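(* Let $N\ge1$, $s\in(0,1)$, and let $\Omega\subset\mathbb{R}^N$ be a bounded open set of class $C^{1,1}$ with outer unit normal $\nu$ on $\partial\Omega$. Let $\mathcal{X}\in C^{0,1}(\mathbb{R}^N,\mathbb{R}^N)$ satisfy $$\mathrm{div}\,\mathcal{X}(x)\ge c_1\ \text{ for a.e. }x\in\mathbb{R}^N\qquad\text{and}\qquad(\mathcal{X}(x)-\mathcal{X}(y))\cdot(x-y)\le c_2|x-y|^2\ \text{ for all }x,y\in\mathbb{R}^N$$ with some constants $c_2>0$ and $c_1\in(\frac{c_2N}{2},c_2N]$. Suppose that $$0<s<\frac{c_1}{c_2}-\frac N2,\qquad p>\frac{2N}{\frac{2c_1}{c_2}-(N+2s)},$$ and let $u\in\mathcal{H}^s_0(\Omega)\cap L^\infty(\Omega)$ be a weak solution of $$(-\Delta)^su=|u|^{p-2}u\ \text{ in }\Omega,\qquad u=0\ \text{ on }\mathbb{R}^N\setminus\Omega.$$ If $\mathcal{X}\cdot\nu\ge0$ on $\partial\Omega$, then $u\equiv0$.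
   Context: $c_{N,s}=\pi^{-N/2}s4^s\frac{\Gamma(\frac N2+s)}{\Gamma(1-s)}$ with $\Gamma$ the Gamma function, and $$\mathcal{E}(v,w)=\frac{c_{N,s}}{2}\int_{\mathbb{R}^N}\int_{\mathbb{R}^N}\frac{(v(x)-v(y))(w(x)-w(y))}{|x-y|^{N+2s}}\,dx\,dy.$$ $H^s(\mathbb{R}^N)=\{u\in L^2(\mathbb{R}^N):\mathcal{E}(u,u)<\infty\}$ (real-valued functions), $\mathcal{H}^s_0(\Omega)=\{u\in H^s(\mathbb{R}^N):u\equiv0\text{ on }\mathbb{R}^N\setminus\Omega\}$. A function $u\in\mathcal{H}^s_0(\Omega)\cap L^\infty(\Omega)$ is a weak solution of $(-\Delta)^su=f(u)$ in $\Omega$, $u=0$ on $\mathbb{R}^N\setminus\Omega$, if $\mathcal{E}(u,v)=\int_\Omega f(u)v\,dx$ for all $v\in\mathcal{H}^s_0(\Omega)$. $C^{0,1}(\mathbb{R}^N,\mathbb{R}^N)$ is the set of globally Lipschitz vector fields (not necessarily bounded); $\mathrm{div}\,\mathcal{X}$ is defined a.e. *)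

(* Defs.v *)
From HB Require Import structures.
From mathcomp Require Import all_boot all_order all_algebra.
From mathcomp Require Import all_classical all_reals all_analysis.
Set Implicit Arguments.
Unset Strict Implicit.
Unset Printing Implicit Defensive.
Import Order.TTheory GRing.Theory Num.Theory.
Import numFieldNormedType.Exports.
Local Open Scope classical_set_scope.
Local Open Scope ring_scope.

(* Row vectors over a measurable type carry the product sigma-algebra, as tuples
   do in the library; for R-valued ones this is the Borel sigma-algebra. *)
Definition measure_rV_display : measure_display -> measure_display.
Proof. exact. Qed.

Section measurable_rV.
Context {d} {T : sigmaRingType d}.
Variable n : nat.

Let coor : 'I_n -> 'rV[T]_n -> T := fun i x => x ord0 i.

Let rV_set0 : g_sigma_preimage coor set0.
Proof. exact: sigma_algebra0. Qed.

Let rV_setC A : g_sigma_preimage coor A -> g_sigma_preimage coor (~` A).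
Proof. exact: sigma_algebraC. Qed.

Let rV_bigcup (F : _^nat) : (forall i, g_sigma_preimage coor (F i)) ->
  g_sigma_preimage coor (\bigcup_i (F i)).
Proof. exact: sigma_algebra_bigcup. Qed.

HB.instance Definition _ := @isMeasurable.Build (measure_rV_display d)
  'rV[T]_n (g_sigma_preimage coor) rV_set0 rV_setC rV_bigcup.

End measurable_rV.

Lemma measurable_coord d (T : sigmaRingType d) n (i : 'I_n) :
  measurable_fun [set: 'rV[T]_n] (fun x : 'rV[T]_n => x ord0 i).
Proof.
move=> _ Y mY; rewrite setTI; apply: sub_sigma_algebra => /=.
rewrite -bigcup_seq/=; exists i => /=; first by rewrite mem_index_enum.
by exists Y => //; rewrite setTI.
Qed.

Lemma measurable_fun_rVP d1 d2 (T1 : measurableType d1) (T2 : measurableType d2)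
    n (f : T1 -> 'rV[T2]_n) :
  (forall i, measurable_fun [set: T1] (fun x => f x ord0 i)) ->
  measurable_fun [set: T1] f.
Proof.
move=> mf.
suff fS : g_sigma_preimage (fun i (x : T1) => f x ord0 i) `<=` measurable.
  have := @g_sigma_preimage_comp _ T2 n _ (fun i (x : 'rV[T2]_n) => x ord0 i) _ f.
  move=> E _ A mA; apply: fS.
  rewrite (_ : (fun i x => _) = (fun i => (fun x : 'rV[T2]_n => x ord0 i) \o f))//.
  by rewrite E; exists A.
apply: smallest_sub; first exact: sigma_algebra_measurable.
case: n => [|n] in f mf *; first by rewrite big_ord0.
rewrite -bigcup_mkord_ord; apply: bigcup_sub => i Ii.
by move=> A [B mB <-]; exact: mf.
Qed.

(* Canonical inference finds the library's sub-probability instance on product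
   measures before the sigma-finite one, so sigma-finiteness is passed by hand. *)
Lemma product_measure1_sigma_finite d1 d2 (T1 : measurableType d1)
    (T2 : measurableType d2) (R : realType)
    (m1 : {sigma_finite_measure set T1 -> \bar R})
    (m2 : {sigma_finite_measure set T2 -> \bar R}) :
  sigma_finite setT (m1 \x m2)%E.
Proof.
have /sigma_finiteP[F [TF ndF Foo]] := sigma_finiteT m1.
have /sigma_finiteP[G [TG ndG Goo]] := sigma_finiteT m2.
exists (fun n => F n `*` G n).
  rewrite -setXTT TF TG predeqE => -[x y]; split.
    move=> [/= [n _ Fnx] [k _ Gky]]; exists (maxn n k) => //; split.
    - by move: x Fnx; exact/subsetPset/ndF/leq_maxl.
    - by move: y Gky; exact/subsetPset/ndG/leq_maxr.
  by move=> [n _ []/= ? ?]; split; exists n.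
move=> k; have [? ?] := Foo k; have [? ?] := Goo k.
split; first exact: measurableX.
by rewrite product_measure1E// lte_mul_pinfty// ge0_fin_numE.
Qed.

Section lebesgue_measure_rV.
Context {R : realType}.

Definition rV_cons n (p : R * 'rV[R]_n) : 'rV[R]_n.+1 :=
  row_mx p.1%:M p.2.

Lemma rV_cons0 n (p : R * 'rV[R]_n) : rV_cons p ord0 ord0 = p.1.
Proof.
rewrite /rV_cons (_ : ord0 = @lshift 1 n ord0); last exact/val_inj.
by rewrite (row_mxEl p.1%:M p.2) mxE.
Qed.

Lemma rV_consS n (p : R * 'rV[R]_n) i :
  rV_cons p ord0 (lift ord0 i) = p.2 ord0 i.
Proof.
rewrite /rV_cons (_ : lift ord0 i = rshift 1 i); last exact/val_inj.
by rewrite (row_mxEr p.1%:M p.2).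
Qed.

Lemma rV_consK n (x : 'rV[R]_n.+1) :
  rV_cons (x ord0 ord0, \row_j x ord0 (lift ord0 j)) = x.
Proof.
apply/rowP => i; case: (unliftP ord0 i) => [j ->|->].
  by rewrite rV_consS mxE.
by rewrite rV_cons0.
Qed.

Lemma measurable_rV_cons n :
  measurable_fun [set: measurableTypeR R * 'rV[R]_n] (@rV_cons n).
Proof.
apply: measurable_fun_rVP => i; case: (unliftP ord0 i) => [j ->|->].
- rewrite (_ : (fun _ => _) = (fun x : 'rV[R]_n => x ord0 j) \o snd).
    by apply: measurableT_comp => //; exact: measurable_coord.
  by apply/funext => p /=; exact: rV_consS.
- rewrite (_ : (fun _ => _) = fst)//.
  by apply/funext => p /=; exact: rV_cons0.
Qed.

Let rV_uncons n (x : 'rV[R]_n.+1) : measurableTypeR R * 'rV[R]_n :=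
  (x ord0 ord0, \row_j x ord0 (lift ord0 j)).

Let measurable_rV_uncons n :
  measurable_fun [set: 'rV[R]_n.+1] (@rV_uncons n).
Proof.
apply: measurable_fun_pair => /=; first exact: measurable_coord.
apply: measurable_fun_rVP => i.
rewrite (_ : (fun _ => _) = (fun x : 'rV[R]_n.+1 => x ord0 (lift ord0 i))).
  exact: measurable_coord.
by apply/funext => x /=; rewrite mxE.
Qed.

Section step.
Variables (n : nat) (mu : {sigma_finite_measure set 'rV[R]_n -> \bar R}).

Definition lebesgue_rV_step : set 'rV[R]_n.+1 -> \bar R :=
  pushforward (@lebesgue_measure R \x mu)%E (@rV_cons n).

Let step0 : lebesgue_rV_step set0 = 0%E.
Proof. by rewrite /lebesgue_rV_step /pushforward preimage_set0 measure0. Qed.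

Let step_ge0 A : (0 <= lebesgue_rV_step A)%E.
Proof. by rewrite /lebesgue_rV_step /pushforward measure_ge0. Qed.

Let step_sigma_additive : semi_sigma_additive lebesgue_rV_step.
Proof.
have mc := @measurable_rV_cons n.
move=> F mF tF mUF; rewrite /lebesgue_rV_step /pushforward preimage_bigcup.
apply: measure_semi_sigma_additive.
- by move=> k; rewrite -[X in measurable X]setTI; exact: mc.
- apply/trivIsetP => /= i j _ _ ij; rewrite -preimage_setI.
  by move/trivIsetP : tF => /(_ _ _ _ _ ij) ->//; rewrite preimage_set0.
- by rewrite -preimage_bigcup -[X in measurable X]setTI; exact: mc.
Qed.

HB.instance Definition _ := isMeasure.Build _ _ _ lebesgue_rV_step
  step0 step_ge0 step_sigma_additive.

Let step_sigma_finite : sigma_finite setT lebesgue_rV_step.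
Proof.
have [F TF mF] := product_measure1_sigma_finite (@lebesgue_measure R) mu.
exists (fun k => @rV_uncons n @^-1` F k).
  by rewrite -preimage_bigcup -TF preimage_setT.
move=> k; have [mFk Fk] := mF k; split.
  by rewrite -[X in measurable X]setTI; exact: measurable_rV_uncons.
rewrite /lebesgue_rV_step /pushforward -comp_preimage.
rewrite (_ : _ \o _ = id) ?preimage_id//.
apply/funext => -[t y] /=; congr pair; first exact: rV_cons0.
by apply/rowP => j; rewrite mxE rV_consS.
Qed.

HB.instance Definition _ := Measure_isSigmaFinite.Build _ _ _ lebesgue_rV_step
  step_sigma_finite.

End step.

Fixpoint lebesgue_measure_rV n :
    {sigma_finite_measure set 'rV[R]_n -> \bar R} :=
  if n is m.+1 then lebesgue_rV_step (lebesgue_measure_rV m)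
  else \d_(0 : 'rV[R]_0).

Lemma lebesgue_measure_rV_box n (A : 'I_n -> set (measurableTypeR R)) :
  (forall i, measurable (A i)) ->
  lebesgue_measure_rV n [set x | forall i, A i (x ord0 i)] =
  (\prod_(i < n) lebesgue_measure (A i))%E.
Proof.
elim: n A => [|n IH] A mA.
  by rewrite big_ord0 /= diracE mem_set// => -[].
rewrite big_ord_recl -IH//= /lebesgue_rV_step /pushforward.
rewrite -product_measure1E//; last first.
  rewrite [X in measurable X](_ : _ =
    \bigcap_(i : 'I_n) ((fun x : 'rV[R]_n => x ord0 i) @^-1` A (lift ord0 i))).
    apply: fin_bigcap_measurable => // i _.
    rewrite -[X in measurable X]setTI; apply: measurable_coord => //.
    exact: mA.
  by apply/seteqP; split => x /= h i; [move=> _; exact: h|exact: (h i I)].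
congr (_ _); apply/seteqP; split => -[t y] /=.
- move=> h; split; first by have := h ord0; rewrite rV_cons0.
  by move=> i; have := h (lift ord0 i); rewrite rV_consS.
- move=> [h0 h] i; case: (unliftP ord0 i) => [j ->|->].
    by rewrite rV_consS.
  by rewrite rV_cons0.
Qed.

End lebesgue_measure_rV.

Section euclidean.
Context {R : realType} {N : nat}.
Implicit Types x y : 'rV[R]_N.

Definition dot x y : R := \sum_(i < N) x ord0 i * y ord0 i.

(* The library norm on row vectors is the sup norm. *)
Definition enorm x : R := Num.sqrt (dot x x).

Definition grad (g : 'rV[R]_N -> R) x : 'rV[R]_N :=
  \row_i 'D_(delta_mx ord0 i) g x.

(* Classical divergence; the value is only meaningful where the partial
   derivatives exist, i.e. almost everywhere if X is Lipschitz. *)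
Definition divergence (X : 'rV[R]_N -> 'rV[R]_N) x : R :=
  \sum_(i < N) 'D_(delta_mx ord0 i) (fun y => X y ord0 i) x.

Definition topological_boundary (A : set 'rV[R]_N) : set 'rV[R]_N :=
  closure A `\` interior A.

End euclidean.

Section C11_domain.
Context {R : realType} {N : nat}.
Implicit Types (Omega : set 'rV[R]_N) (x : 'rV[R]_N).

Definition C11 n (g : 'rV[R]_n -> R) : Prop :=
  (forall y, differentiable g y) /\ lipschitz (grad g).

(* In the orthonormal coordinates z = x *m Q, and inside the ball of radius r
   about x0, Omega lies strictly above the graph of g, which gives the i-th
   coordinate of z in terms of the N-1 others. *)
Definition C11_chart Omega (x0 : 'rV[R]_N) (r : R) (Q : 'M[R]_N) (i : 'I_N)
    (g : 'rV[R]_N.-1 -> R) : Prop :=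
  [/\ 0 < r, Q *m Q^T = 1%:M, C11 g &
      forall x, enorm (x - x0) < r ->
        (Omega x <-> g (col' i (x *m Q)) < (x *m Q) ord0 i)].

Definition C11_domain Omega : Prop :=
  forall x0, topological_boundary Omega x0 ->
    exists r Q i g, C11_chart Omega x0 r Q i g.

(* Gradient of z |-> g (z without its i-th coordinate) - z_i. *)
Definition graph_conormal (i : 'I_N) (g : 'rV[R]_N.-1 -> R) (z : 'rV[R]_N) :
    'rV[R]_N :=
  \row_j if unlift i j is Some k then grad g (col' i z) ord0 k else - 1.

Definition outer_unit_normal Omega x (nu : 'rV[R]_N) : Prop :=
  exists r Q i g, C11_chart Omega x r Q i g /\
    let w := graph_conormal i g (x *m Q) in
    nu = (enorm w)^-1 *: (w *m Q^T).

End C11_domain.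

Section fractional_laplacian.
Context {R : realType}.
Local Open Scope ereal_scope.

Definition Gamma (a : R) : R :=
  Rintegral (@lebesgue_measure R) `]0%R, +oo[
    (fun t => t `^ (a - 1) * expR (- t))%R.

Definition c_Ns (N : nat) (s : R) : R :=
  (pi `^ (- (N%:R / 2)) * s * 4 `^ s * Gamma (N%:R / 2 + s) / Gamma (1 - s))%R.

Context {N : nat}.
Local Notation mu := (@lebesgue_measure_rV R N).
Implicit Types (s : R) (u v w : 'rV[R]_N -> R) (Omega : set 'rV[R]_N).

Definition energy s v w : \bar R :=
  (c_Ns N s / 2)%:E *
  \int[mu]_y \int[mu]_x
    ((v x - v y) * (w x - w y) / enorm (x - y) `^ (N%:R + 2 * s))%R%:E.

Definition Hs s u : Prop := u \in Lfun mu 2%:E /\ energy s u u < +oo.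

(* Functions stand for their classes modulo almost everywhere equality. *)
Definition Hs0 s Omega u : Prop :=
  Hs s u /\ {ae mu, forall x, (~` Omega) x -> u x = 0%R}.

Definition weak_solution s Omega (f : R -> R) u : Prop :=
  [/\ Hs0 s Omega u, finite_norm mu +oo (u \_ Omega) &
      forall v, Hs0 s Omega v ->
        energy s u v = \int[mu]_(x in Omega) (f (u x) * v x)%:E].

End fractional_laplacian.

(* Main.v *)
Require Import Defs.
From HB Require Import structures.
From mathcomp Require Import all_boot all_order all_algebra.
From mathcomp Require Import ring lra.
From mathcomp Require Import all_classical all_reals all_analysis.
From mathcomp Require Import measurable_realfun.
Set Implicit Arguments.
Unset Strict Implicit.
Unset Printing Implicit Defensive.
Import Order.TTheory GRing.Theory Num.Theory.
Import numFieldNormedType.Exports.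
Local Open Scope classical_set_scope.
Local Open Scope ring_scope.

(* Perturb X to a Lipschitz field Y pointing strictly outwards on the boundary,
   with constants alpha < c1 and gamma > c2, and let T x = x + h Y x. For small
   h > 0 the map T preserves the complement of Omega, expands distances by at
   most exp (h gamma), and multiplies volumes by a factor between exp (h alpha)
   and exp (h N gamma), so v = u o T is an admissible test function. Scaling
   bounds the energy of v by exp (- h mu) times that of u, where
   mu = 2 alpha - gamma (N + 2 s); testing the equation with u and v and using
   that |t|^p / p is convex up to a quadratic error gives, for w = u - v,
     E(w, w) + delta h |u|_p^p <= C |w|_2^2,   delta > 0,
   as soon as p > 2 N gamma / mu. This inequality forces w to vary slowly:
   w o T^k is L2-close to w as long as k h is small, and summing w o T^k over
   k < tau / h yields |w|_2 = O(h). Hence delta h |u|_p^p = O(h^2), so u = 0. *)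

(** * Densities and image measures *)

(** The solution [u] is only bounded with finite energy, so neither its gradient nor its boundary
    behaviour is available for an integral identity. Inserting a competitor into the weak equation
    avoids both: every gain is linear in h, errors of order h^2 are harmless, and a single Euler
    step can replace the flow of the field. Strict outwardness is what an Euler step requires, since
    a tangential step may enter Omega by O(h^2); the strict gaps alpha < c1 and gamma > c2 absorb
    the second-order errors in volumes and distances. In mu, the kernel contributes exp (h gamma (N
    + 2 s)) and each of the two integrations exp (- h alpha). The comparison of |v|_p^p with |u|_p^p
    costs 2 N gamma / p, so that at alpha = c1, gamma = c2 the condition on p is the stated one. The
    obstacle is the error C |w|_2^2: it competes with delta h |u|_p^p, and no derivative of [u] is
    there to make it small. As T is merely Lipschitz, its change of variables is obtained by moving
    one coordinate at a time, each move being a monotone Lipschitz map on lines. *)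

Section lsup.
Context {R : realType}.
Implicit Types a b : nat -> R.

(** An upper limit is defined for every sequence, is measurable in a parameter and respects
    inequalities up to an additive error. Derivatives that exist only almost everywhere thus become
    measurable functions defined everywhere. *)
Definition lsup a : R := fine (limn_esup (EFin \o a)).

Lemma lsup_bounds a (m M : R) : (forall n, m <= a n <= M) ->
  limn_esup (EFin \o a) \is a fin_num /\ m <= lsup a <= M.
Proof.
move=> h.
have h1 : (limn_esup (EFin \o a) <= M%:E)%E.
  rewrite limn_esup_lim; apply: lime_le; first exact: is_cvg_esups.
  near=> k; apply: ge_ereal_sup => _ [j /= _ <-] /=.
  by rewrite lee_fin; case/andP: (h j).
have h2 : (m%:E <= limn_esup (EFin \o a))%E.
  rewrite limn_esup_lim; apply: lime_ge; first exact: is_cvg_esups.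
  near=> k; apply: (@le_trans _ _ (a k)%:E).
    by rewrite lee_fin; case/andP: (h k).
  by apply: ereal_sup_ubound; exists k => /=.
have fin : limn_esup (EFin \o a) \is a fin_num.
  rewrite fin_numElt (lt_le_trans _ h2) ?ltNyr//=.
  by rewrite (le_lt_trans h1) ?ltry.
split=> //; rewrite /lsup -!lee_fin fineK// h1 h2 //.
Unshelve. all: by end_near. Qed.

Lemma lsup_dist a b (m M e : R) : (forall n, m <= a n <= M) ->
  (forall n, m <= b n <= M) ->
  (forall n, a n <= b n + e) -> lsup a <= lsup b + e.
Proof.
move=> ha hb hab.
have [fa _] := lsup_bounds ha; have [fb _] := lsup_bounds hb.
rewrite -lee_fin EFinD /lsup !fineK//.
rewrite -leeBlDr//; apply: le_ereal_inf_tmp => /= _ [A [r r0 rA] <-].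
rewrite EFinN leeBlDr//.
apply: (@le_trans _ _ (ereal_sup [set (EFin \o a) n | n in A])).
  by apply: ereal_inf_lbound; exists A => //; exists r.
apply: ge_ereal_sup => _ [n An <-] /=.
apply: (@le_trans _ _ ((b n)%:E + e%:E)%E); first by rewrite -EFinD lee_fin.
by apply: leeD => //; apply: ereal_sup_ubound; exists n.
Qed.

Lemma lsup_cvg a (l : R) : a @ \oo --> l -> lsup a = l.
Proof.
move=> al; have /cvg_limn_einf_sup[_] : (EFin \o a) @ \oo --> l%:E.
  by apply: cvg_EFin => //; exact: nearW.
by rewrite /lsup => ->.
Qed.

Lemma measurable_lsup d (T : measurableType d) (f : nat -> T -> R) :
  (forall n, measurable_fun setT (f n)) ->
  measurable_fun setT (fun x => lsup (f ^~ x)).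
Proof.
move=> mf.
have mg : measurable_fun setT (fun x => limn_esup (fun n => (f n x)%:E)).
  by apply: measurable_fun_limn_esup => n; exact/measurable_EFinP.
exact: (measurableT_comp (fine_measurable measurableT) mg).
Qed.

End lsup.

Section density.
Import HBNNSimple.
Context d (T : measurableType d) {R : realType}.
Variables (mu : {measure set T -> \bar R}) (f : T -> R).
Hypotheses (mf : measurable_fun setT f) (f0 : forall x, 0 <= f x).
Local Open Scope ereal_scope.

Definition density_measure (A : set T) : \bar R := \int[mu]_(x in A) (f x)%:E.

Let density0 : density_measure set0 = 0.
Proof. exact: integral_set0. Qed.

Let density_ge0 A : 0 <= density_measure A.
Proof. by apply: integral_ge0 => x _; rewrite lee_fin. Qed.

Let density_sigma_additive : semi_sigma_additive density_measure.
Proof.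
by apply: semi_sigma_additive_nng_induced => //; exact/measurable_EFinP.
Qed.

HB.instance Definition _ := isMeasure.Build _ _ _ density_measure
  density0 density_ge0 density_sigma_additive.

Definition density : {measure set T -> \bar R} := density_measure.

(** Monotone convergence along [nnsfun_approx] reduces the formula to simple functions, linearity
    reduces it to indicators, and for these it is the definition of [density_measure]. *)
Lemma ge0_integral_density (g : T -> \bar R) : measurable_fun setT g ->
  (forall x, 0 <= g x) ->
  \int[density]_x g x = \int[mu]_x (g x * (f x)%:E).
Proof.
move=> mg g0; pose g_ := nnsfun_approx measurableT mg.
have gcvg x : (fun n => (g_ n x)%:E) @ \oo --> g x.
  by apply: cvg_nnsfun_approx => // y _; exact: g0.
have gnd x : {homo (fun n => (g_ n x)) : m n / (m <= n)%N >-> (m <= n)%R}.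
  by move=> m n mn; exact/lefP/nd_nnsfun_approx.
transitivity (limn (fun n => \int[density]_x (g_ n x)%:E)).
  rewrite -monotone_convergence//.
  - by apply: eq_integral => x _; apply/esym/cvg_lim => //; exact: gcvg.
  - by move=> n; exact/measurable_EFinP.
  - by move=> n x _; rewrite lee_fin.
  - by move=> x _ m n mn; rewrite lee_fin; exact: gnd.
transitivity (limn (fun n => \int[mu]_x ((g_ n x)%:E * (f x)%:E))); last first.
  rewrite -monotone_convergence//.
  - apply: eq_integral => x _; apply/cvg_lim => //.
    by apply: cvgeZr => //; exact: gcvg.
  - by move=> n; apply: emeasurable_funM; exact/measurable_EFinP.
  - by move=> n x _; rewrite mule_ge0// lee_fin.
  - by move=> x _ m n mn; rewrite lee_wpmul2r// ?lee_fin//; exact: gnd.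
congr (limn _); apply/funext => n.
transitivity (\sum_(k \in range (g_ n))
    \int[density]_x (k * \1_(g_ n @^-1` [set k]) x)%:E).
  under eq_integral do rewrite fimfunE -fsumEFin//.
  rewrite ge0_integral_fsum//.
  - by move=> y; exact/measurable_EFinP/measurable_funM.
  - by move=> y x _; rewrite nnfun_muleindic_ge0.
transitivity (\sum_(k \in range (g_ n))
    \int[mu]_x (k%:E * ((\1_(g_ n @^-1` [set k]) x)%:E * (f x)%:E))); last first.
  have E x : (g_ n x)%:E * (f x)%:E = \sum_(k \in range (g_ n))
      (k%:E * ((\1_(g_ n @^-1` [set k]) x)%:E * (f x)%:E)).
    rewrite [in LHS]fimfunE -fsumEFin// ge0_mule_fsuml//.
      by apply: eq_fsbigr => k _; rewrite EFinM muleA.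
    by move=> k; exact: nnfun_muleindic_ge0.
  under [RHS]eq_integral do rewrite E.
  rewrite ge0_integral_fsum//.
  - move=> k; apply: emeasurable_funM => //.
    by apply: emeasurable_funM; exact/measurable_EFinP.
  - move=> k x _; rewrite muleA; apply: mule_ge0; last by rewrite lee_fin.
    by rewrite -EFinM; exact: nnfun_muleindic_ge0.
apply: eq_fsbigr => k; rewrite inE/= => -[x _ gk].
have k0 : (0 <= k)%R by rewrite -gk.
rewrite [LHS](eq_integral (fun y => k%:E * (\1_(g_ n @^-1` [set k]) y)%:E)); last first.
  by move=> y _; rewrite EFinM.
rewrite !ge0_integralZl//.
- congr (_ * _); rewrite integral_indic// setIT/= /density_measure.
  rewrite integral_mkcond; apply: eq_integral => y _.
  by rewrite patchE indicE; case: ifPn; rewrite ?mul1e ?mul0e.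
- by apply: emeasurable_funM; exact/measurable_EFinP.
- by move=> y _; rewrite mule_ge0// lee_fin.
- by exact/measurable_EFinP.
Qed.

End density.

Section ae.
Context d (T : measurableType d) {R : realType}.
Variable mu : {measure set T -> \bar R}.

Lemma ae_imp (P Q : T -> Prop) : (forall x, P x -> Q x) ->
  {ae mu, forall x, P x} -> {ae mu, forall x, Q x}.
Proof.
by move=> PQ [A [mA A0 PA]]; exists A; split=> // x nQ; apply: PA => /PQ.
Qed.

Lemma ae_imp2 (P Q S : T -> Prop) : (forall x, P x -> Q x -> S x) ->
  {ae mu, forall x, P x} -> {ae mu, forall x, Q x} -> {ae mu, forall x, S x}.
Proof.
move=> PQ aeP aeQ.
have : mu.-negligible (~` P `|` ~` Q) by exact: negligibleU.
move=> [A [mA A0 PA]]; exists A; split=> // x nS; apply: PA.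
by apply: contrapT => /not_orP[/contrapT Px /contrapT Qx]; exact/nS/PQ.
Qed.

End ae.

Definition pushm d d' (T1 : measurableType d) (T2 : measurableType d')
    (R : realType) (m : {measure set T1 -> \bar R}) (f : T1 -> T2)
    (mf : measurable_fun setT f) : {measure set T2 -> \bar R} :=
  measure_function_pushforward__canonical__measure_function_Measure m mf.

Lemma ge0_integral_pushm d d' (T1 : measurableType d) (T2 : measurableType d')
    (R : realType) (m : {measure set T1 -> \bar R}) (f : T1 -> T2)
    (mf : measurable_fun setT f) (g : T2 -> \bar R) :
  measurable_fun setT g -> (forall y, 0 <= g y)%E ->
  (\int[pushm m mf]_y g y = \int[m]_x g (f x))%E.
Proof.
by move=> mg g0; rewrite ge0_integral_pushforward// preimage_setT.
Qed.

(** * Change of variables on the line *)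

Section one_dimension.
Context {R : realType}.
Local Notation mu := (@lebesgue_measure R).
Implicit Types phi : R -> R.

(** Monotonicity makes [phi] the distribution function of a Stieltjes measure, and the upper bound
    keeps this measure below [k] times Lebesgue measure. Other Lipschitz functions are brought to
    this form by adding a linear one. *)
Definition nd_lip (k : R) phi :=
  forall x y, x <= y -> 0 <= phi y - phi x <= k * (y - x).

(** The steps 1/(n+1) form one fixed sequence, which gives measurability in [x] for continuous [f];
    where the directional derivative exists, it is the value. *)
Definition dini (V : lmodType R) (f : V -> R) (v x : V) : R :=
  lsup (fun n => n.+1%:R * (f (n.+1%:R^-1 *: v + x) - f x)).

Lemma cvg_invS : (fun n => n.+1%:R^-1 : R) @ \oo --> (0 : R)^'.
Proof.
move=> A [e /= e0 eA].
suff : \forall n \near \oo, A (n.+1%:R^-1 : R) by [].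
near=> n; apply: eA; last by rewrite invr_neq0// pnatr_eq0.
near: n; have /cvgrPdist_lt := @cvg_harmonic R; exact.
Unshelve. all: by end_near. Qed.

Lemma derivable_dini (V : normedModType R) (f : V -> R) (v x : V) :
  derivable f x v -> dini f v x = 'D_v f x.
Proof.
move=> /cvg_ex[/= l fl].
have -> : 'D_v f x = l by apply/cvg_lim.
apply: lsup_cvg.
have := cvg_comp _ _ cvg_invS fl.
rewrite (_ : _ \o _ = (fun n => n.+1%:R * (f (n.+1%:R^-1 *: v + x) - f x)))//.
by apply/funext => n /=; rewrite invrK.
Qed.

Lemma near_shift_derive (F phi : R -> R) (c x l : R) :
  {near x, F =1 (fun y => phi y - c)} -> derivable F x 1 -> 'D_1 F x = l ->
  derivable phi x 1 /\ 'D_1 phi x = l.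
Proof.
move=> Fphi dF <-.
have E : (fun h : R => h^-1 *: (phi (h *: 1 + x) - c - (phi x - c))) =
         (fun h : R => h^-1 *: (phi (h *: 1 + x) - phi x)).
  by apply/funext => h; congr (_ *: _); ring.
have := near_eq_derivable Fphi dF; have := near_eq_derive (1 : R^o) Fphi.
by rewrite /derivable /derive E.
Qed.

Variables (k : R) (phi : R -> R).
Hypothesis lphi : nd_lip k phi.

Lemma nd_lip_continuous : continuous phi.
Proof.
move=> x; apply/cvgrPdist_le => /= e e0.
have k1 : 0 < `|k| + 1 by rewrite ltr_wpDl.
near=> y.
have yx : `|x - y| <= e / (`|k| + 1).
  near: y; apply: cvgr_dist_le; first exact: cvg_id.
  by rewrite divr_gt0.
have H : forall a b, a <= b -> `|phi b - phi a| <= (`|k| + 1) * (b - a).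
  move=> a b ab; have /andP[h1 h2] := lphi ab.
  rewrite ger0_norm//; apply: (le_trans h2).
  rewrite ler_wpM2r ?subr_ge0//.
  by rewrite (le_trans (ler_norm k))// lerDl.
have {H}H : `|phi x - phi y| <= (`|k| + 1) * `|x - y|.
  have [xy|yx'] := leP x y.
    by rewrite distrC (distrC x) (ger0_norm (x := y - x)) ?subr_ge0//; exact: H.
  rewrite (ger0_norm (x := x - y)) ?subr_ge0 ?(ltW yx')//.
  by apply: H; exact: ltW.
by rewrite (le_trans H)// mulrC -ler_pdivlMr.
Unshelve. all: by end_near. Qed.

Let phi_nd : {homo phi : x y / x <= y}.
Proof. by move=> x y xy; have /andP[+ _] := lphi xy; rewrite subr_ge0. Qed.

Let phi_mixin :=
  isCumulative.Build R _ R phi phi_nd (right_continuousW nd_lip_continuous).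

Let phi_cum : cumulative R R := HB.pack_for (cumulative R R) phi phi_mixin.

Local Notation nu := (lebesgue_stieltjes_measure phi_cum).

Lemma nd_lip_measure_itv a b : a <= b -> nu `]a, b] = (phi b - phi a)%:E.
Proof.
move=> ab; rewrite /lebesgue_stieltjes_measure /measure_extension.
rewrite measurable_mu_extE//=; last exact: is_ocitv.
by rewrite wlength_itv_bnd.
Qed.

(* The Lebesgue-Stieltjes measure of phi is dominated on half-open intervals,
   hence, going through coverings, on null sets. *)
Lemma nd_lip_dominates : nu `<< mu.
Proof.
have k0 : 0 <= k.
  by have /andP[h1 h2] := lphi (@ler01 R); rewrite subr0 mulr1 in h2; exact: le_trans h2.
have kw (X : set (ocitv_type R)) : measurable X ->
    (wlength phi X <= k%:E * wlength idfun X)%E.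
  move=> [[a b] _ <-] /=; have [ab|ba] := leP a b.
    rewrite !wlength_itv_bnd//= -EFinM lee_fin.
    by have /andP[] := lphi ab.
  rewrite set_itv_ge ?wlength0 ?mule0//.
  by rewrite bnd_simp -leNgt ltW.
apply/null_content_dominatesP => A mA A0.
apply/eqP; rewrite eq_le measure_ge0 andbT; apply/lee_addgt0Pr => e e0.
have k1 : 0 < k + 1 by rewrite ltr_wpDl.
have muAe : (mu A < (e / (k + 1))%:E)%E.
  by rewrite A0; have := divr_gt0 e0 k1; rewrite -lte_fin.
move: muAe; rewrite /lebesgue_measure /lebesgue_stieltjes_measure
  /measure_extension => /ereal_inf_lt[_ [F [mF AF] <-] Fe].
apply: (@le_trans _ _ (\sum_(i <oo) wlength phi (F i))%E).
  by apply: ereal_inf_lbound; exists F.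
have w0 i : (0 <= wlength idfun (F i))%E by exact: (wlength_ge0 (idfun : cumulative R R)).
apply: (@le_trans _ _ (\sum_(i <oo) k%:E * wlength idfun (F i))%E).
  by apply: lee_nneseries => i *; [exact: (wlength_ge0 phi_cum)|exact: kw].
rewrite nneseriesZl// add0e.
apply: (@le_trans _ _ (k%:E * (e / (k + 1))%:E)%E).
  by rewrite lee_wpmul2l ?lee_fin// ltW.
rewrite -EFinM lee_fin mulrCA ger_pMr//; last first.
by rewrite ler_pdivrMr// mul1r lerDl.
Qed.


(** Cutting down to a bounded interval makes the Stieltjes measure finite, so that the Radon-Nikodym
    theorem provides a density. *)
Let nd_lip_local_density (M : R) : 0 < M -> exists f : R -> R,
  [/\ mu.-integrable setT (EFin \o f) &
     forall a b, - M <= a -> a <= b -> b <= M ->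
       (\int[mu]_(x in `]a, b]) (f x)%:E = (phi b - phi a)%:E)%E].
Proof.
move=> M0; pose D := `]- M, M]%classic : set (measurableTypeR R).
have mD : measurable D by exact: measurable_itv.
have Doo : (nu D < +oo)%E by rewrite nd_lip_measure_itv ?ltry// ge0_cp// ltW.
have dom : mfrestr mD Doo `<< mu.
  apply/null_content_dominatesP => A mA A0.
  rewrite /mfrestr /mrestr; apply/eqP; rewrite eq_le measure_ge0 andbT.
  have /null_content_dominatesP/(_ A mA A0) <- := nd_lip_dominates.
  by rewrite le_measure// inE//; exact: measurableI.
have [f [f0 ffin intf fE]] := radon_nikodym_sigma_finite dom.
have fK : EFin \o (fine \o f) = f by apply/funext => x /=; rewrite fineK.
exists (fine \o f); rewrite fK; split => // a b Ma ab bM.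
rewrite (_ : (fun x => _) = f); last exact: fK.
rewrite -fE//= /mfrestr /mrestr -nd_lip_measure_itv//; congr (nu _).
apply/setIidl => x /=; rewrite !in_itv/= => /andP[ax xb].
by rewrite /D/= in_itv/= (le_lt_trans Ma ax) (le_trans xb bM).
Qed.

(** Up to a constant [phi] is locally the indefinite integral of the density, so Lebesgue
    differentiation, in the form of [FTC1], identifies the density with the derivative. *)
Let nd_lip_local_derivable (M : R) : 0 < M -> exists f : R -> R,
  [/\ mu.-integrable setT (EFin \o f),
     (forall a b, - M <= a -> a <= b -> b <= M ->
       (\int[mu]_(x in `]a, b]) (f x)%:E = (phi b - phi a)%:E)%E) &
     {ae mu, forall x, - M < x < M -> derivable phi x 1 /\ 'D_1 phi x = f x}].
Proof.
move=> M0; have [f [intf fE]] := nd_lip_local_density M0.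
exists f; split => //.
have := @FTC1 R f (BRight (- M)).
have intfA A : measurable A -> mu.-integrable A (EFin \o f).
  by move=> mA; exact: integrableS intf.
have locf : locally_integrable [set: R] f.
  by apply: open_integrable_locally => //; exact: openT.
move=> /(_ (fun y => intfA _ (measurable_itv _)) locf).
apply: ae_imp => x H /andP[Mx xM].
have [] := H Mx; set F := fun _ => _ => dF DF.
have Fphi : {near x, F =1 (fun y => phi y - phi (- M))}.
  have : \forall y \near x, y \in `]- M, M[ by apply: near_in_itvoo; rewrite in_itv/= Mx.
  apply: filterS => y; rewrite in_itv/= => /andP[My yM].
  by rewrite /F /Rintegral fE//= ltW.
by apply: near_shift_derive Fphi dF _; rewrite -derive1E.
Qed.

Lemma nd_lip_derivable : {ae mu, forall x, derivable phi x 1}.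
Proof.
have H (n : nat) : {ae mu, forall x, - n.+1%:R < x < n.+1%:R -> derivable phi x 1}.
  have [f [_ _ fD]] := nd_lip_local_derivable (ltr0Sn R n).
  by apply: ae_imp fD => x fx /fx[].
have := ae_foralln H; apply: ae_imp => x Hx.
apply: (Hx (Num.bound `|x|)); rewrite -ltr_norml.
by rewrite (lt_le_trans (archi_boundP _))// ler_nat.
Qed.

Lemma measurable_dini : measurable_fun setT (dini phi (1 : R^o)).
Proof.
have mphi : measurable_fun setT phi.
  by apply: continuous_measurable_fun; exact: nd_lip_continuous.
apply: measurable_lsup => n.
have ms : measurable_fun setT (fun x : R => n.+1%:R^-1 *: (1 : R^o) + x).
  exact: measurable_funD.
apply: measurable_funM => //; apply: measurable_funB => //.
exact: (measurableT_comp mphi ms).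
Qed.

Lemma dini_ge0 x : 0 <= dini phi (1 : R^o) x <= k.
Proof.
apply: (proj2 (lsup_bounds _)) => n; set y : R := _ + x.
have yx : y - x = n.+1%:R^-1 by rewrite /y addrK; exact: mulr1.
have xy : x <= y by rewrite -subr_ge0 yx.
have /andP[h0] := lphi xy; rewrite yx => h1.
by rewrite mulr_ge0//= mulrC -ler_pdivlMr.
Qed.

Lemma nd_lip_integral a b : a <= b ->
  (\int[mu]_(x in `]a, b]) (dini phi (1 : R^o) x)%:E = (phi b - phi a)%:E)%E.
Proof.
move=> ab; pose M := Num.max `|a| `|b| + 1.
have M0 : 0 < M by rewrite ltr_wpDl// le_max normr_ge0.
have aM : `|a| < M by rewrite ltr_pwDr// le_max lexx.
have bM : `|b| < M by rewrite ltr_pwDr// le_max lexx orbT.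
move: aM bM; rewrite !ltr_norml => /andP[Ma _] /andP[_ bM].
have [f [intf fE fD]] := nd_lip_local_derivable M0.
rewrite -(fE a b (ltW Ma) ab (ltW bM)); apply: ae_eq_integral => //.
- by apply: measurable_funTS; apply/measurable_EFinP; exact: measurable_dini.
- by apply: measurable_funTS; exact: measurable_int intf.
- apply: ae_imp fD => x H /=; rewrite in_itv/= => /andP[ax xb].
  have [|dx <-] := H; first by rewrite (lt_trans Ma ax) (le_lt_trans xb bM).
  by rewrite derivable_dini.
Qed.

Lemma nd_lip_change_of_variables (g : R -> \bar R) : injective phi ->
  (forall c, exists a, phi a = c) ->
  measurable_fun setT g -> (forall x, 0 <= g x)%E ->
  (\int[mu]_x g x = \int[mu]_x (g (phi x) * (dini phi (1 : R^o) x)%:E))%E.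
Proof.
move=> phiI phiS mg g0.
have mphi : measurable_fun setT (phi : measurableTypeR R -> measurableTypeR R).
  by apply: continuous_measurable_fun; exact: nd_lip_continuous.
have D0 x : 0 <= dini phi (1 : R^o) x by have /andP[] := dini_ge0 x.
pose m := pushm (density mu measurable_dini D0) mphi.
have mE A : measurable A -> mu A = m A.
  apply: lebesgue_measure_unique => X [[c d] _ <-].
  rewrite [(c, d).1]/= [(c, d).2]/=.
  have phil x y : (phi x < phi y) = (x < y).
    apply/idP/idP; rewrite !ltNge; apply: contraNN; first exact: phi_nd.
    rewrite le_eqVlt => /orP[/eqP/phiI -> //|].
    by apply: contraTT; rewrite -!leNgt -ltNge => /ltW/phi_nd.
  have [ab|ba] := leP c d; last first.
    rewrite set_itv_ge; last by rewrite bnd_simp -leNgt ltW.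
    by rewrite !measure0.
  move: ab; have [a <-] := phiS c; have [b <-] := phiS d => ab.
  have {}ab : a <= b by move: ab; rewrite !leNgt phil.
  rewrite lebesgue_measure_itv/= lte_fin.
  have -> : m `]phi a, phi b]%classic = (\int[mu]_(x in `]a, b]) (dini phi (1 : R^o) x)%:E)%E.
    congr (integral _ _ _); apply/seteqP; split => x /=; rewrite !in_itv/=.
      by rewrite phil !leNgt phil.
    by rewrite phil !leNgt phil.
  rewrite nd_lip_integral// phil -EFinB.
  by case: ltP => // ba; rewrite (le_anti (introT andP (conj ab ba))) subrr.
transitivity (\int[m]_x g x)%E.
  by apply: eq_measure_integral => A mA _; exact: mE.
rewrite ge0_integral_pushm// ge0_integral_density//.
exact: measurableT_comp.
Qed.

End one_dimension.

(** * Coordinate lines *)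

Section coordinate_lines.
Context {R : realType}.
Local Notation leb := (@lebesgue_measure R).
Local Notation mu := (@lebesgue_measure_rV R).

(** [rV_cons] adds a coordinate in front, as in the construction of the measure; insertion at an
    arbitrary position allows slicing along lines parallel to any axis. *)
Definition ins n (k : 'I_n.+1) (t : R) (y : 'rV[R]_n) : 'rV[R]_n.+1 :=
  \row_j if unlift k j is Some i then y ord0 i else t.

Lemma ins_eq n (k : 'I_n.+1) t y : ins k t y ord0 k = t.
Proof. by rewrite mxE unlift_none. Qed.

Lemma ins_lift n (k : 'I_n.+1) t y i : ins k t y ord0 (lift k i) = y ord0 i.
Proof. by rewrite mxE liftK. Qed.

Lemma insK n (k : 'I_n.+1) (x : 'rV[R]_n.+1) : ins k (x ord0 k) (\row_i x ord0 (lift k i)) = x.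
Proof.
apply/rowP => j; case: (unliftP k j) => [i ->|->].
  by rewrite ins_lift mxE.
by rewrite ins_eq.
Qed.

Lemma ins0 n t y : ins (@ord0 n) t y = rV_cons (t, y).
Proof.
apply/rowP => j; case: (unliftP ord0 j) => [i ->|->].
  by rewrite ins_lift rV_consS.
by rewrite ins_eq rV_cons0.
Qed.

Lemma insS n (k : 'I_n.+1) s t (z : 'rV[R]_n) :
  ins (lift ord0 k) s (ins ord0 t z) = ins ord0 t (ins k s z).
Proof.
apply/rowP => j; case: (unliftP ord0 j) => [i ->|->].
  case: (unliftP k i) => [i' ->|->].
    rewrite [RHS]ins_lift ins_lift.
    have -> : lift ord0 (lift k i') = lift (lift ord0 k) (lift ord0 i').
      by apply: val_inj; rewrite /= /bump /= !add1n ltnS addnS.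
    by rewrite ins_lift ins_lift.
  by rewrite ins_eq ins_lift ins_eq.
have E : lift (lift ord0 k) (ord0 : 'I_n.+1) = ord0 by apply: val_inj.
by have := ins_lift (lift ord0 k) s (ins ord0 t z) ord0; rewrite E !ins_eq.
Qed.

Lemma measurable_ins n (k : 'I_n.+1) :
  measurable_fun setT (fun p : measurableTypeR R * 'rV[R]_n => ins k p.1 p.2).
Proof.
apply: measurable_fun_rVP => j; case: (unliftP k j) => [i ->|->].
- rewrite (_ : (fun _ => _) = (fun x : 'rV[R]_n => x ord0 i) \o snd).
    by apply: measurableT_comp => //; exact: measurable_coord.
  by apply/funext => p /=; exact: ins_lift.
- rewrite (_ : (fun _ => _) = fst)//.
  by apply/funext => p /=; exact: ins_eq.
Qed.

Lemma measurable_insr n (k : 'I_n.+1) t :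
  measurable_fun setT (fun y : 'rV[R]_n => ins k t y).
Proof.
apply: measurable_fun_rVP => j; case: (unliftP k j) => [i ->|->].
- under eq_fun do rewrite ins_lift; exact: measurable_coord.
- by under eq_fun do rewrite ins_eq; exact: measurable_cst.
Qed.

Lemma measurable_insl n (k : 'I_n.+1) (y : 'rV[R]_n) :
  measurable_fun setT (fun t : measurableTypeR R => ins k t y).
Proof.
apply: measurable_fun_rVP => j; case: (unliftP k j) => [i ->|->].
- by under eq_fun do rewrite ins_lift; exact: measurable_cst.
- by under eq_fun do rewrite ins_eq; exact: measurable_id.
Qed.

Section measurable_ins_comp.
Context n (k : 'I_n.+1) (g : 'rV[R]_n.+1 -> \bar R).
Hypotheses (mg : measurable_fun setT g) (g0 : forall x, (0 <= g x)%E).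
Local Open Scope ereal_scope.

Let mgi : measurable_fun setT
  (fun p : measurableTypeR R * 'rV[R]_n => g (ins k p.1 p.2)).
Proof. by apply: (measurableT_comp mg); exact: measurable_ins. Qed.

Lemma measurable_integral_ins :
  measurable_fun setT (fun y => \int[leb]_t g (ins k t y)).
Proof. exact: (measurable_fun_fubini_tonelli_G _ mgi). Qed.

Lemma integral_ins_swap :
  \int[leb]_t \int[mu n]_y g (ins k t y) = \int[mu n]_y \int[leb]_t g (ins k t y).
Proof. exact: (fubini_tonelli _ mgi). Qed.

End measurable_ins_comp.

Local Open Scope ereal_scope.

Lemma integral_rV_ins0 n (g : 'rV[R]_n.+1 -> \bar R) :
  measurable_fun setT g -> (forall x, 0 <= g x) ->
  \int[mu n.+1]_x g x = \int[leb]_t \int[mu n]_y g (ins ord0 t y).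
Proof.
move=> mg g0; rewrite [LHS](_ : _ =
  \int[pushm (leb \x mu n) (@measurable_rV_cons R n)]_x g x)//.
rewrite ge0_integral_pushm//.
have mc : measurable_fun setT
    (fun p : measurableTypeR R * 'rV[R]_n => g (rV_cons p)).
  by apply: (measurableT_comp mg); exact: measurable_rV_cons.
transitivity (\int[leb]_t \int[mu n]_y g (rV_cons (t, y))).
  exact: (fubini_tonelli1 (m1 := leb) (m2 := mu n) _ mc (fun p => g0 _)).
apply: eq_integral => t _.
by apply: eq_integral => y _; rewrite ins0.
Qed.

(** For [k = ord0] this is Tonelli for the recursive construction of the measure. Otherwise
    coordinate 0 is split off on both sides, induction treats the remaining ones, and [insS]
    exchanges the two insertions. *)
Lemma ge0_integral_rV_ins n (k : 'I_n.+1) (g : 'rV[R]_n.+1 -> \bar R) :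
  measurable_fun setT g -> (forall x, 0 <= g x) ->
  \int[mu n.+1]_x g x = \int[mu n]_y \int[leb]_t g (ins k t y).
Proof.
elim: n => [|n IH] in k g *; move=> mg g0.
  by rewrite (ord1 k) integral_rV_ins0// integral_ins_swap.
case: (unliftP ord0 k) => [k' ->|->]; last first.
  by rewrite integral_rV_ins0// integral_ins_swap.
rewrite integral_rV_ins0//.
rewrite [RHS]integral_rV_ins0; last 2 first.
- exact: measurable_integral_ins.
- by move=> y; exact: integral_ge0.
apply: eq_integral => t _; rewrite (IH k')//; last first.
  by apply: (measurableT_comp mg); exact: measurable_insr.
by apply: eq_integral => z _; apply: eq_integral => s _; rewrite insS.
Qed.

Local Close Scope ereal_scope.

Lemma ball_rV_measurable n (x : 'rV[R]_n) (e : R) :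
  measurable (ball x e).
Proof.
have [e0|e0] := ltP 0 e; last first.
  rewrite (_ : ball x e = set0) ?measurable0//.
  by apply/seteqP; split => // y; rewrite -ball_normE/= => /(le_lt_trans (normr_ge0 _)); rewrite ltNge e0.
rewrite (_ : ball x e = \bigcap_(i : 'I_n)
  ((fun y : 'rV[R]_n => y ord0 i) @^-1` ball (x ord0 i) e)).
  apply: fin_bigcap_measurable => // i _.
  rewrite -[X in measurable X]setTI; apply: measurable_coord => //.
  exact: measurable_ball.
apply/seteqP; split => [y [_ xy] i _ /=|y xy]; first exact: xy.
by split => // i j; rewrite (ord1 i); exact: xy.
Qed.

(** The sigma-algebra is generated by the coordinates. Balls of the sup norm are boxes, hence
    measurable, and [U] is the union of the countably many balls with rational centre and radius
    1/(k+1) that it contains, enumerated by [unpickle]. *)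
Lemma open_measurable_rV n (U : set 'rV[R]_n) : open U -> measurable U.
Proof.
move=> oU.
pose q2r (q : 'rV[rat]_n) : 'rV[R]_n := map_mx ratr q.
pose F m : set 'rV[R]_n := if @unpickle ('rV[rat]_n * nat)%type m is Some (q, k) then
  if `[< ball (q2r q) k.+1%:R^-1 `<=` U >] then ball (q2r q) k.+1%:R^-1
  else set0 else set0.
rewrite (_ : U = \bigcup_m F m).
  apply: bigcup_measurable => m _; rewrite /F; case: unpickle => // -[q k].
  by case: ifPn => // _; exact: ball_rV_measurable.
apply/seteqP; split => [x Ux|x [m _]]; last first.
  by rewrite /F; case: unpickle => // -[q k]; case: ifPn => // /asboolP; exact.
have /nbhs_ballP[e /= e0 eU] := open_nbhs_nbhs (conj oU Ux).
have [k ke] : exists k : nat, k.+1%:R^-1 < e / 2.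
  exists (Num.bound (e / 2)^-1).
  rewrite -[ltRHS]invrK ltf_pV2 ?posrE// ?invr_gt0 ?divr_gt0//.
  apply: (lt_le_trans (archi_boundP _)); last by rewrite ler_nat.
  by rewrite invr_ge0 divr_ge0// ltW.
have k0 : 0 < k.+1%:R^-1 :> R by [].
have /choice[q qx] : forall i, exists q : rat, `|x ord0 i - ratr q| < k.+1%:R^-1.
  move=> i; have [|q] := @rat_in_itvoo R (x ord0 i - k.+1%:R^-1) (x ord0 i).
    by rewrite ltrBlDr ltrDl.
  rewrite in_itv/= => /andP[h1 h2]; exists q.
  by rewrite gtr0_norm ?subr_gt0// ltrBlDr addrC -ltrBlDr.
pose Q : 'rV[rat]_n := \row_i q i.
have xQ : ball (q2r Q) k.+1%:R^-1 x.
  split=> // i j; rewrite (ord1 i) /ball/= !mxE distrC; exact: qx.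
exists (pickle (Q, k)) => //; rewrite /F pickleK asboolT// => y Qy.
apply: eU; apply: (@le_ball _ _ x (k.+1%:R^-1 + k.+1%:R^-1)).
  by rewrite [leRHS]splitr lerD// ltW.
exact: ball_triangle (ball_sym xQ) Qy.
Qed.

Lemma continuous_measurable_rV n (f : 'rV[R]_n -> R) :
  continuous f -> measurable_fun setT f.
Proof.
move=> cf; apply: (measurability _ (RGenOInfty.measurableE R)).
move=> _ [_ [x ->] <-]; rewrite setTI; apply: open_measurable_rV.
by apply: open_comp => // y _; exact: cf.
Qed.

Lemma measurable_dini_rV n (f : 'rV[R]_n -> R) (v : 'rV[R]_n) :
  continuous f -> measurable_fun setT (dini f v).
Proof.
move=> cf; apply: measurable_lsup => m.
have cs : continuous (fun x : 'rV[R]_n => m.+1%:R^-1 *: v + x).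
  move=> x; apply: (@cvgD R 'rV[R]_n 'rV[R]_n (nbhs x) _ (cst _) id).
    exact: cvg_cst.
  exact: cvg_id.
apply: measurable_funM; first exact: measurable_cst.
apply: measurable_funB; apply: continuous_measurable_rV => // x.
exact: (continuous_comp (cs x) (cf _)).
Qed.

Definition upd n (k : 'I_n) (c : R) (x : 'rV[R]_n) : 'rV[R]_n :=
  \row_j if j == k then c else x ord0 j.

Lemma upd_ins n (k : 'I_n.+1) c t y : upd k c (ins k t y) = ins k c y.
Proof.
apply/rowP => j; rewrite mxE; case: (unliftP k j) => [i ->|->].
  by rewrite eq_sym (negbTE (neq_lift _ _)) !ins_lift.
by rewrite eqxx ins_eq.
Qed.

Lemma ins_shift n (k : 'I_n.+1) (a t : R) y :
  a *: delta_mx ord0 k + ins k t y = ins k (a + t) y.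
Proof.
apply/rowP => j; rewrite !mxE eqxx/=; case: (unliftP k j) => [i ->|->].
  by rewrite eq_sym (negbTE (neq_lift _ _)) mulr0 add0r.
by rewrite eqxx mulr1.
Qed.

(** A map that alters only coordinate [k] is one-dimensional on each line in that direction. Tonelli
    on both sides leaves the change of variables for [t |-> phi (ins k t y)], and the Jacobian is a
    partial derivative of [phi]. *)
Lemma ge0_integral_shear n (k : 'I_n.+1) (c : R) (phi : 'rV[R]_n.+1 -> R)
    (g : 'rV[R]_n.+1 -> \bar R) :
  continuous phi ->
  (forall y, nd_lip c (fun t => phi (ins k t y))) ->
  (forall y, injective (fun t => phi (ins k t y))) ->
  (forall y d, exists t, phi (ins k t y) = d) ->
  measurable_fun setT g -> (forall x, 0 <= g x)%E ->
  (\int[mu n.+1]_x g x =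
   \int[mu n.+1]_x (g (upd k (phi x) x) * (dini phi (delta_mx ord0 k) x)%:E))%E.
Proof.
move=> cphi lphi iphi sphi mg g0.
have dE t y : dini phi (delta_mx ord0 k) (ins k t y) =
    dini (fun t => phi (ins k t y)) (1 : R^o) t.
  congr lsup; apply/funext => m; rewrite ins_shift.
  by congr (_ * (phi (ins k (_ + t) y) - _)); rewrite [RHS]mulr1.
have d0 x : 0 <= dini phi (delta_mx ord0 k) x.
  by rewrite -(insK k x) dE; have /andP[] := dini_ge0 (lphi (\row_i x ord0 (lift k i))) (x ord0 k).
rewrite !(ge0_integral_rV_ins k)//; last 2 first.
- apply: emeasurable_funM; last by apply/measurable_EFinP; exact: measurable_dini_rV.
  apply: (measurableT_comp mg); apply: measurable_fun_rVP => i.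
  rewrite [X in measurable_fun _ X](_ : _ =
    if i == k then phi else fun x => x ord0 i); last first.
    by apply/funext => x; rewrite mxE; case: ifP.
  by case: ifP => _; [exact: continuous_measurable_rV|exact: measurable_coord].
- by move=> x; apply: mule_ge0; rewrite ?lee_fin.
apply: eq_integral => y _.
pose G t := g (ins k t y).
have mG : measurable_fun setT (G : measurableTypeR R -> \bar R).
  by apply: (measurableT_comp mg); exact: measurable_insl.
have := nd_lip_change_of_variables (lphi y) (iphi y) (sphi y) mG (fun t => g0 _).
rewrite /G => ->.
by apply: eq_integral => t _; rewrite upd_ins dE.
Qed.

End coordinate_lines.

(** * Change of variables for Euler steps *)

Section sup_norm.
Context {R : realType} {n : nat}.
Implicit Types x : 'rV[R]_n.

Lemma coord_le_norm x i : `|x ord0 i| <= `|x|.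
Proof.
rewrite [leRHS]mx_normrE.
by rewrite (le_bigmax _ (fun ij => `|x ij.1 ij.2|) (ord0, i)).
Qed.

Lemma norm_le_coord x c : 0 <= c -> (forall i, `|x ord0 i| <= c) -> `|x| <= c.
Proof.
move=> c0 h; rewrite [leLHS]mx_normrE; apply: bigmax_le => // -[i j] _ /=.
by rewrite (ord1 i).
Qed.

Lemma norm_delta_mx (i : 'I_n) : `|delta_mx ord0 i : 'rV[R]_n| <= 1.
Proof. by apply: norm_le_coord => // j; rewrite mxE; case: eqP => //=; case: eqP => //=; rewrite ?normr1 ?normr0. Qed.

Lemma lip_coord_continuous (V : normedModType R) (f : V -> R) (L : R) :
  (forall x y : V, `|f x - f y| <= L * `|x - y|) -> continuous f.
Proof.
move=> fL x; apply/cvgrPdist_le => /= e e0.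
have k1 : 0 < `|L| + 1 by rewrite ltr_wpDl.
near=> y.
have yx : `|x - y| <= e / (`|L| + 1).
  by near: y; apply: cvgr_dist_le; [exact: cvg_id|rewrite divr_gt0].
apply: (le_trans (fL x y)); apply: (@le_trans _ _ ((`|L| + 1) * `|x - y|)).
  by rewrite ler_wpM2r// (le_trans (ler_norm L))// lerDl.
by rewrite mulrC -ler_pdivlMr.
Unshelve. all: by end_near. Qed.

End sup_norm.

Section euler_step.
Context {R : realType} {n : nat}.
Local Notation N := n.+1.
Local Notation mu := (@lebesgue_measure_rV R N).
Variables (Y : 'rV[R]_N -> 'rV[R]_N) (L h : R).
Hypotheses (YL : forall x y, `|Y x - Y y| <= L * `|x - y|).
Hypotheses (h0 : 0 <= h) (hL : h * L <= 4^-1).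

(** Interpolates between the identity ([k = 0]) and the Euler step ([k = N]), one coordinate at a
    time. [Y] is always evaluated at the original point, so that [G N] is exactly the Euler step. *)
Let G (k : nat) (x : 'rV[R]_N) : 'rV[R]_N :=
  \row_j if (j < k)%N then x ord0 j + h * Y x ord0 j else x ord0 j.

Let L0 : 0 <= L.
Proof.
have := YL 0 (const_mx 1); have : 0 < `|0 - const_mx 1 : 'rV[R]_N|.
  rewrite normr_gt0 sub0r oppr_eq0; apply/eqP => /rowP/(_ ord0).
  by rewrite !mxE => /eqP; rewrite oner_eq0.
by move=> p /(le_trans (normr_ge0 _)); rewrite pmulr_lge0.
Qed.

Let Ycoord x y j : `|Y x ord0 j - Y y ord0 j| <= L * `|x - y|.
Proof.
by apply: le_trans (YL x y); have := coord_le_norm (Y x - Y y) j; rewrite !mxE.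
Qed.

Let G_dist k x y : `|G k x - G k y - (x - y)| <= h * L * `|x - y|.
Proof.
apply: norm_le_coord => [|j]; first by rewrite !mulr_ge0.
rewrite !mxE; case: ifP => _; last first.
  by rewrite subrr normr0 !mulr_ge0.
rewrite (_ : _ - _ = h * (Y x ord0 j - Y y ord0 j)); last by ring.
by rewrite normrM (ger0_norm h0) -mulrA ler_wpM2l.
Qed.

(** As [h * L <= 4^-1], the map [G k] is a 1/4-Lipschitz perturbation of the identity; distances
    shrink at most by the factor 3/4, hence injectivity and a 2-Lipschitz inverse. *)
Let G_expand k x y : `|x - y| <= 2 * `|G k x - G k y|.
Proof.
have h1 := G_dist k x y.
have h2 := ler_distD (G k x - G k y) (x - y) 0; rewrite !subr0 in h2.
rewrite distrC in h1.
have h3 : h * L * `|x - y| <= 4^-1 * `|x - y| by rewrite ler_wpM2r.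
have := normr_ge0 (x - y); lra.
Qed.

Let G_inj k : injective (G k).
Proof.
move=> x y Gxy; have := G_expand k x y.
by rewrite Gxy subrr normr0 mulr0 normr_le0 subr_eq0 => /eqP.
Qed.

Let G_lip k x y : `|G k x - G k y| <= 2 * `|x - y|.
Proof.
have h1 := G_dist k x y.
have h2 := ler_distD (x - y) (G k x - G k y) 0; rewrite !subr0 in h2.
have h3 : h * L * `|x - y| <= 4^-1 * `|x - y| by rewrite ler_wpM2r.
have := normr_ge0 (x - y); lra.
Qed.

Let measurable_G k : measurable_fun setT (G k).
Proof.
apply: measurable_fun_rVP => i; apply: continuous_measurable_rV.
apply: (@lip_coord_continuous _ _ _ 2) => x y.
by apply: le_trans (G_lip k x y); have := coord_le_norm (G k x - G k y) i; rewrite !mxE.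
Qed.

Section step.
Variables (k : 'I_N) (Gi : 'rV[R]_N -> 'rV[R]_N).
Hypotheses (GiK : cancel Gi (G k)).

Let GK : cancel (G k) Gi.
Proof. by move=> x; apply: (@G_inj k); rewrite GiK. Qed.

Let Gi_lip x y : `|Gi x - Gi y| <= 2 * `|x - y|.
Proof. by have := G_expand k (Gi x) (Gi y); rewrite !GiK. Qed.

(** In the variable [z = G k x] the passage to [G k.+1] replaces coordinate [k] by [phi z], a shear.
    The inverse [Gi] recovers the original point at which [Y] is evaluated. *)
Let phi (z : 'rV[R]_N) := z ord0 k + h * Y (Gi z) ord0 k.

Let phi_dist z w : `|phi z - phi w - (z ord0 k - w ord0 k)| <= 2^-1 * `|z - w|.
Proof.
rewrite (_ : _ - _ = h * (Y (Gi z) ord0 k - Y (Gi w) ord0 k)); last by rewrite /phi; ring.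
rewrite normrM (ger0_norm h0).
have h1 : h * `|Y (Gi z) ord0 k - Y (Gi w) ord0 k| <= h * (L * (2 * `|z - w|)).
  by rewrite ler_wpM2l// (le_trans (Ycoord _ _ _))// ler_wpM2l.
have h2 : h * L * (2 * `|z - w|) <= 4^-1 * (2 * `|z - w|) by rewrite ler_wpM2r// mulr_ge0.
lra.
Qed.

Let phi_continuous : continuous phi.
Proof.
apply: (@lip_coord_continuous _ _ _ 2) => z w.
have h1 := phi_dist z w.
have h2 := ler_distD (z ord0 k - w ord0 k) (phi z - phi w) 0; rewrite !subr0 in h2.
have h3 := coord_le_norm (z - w) k; rewrite !mxE in h3.
have := normr_ge0 (z - w); lra.
Qed.

Let phi_line (y : 'rV[R]_n) s t : s <= t ->
  2^-1 * (t - s) <= phi (ins k t y) - phi (ins k s y) <= 2 * (t - s).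
Proof.
move=> st; have := phi_dist (ins k t y) (ins k s y).
rewrite !ins_eq; have : `|ins k t y - ins k s y| <= t - s.
  apply: norm_le_coord => [|j]; first by rewrite subr_ge0.
  rewrite mxE [X in _ + X]mxE; case: (unliftP k j) => [i ->|->].
    by rewrite !ins_lift subrr normr0 subr_ge0.
  by rewrite !ins_eq ger0_norm// subr_ge0.
rewrite ler_norml => h1 /andP[h2 h3]; apply/andP; split; lra.
Qed.

Let phi_inj y : injective (fun t => phi (ins k t y)).
Proof.
move=> s t; have [st|ts] := leP s t => E.
  have /andP[+ _] := phi_line y st; rewrite E subrr => h1; lra.
have /andP[+ _] := phi_line y (ltW ts); rewrite E subrr => h1; lra.
Qed.

Let phi_surj y d : exists t, phi (ins k t y) = d.
Proof.
(* The slope of [phi] along the line is at least 1/2, so the value [d] is reached at distance at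
   most [a] from 0. *)
pose a := 2 * `|d - phi (ins k 0 y)|.
have a0 : 0 <= a by rewrite mulr_ge0.
have Na : - a <= a by lra.
have cf : continuous (fun t => phi (ins k t y)).
  apply: (@nd_lip_continuous _ 2) => s t st; have /andP[h1 h2] := phi_line y st.
  by rewrite h2 (le_trans _ h1)// mulr_ge0// subr_ge0.
have [||t _ <-] := @IVT R (fun t => phi (ins k t y)) (- a) a d Na; last by exists t.
  exact: continuous_subspaceT.
have /andP[h1 _] := phi_line y a0.
have Na0 : - a <= 0 by rewrite oppr_le0.
have /andP[h2 _] := phi_line y Na0.
have h3 : `|d - phi (ins k 0 y)| = a / 2 by rewrite /a; field.
have := ler_norm (d - phi (ins k 0 y)); have := ler_norm (phi (ins k 0 y) - d).
rewrite (distrC (phi _)) h3 => h4 h5.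
by rewrite ge_min le_max; apply/andP; split; apply/orP; [left|right]; lra.
Qed.

Let G_step x : G k.+1 x = upd k (phi (G k x)) (G k x).
Proof.
apply/rowP => j; rewrite !mxE ltnS /phi GK !mxE ltnn.
have [->|jk] := eqVneq j k; first by rewrite leqnn.
by rewrite leq_eqVlt -[(j == k :> nat)]/(j == k) (negbTE jk).
Qed.

Lemma euler_step_surj w : exists x, G k.+1 x = w.
Proof.
have [t th] := phi_surj (\row_i w ord0 (lift k i)) (w ord0 k).
exists (Gi (ins k t (\row_i w ord0 (lift k i)))).
by rewrite G_step GiK th upd_ins insK.
Qed.

Let B x := dini phi (delta_mx ord0 k) (G k x).

(** The new factor is the partial derivative of the shear, read at [G k x]. Near that point [Gi]
    follows a displacement up to a relative error [2 * (h * L)], so the quotients of [phi] and of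
    [1 + h * Y_k] differ by at most [h * L] times this. Upper limits are compared, since [phi] need
    not be derivable at [G k x]. *)
Lemma euler_step_integral (J : 'rV[R]_N -> R) :
  measurable_fun setT J -> (forall x, 0 <= J x) ->
  (forall g : 'rV[R]_N -> \bar R, measurable_fun setT g -> (forall x, 0 <= g x)%E ->
    \int[mu]_x g x = \int[mu]_x (g (G k x) * (J x)%:E))%E ->
  exists b : 'rV[R]_N -> R, [/\ measurable_fun setT b, (forall x, 0 <= b x),
    (forall x, derivable (fun y => Y y ord0 k) x (delta_mx ord0 k) ->
      `|b x - (1 + h * 'D_(delta_mx ord0 k) (fun y => Y y ord0 k) x)| <= 2 * (h * L) ^+ 2) &
    forall g : 'rV[R]_N -> \bar R, measurable_fun setT g -> (forall x, 0 <= g x)%E ->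
    (\int[mu]_x g x = \int[mu]_x (g (G k.+1 x) * (J x * b x)%:E))%E].
Proof.
move=> mJ J0 IH; exists B.
have mD := measurable_dini_rV (delta_mx ord0 k) phi_continuous.
have mB : measurable_fun setT B by exact: measurableT_comp mD (measurable_G k).
have D0 z : 0 <= dini phi (delta_mx ord0 k) z.
  apply: (proj1 (andP (proj2 (@lsup_bounds _ _ 0 2 _)))) => m.
  rewrite -(insK k z) ins_shift; set t := z ord0 k.
  have st : t <= m.+1%:R^-1 + t by rewrite lerDr.
  have /andP[h1] := phi_line (\row_i z ord0 (lift k i)) st; rewrite addrK => h2.
  rewrite addrK in h1; have p : 0 < m.+1%:R^-1 :> R by [].
  apply/andP; split; first by rewrite mulr_ge0// (le_trans _ h1)// mulr_ge0// ltW.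
  by rewrite mulrC -ler_pdivlMr.
split => //; first by move=> x; exact: D0.
- move=> x dY; set e := delta_mx ord0 k.
  set a := fun m : nat => m.+1%:R * (phi (m.+1%:R^-1 *: e + G k x) - phi (G k x)).
  set c := fun m : nat => 1 + h * (m.+1%:R * (Y (m.+1%:R^-1 *: e + x) ord0 k - Y x ord0 k)).
  have cD : lsup c = 1 + h * 'D_e (fun y => Y y ord0 k) x.
    apply: lsup_cvg; rewrite /c; apply: (@cvgD R R nat _ _ (cst 1) _ 1); first exact: cvg_cst.
    apply: (@cvgM R nat _ _ (cst h)); first exact: cvg_cst.
    move: dY => /cvg_ex[/= l fl].
    have -> : 'D_e (fun y => Y y ord0 k) x = l by apply/cvg_lim.
    have := cvg_comp _ _ (@cvg_invS R) fl.
    rewrite (_ : _ \o _ = (fun m => m.+1%:R * (Y (m.+1%:R^-1 *: e + x) ord0 k - Y x ord0 k)))//.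
    by apply/funext => m /=; rewrite invrK.
  have ac m : `|a m - c m| <= 2 * (h * L) ^+ 2.
    set y := m.+1%:R^-1 *: e; have m0 : 0 < m.+1%:R :> R by [].
    have y1 : `|y| <= m.+1%:R^-1.
      by rewrite normrZ ger0_norm// ler_piMr// norm_delta_mx.
    rewrite (_ : a m - c m = h * (m.+1%:R * (Y (Gi (y + G k x)) ord0 k - Y (y + x) ord0 k))); last first.
      rewrite /a /c -/y /phi GK !mxE !eqxx mulr1; field.
      by rewrite nat1r pnatr_eq0.
    rewrite !normrM (ger0_norm h0) normr_nat.
    (* [G k] displaces [x] and [y + x] by almost the same vector, so [y + G k x] is close to
       [G k (y + x)]; the 2-Lipschitz map [Gi] at most doubles the error. *)
    have h1 : `|Gi (y + G k x) - (y + x)| <= 2 * (h * L * m.+1%:R^-1).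
      rewrite -{1}(GK (y + x)) (le_trans (Gi_lip _ _))// ler_wpM2l//.
      have := G_dist k (y + x) x; rewrite addrK -normrN.
      rewrite (_ : - _ = y + G k x - G k (y + x)); last first.
        by rewrite !opprD !opprK -addrA addrC [_ + y]addrC.
      by move=> /le_trans; apply; rewrite ler_wpM2l// mulr_ge0.
    rewrite expr2 (_ : 2 * _ = h * (m.+1%:R * (L * (2 * (h * L * m.+1%:R^-1))))); last first.
      by field; rewrite nat1r pnatr_eq0.
    rewrite !ler_wpM2l// (le_trans (Ycoord _ _ _))// ler_wpM2l//.
  have ab : exists M, forall m, - M <= a m <= M /\ - M <= c m <= M.
    have cb m : `|c m| <= 1 + h * L.
      rewrite /c (le_trans (ler_normD _ _))// normr1 lerD2l normrM ger0_norm//.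
      rewrite ler_wpM2l// normrM normr_nat mulrC -ler_pdivlMr//.
      rewrite (le_trans (Ycoord _ _ _))// addrK ler_wpM2l// normrZ ger0_norm//.
      by rewrite ler_piMr// norm_delta_mx.
    exists (1 + h * L + 2 * (h * L) ^+ 2) => m; rewrite -!ler_norml; split.
      have := ler_distD (c m) (a m) 0; rewrite !subr0 => /le_trans; apply.
      by rewrite addrC lerD.
    by rewrite (le_trans (cb m))// lerDl mulr_ge0// sqr_ge0.
  have [M abM] := ab.
  rewrite -cD /B /dini -/e -/a ler_distl.
  have h1 : lsup a <= lsup c + 2 * (h * L) ^+ 2.
    apply: (@lsup_dist _ _ _ (- M) M) => m; [by have [] := abM m|by have [] := abM m|].
    by have := ac m; rewrite ler_distl => /andP[_].
  have h2 : lsup c <= lsup a + 2 * (h * L) ^+ 2.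
    apply: (@lsup_dist _ _ _ (- M) M) => m; [by have [] := abM m|by have [] := abM m|].
    by have := ac m; rewrite ler_distl => /andP[+ _]; rewrite lerBlDr.
  by rewrite h1 lerBlDr h2.
- move=> g mg g0.
  have Bl y : nd_lip 2 (fun t => phi (ins k t y)).
    move=> s t st; have /andP[h1 h2] := phi_line y st.
    by rewrite h2 (le_trans _ h1)// mulr_ge0// subr_ge0.
  rewrite (ge0_integral_shear phi_continuous Bl phi_inj phi_surj mg g0).
  have mu1 : measurable_fun setT (fun x => upd k (phi x) x).
    apply: measurable_fun_rVP => i.
    rewrite [X in measurable_fun _ X](_ : _ =
      if i == k then phi else fun x => x ord0 i); last first.
      by apply/funext => x; rewrite mxE; case: ifP.
    by case: ifP => _; [exact: continuous_measurable_rV|exact: measurable_coord].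
  rewrite IH; last 2 first.
  + apply: emeasurable_funM; last exact/measurable_EFinP.
    exact: (measurableT_comp mg mu1).
  + by move=> x; apply: mule_ge0; rewrite ?lee_fin.
  apply: eq_integral => x _; rewrite G_step -muleA -EFinM.
  by rewrite mulrC.
Qed.

End step.

Lemma euler_change_of_variables : exists b : 'I_N -> 'rV[R]_N -> R,
  [/\ (forall j, measurable_fun setT (b j)), (forall j x, 0 <= b j x),
    (forall j x, derivable (fun y => Y y ord0 j) x (delta_mx ord0 j) ->
      `|b j x - (1 + h * 'D_(delta_mx ord0 j) (fun y => Y y ord0 j) x)| <= 2 * (h * L) ^+ 2) &
    forall g : 'rV[R]_N -> \bar R, measurable_fun setT g -> (forall x, 0 <= g x)%E ->
    (\int[mu]_x g x = \int[mu]_x (g (x + h *: Y x)%R * (\prod_j b j x)%:E))%E].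
Proof.
(* Surjectivity is carried through the induction because it supplies the inverse [Gi] on which the
   next shear is built. *)
suff : forall k, (k <= N)%N -> (forall w, exists x, G k x = w) /\
  exists b : 'I_N -> 'rV[R]_N -> R,
  [/\ (forall j, measurable_fun setT (b j)), (forall j x, 0 <= b j x),
    (forall (j : 'I_N) x, (j < k)%N -> derivable (fun y => Y y ord0 j) x (delta_mx ord0 j) ->
      `|b j x - (1 + h * 'D_(delta_mx ord0 j) (fun y => Y y ord0 j) x)| <= 2 * (h * L) ^+ 2) &
    forall g : 'rV[R]_N -> \bar R, measurable_fun setT g -> (forall x, 0 <= g x)%E ->
    (\int[mu]_x g x = \int[mu]_x (g (G k x) * (\prod_(j < N | (j < k)%N) b j x)%:E))%E].
  move=> /(_ N (leqnn _))[_ [b [mb b0 bD bI]]]; exists b; split => //.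
    by move=> j x; apply: bD.
  move=> g mg g0; rewrite bI//; apply: eq_integral => x _; congr (g _ * _%:E)%E.
    by apply/rowP => j; rewrite !mxE ltn_ord.
  by apply: eq_bigl => j; rewrite ltn_ord.
elim => [_|k IH kN].
  split; first by move=> w; exists w; apply/rowP => j; rewrite !mxE.
  exists (fun _ _ => 1); split => // g mg g0; apply: eq_integral => x _.
  rewrite big_pred0// mule1; congr g; apply/rowP => j; by rewrite !mxE.
have [surj [b [mb b0 bD bI]]] := IH (ltnW kN).
have /choice[Gi GiK] := surj.
pose k' := Ordinal kN.
split; first exact: (@euler_step_surj k' Gi GiK).
pose J x := \prod_(j < N | (j < k)%N) b j x.
have mJ : measurable_fun setT J.
  by rewrite /J; under eq_fun do rewrite -big_filter; exact: measurable_prod.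
have J0 x : 0 <= J x by apply: prodr_ge0 => j _.
have [bk [mbk bk0 bkD bkI]] := @euler_step_integral k' Gi GiK J mJ J0 bI.
exists (fun j => if j == k' then bk else b j); split.
- by move=> j; case: ifP.
- by move=> j x; case: ifP.
- move=> j x; rewrite ltnS leq_eqVlt -[(j == k :> nat)]/(j == k').
  by case: eqVneq => [->|_] //= jk; [exact: bkD|exact: bD].
- move=> g mg g0; rewrite bkI//; apply: eq_integral => x _; congr (_ * _%:E)%E.
  rewrite [RHS](bigD1 k') ?leqnn//= eqxx mulrC; congr (_ * _).
  rewrite /J; apply: eq_big => [j|j jk].
    by rewrite ltnS andbC [(j <= k)%N]leq_eqVlt -[(j == k :> nat)]/(j == k'); case: eqVneq => [->|] //=; rewrite ltnn.
  by case: eqVneq jk => // ->; rewrite ltnn.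
Qed.

End euler_step.

(** * Partial derivatives of Lipschitz functions *)

Section measurable_derivable.
Context {R : realType} {n : nat}.
Implicit Types (f : 'rV[R]_n -> R) (v x : 'rV[R]_n).

Definition quotient_at f v (t : R) x : R := t^-1 * (f (t *: v + x) - f x).

(** Cauchy form of derivability with precision 1/(m+1) and radius 1/(k+1), so that countable
    operations suffice. For continuous [f] each set is closed, being an intersection of closed
    conditions over [s] and [t]. *)
Let close f v (m k : nat) : set 'rV[R]_n := [set x | forall s t : R,
  s != 0 -> t != 0 -> `|s| < k.+1%:R^-1 -> `|t| < k.+1%:R^-1 ->
  `|quotient_at f v s x - quotient_at f v t x| <= m.+1%:R^-1].

Let inv_lt (e : R) : 0 < e -> exists k : nat, k.+1%:R^-1 < e.
Proof.
move=> e0; exists (Num.bound e^-1).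
rewrite -[ltRHS]invrK ltf_pV2 ?posrE// ?invr_gt0//.
apply: (lt_le_trans (archi_boundP _)); last by rewrite ler_nat.
by rewrite invr_ge0 ltW.
Qed.

Let derivableE f v : [set x | derivable f x v] = \bigcap_m \bigcup_k close f v m k.
Proof.
apply/seteqP; split => x /=.
- move=> /cvg_ex[/= l fl] m _.
  have m0 : 0 < m.+1%:R^-1 / 2 :> R by rewrite divr_gt0.
  move/cvgrPdist_lt : fl => /(_ _ m0)[e /= e0 eP].
  have [k ke] := inv_lt e0; exists k => // s t s0 t0 sk tk.
  have q (a : R) : a != 0 -> `|a| < k.+1%:R^-1 -> `|l - quotient_at f v a x| < m.+1%:R^-1 / 2.
    move=> a0 ak; apply: eP => //=.
    by rewrite sub0r normrN (lt_trans ak).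
  rewrite (le_trans (ler_distD l _ _))// distrC.
  by rewrite [leRHS]splitr lerD// ltW// q.
- move=> H; apply/cauchy_cvgP/cauchy_ballP => e e0.
  have [m me] := inv_lt e0; have [k _ xk] := H m I.
  have k0 : 0 < k.+1%:R^-1 :> R by [].
  pose S : set R := [set a | a != 0 /\ `|a| < k.+1%:R^-1].
  have nS : (0 : R)^' S.
    by exists k.+1%:R^-1 => //= a /=; rewrite sub0r normrN => ak a0; split.
  exists ((quotient_at f v)^~ x @` S, (quotient_at f v)^~ x @` S) => /=.
    by split; apply: filterS nS => a Sa; exists a.
  move=> [_ _] /= [[s [s0 sk] <-] [t [t0 tk] <-]].
  by apply: le_lt_trans me; exact: xk.
Qed.

Lemma measurable_derivable f v : continuous f -> measurable [set x | derivable f x v].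
Proof.
move=> cf; rewrite derivableE; apply: bigcap_measurable => // m _.
apply: bigcup_measurable => k _; rewrite -[close _ _ _ _]setCK; apply: measurableC.
apply: open_measurable_rV; rewrite openC.
rewrite (_ : close f v m k = \bigcap_(p in [set p : R * R | [/\ p.1 != 0, p.2 != 0,
   `|p.1| < k.+1%:R^-1 & `|p.2| < k.+1%:R^-1]])
   [set x | `|quotient_at f v p.1 x - quotient_at f v p.2 x| <= m.+1%:R^-1]); last first.
  apply/seteqP; split => [x h [s t] [] /=|x h s t s0 t0 sk tk]; first exact: h.
  exact: (h (s, t)).
apply: closed_bigI => -[s t] _ /=.
have cq (a : R) : continuous (quotient_at f v a).
  move=> x; apply: (@cvgM R 'rV[R]_n (nbhs x) _ (cst a^-1)); first exact: cvg_cst.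
  apply: (@cvgB R R 'rV[R]_n (nbhs x) _ (fun x => f (a *: v + x)) f); last exact: cf.
  apply: (@continuous_comp _ _ _ (fun x => a *: v + x) f); last exact: cf.
  apply: (@cvgD R 'rV[R]_n 'rV[R]_n (nbhs x) _ (cst _) id); first exact: cvg_cst.
  exact: cvg_id.
apply: (@closed_comp _ _ (fun x => `|quotient_at f v s x - quotient_at f v t x|)
  [set r | r <= m.+1%:R^-1]); last exact: closed_le.
move=> x _.
have h : {for x, continuous (quotient_at f v s \- quotient_at f v t)}.
  by apply: continuousB; exact: cq.
exact: (continuous_comp h (@norm_continuous _ R _)).
Qed.

End measurable_derivable.

Section lipschitz_derivable.
Context {R : realType}.

(** Adding [L * t] to a Lipschitz function makes it monotone, with constant [2 * L]. *)
Lemma lip_derivable_ae (f : R -> R) (L : R) :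
  (forall s t, `|f s - f t| <= L * `|s - t|) ->
  {ae @lebesgue_measure R, forall t, derivable f t 1}.
Proof.
move=> fL; have phiL : nd_lip (2 * L) (fun t => f t + L * t).
  move=> s t st; have := fL t s; rewrite (ger0_norm (x := t - s)) ?subr_ge0//.
  rewrite ler_norml => /andP[h1 h2]; apply/andP; split; lra.
have dL (t : R) : derivable (fun t : R => L * t) t 1.
  exact: derivableM (derivable_cst _ _ _) (@derivable_id _ _ _ _).
apply: ae_imp (nd_lip_derivable phiL) => t dt.
rewrite (_ : f = (fun t => f t + L * t) - (fun t => L * t)).
  exact: derivableB.
by apply/funext => s; rewrite -[RHS]/(f s + L * s - L * s) addrK.
Qed.

(** The exceptional set is measurable, so Tonelli computes its measure along the lines in direction
    [k], on each of which it is null by the one-dimensional case. *)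
Lemma lip_partial_derivable n (f : 'rV[R]_n.+1 -> R) (L : R) (k : 'I_n.+1) :
  (forall x y, `|f x - f y| <= L * `|x - y|) ->
  {ae @lebesgue_measure_rV R n.+1, forall x, derivable f x (delta_mx ord0 k)}.
Proof.
move=> fL; have cf : continuous f by exact: lip_coord_continuous fL.
pose A := ~` [set x | derivable f x (delta_mx ord0 k)].
have mA : measurable A by apply: measurableC; exact: measurable_derivable.
exists A; split => //.
rewrite -[A]setIT -integral_indic//.
have mi : measurable_fun setT (fun x : 'rV[R]_n.+1 => (\1_A x)%:E : \bar R).
  exact/measurable_EFinP.
rewrite (ge0_integral_rV_ins k mi); last by move=> x; rewrite lee_fin.
apply: integral0_eq => y _.
have dline t : derivable f (ins k t y) (delta_mx ord0 k) <->
    derivable (fun t => f (ins k t y)) t 1.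
  rewrite /derivable (_ : (fun h => _) = (fun h : R => h^-1 *: (f (ins k (h *: 1 + t) y) - f (ins k t y))))//.
  by apply/funext => h /=; rewrite ins_shift [h *: 1]mulr1.
have fyL s t : `|f (ins k s y) - f (ins k t y)| <= L * `|s - t|.
  apply: (le_trans (fL _ _)).
  have L0 : 0 <= L.
    have := fL (ins k 1 y) (ins k 0 y); have : 0 < `|ins k 1 y - ins k 0 y|.
      rewrite normr_gt0 subr_eq0; apply/eqP => /rowP/(_ k).
      by rewrite !ins_eq => /eqP; rewrite oner_eq0.
    by move=> p /(le_trans (normr_ge0 _)); rewrite pmulr_lge0.
  rewrite ler_wpM2l//; apply: norm_le_coord => // j; rewrite mxE [X in _ + X]mxE.
  case: (unliftP k j) => [i ->|->]; first by rewrite !ins_lift subrr normr0.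
  by rewrite !ins_eq.
transitivity (\int[@lebesgue_measure R]_t cst 0%E t)%E; last exact: integral0.
apply: ge0_ae_eq_integral => //.
- by apply: (measurableT_comp mi); exact: measurable_insl.
- apply: ae_imp (lip_derivable_ae fyL) => t dt _ /=.
  by rewrite indicE memNset// => -[]; exact/dline.
Qed.

End lipschitz_derivable.

(** * Distortion of distances and measure by an Euler step *)

Section euclidean.
Context {R : realType} {n : nat}.
Implicit Types x y : 'rV[R]_n.

Lemma dotC x y : dot x y = dot y x.
Proof. by apply: eq_bigr => i _; rewrite mulrC. Qed.

Lemma dotDl x y z : dot (x + y) z = dot x z + dot y z.
Proof. by rewrite -big_split; apply: eq_bigr => i _; rewrite mxE mulrDl. Qed.

Lemma dotZl a x y : dot (a *: x) y = a * dot x y.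
Proof. by rewrite mulr_sumr; apply: eq_bigr => i _; rewrite mxE mulrA. Qed.

Lemma dotDr x y z : dot z (x + y) = dot z x + dot z y.
Proof. by rewrite dotC dotDl !(dotC z). Qed.

Lemma dotZr a x y : dot y (a *: x) = a * dot y x.
Proof. by rewrite dotC dotZl dotC. Qed.

Lemma dotNl x y : dot (- x) y = - dot x y.
Proof. by rewrite -scaleN1r dotZl mulN1r. Qed.

Lemma dotNr x y : dot y (- x) = - dot y x.
Proof. by rewrite dotC dotNl dotC. Qed.

Lemma dot_ge0 x : 0 <= dot x x.
Proof. by apply: sumr_ge0 => i _; rewrite -expr2 sqr_ge0. Qed.

Lemma enorm_ge0 x : 0 <= enorm x.
Proof. exact: sqrtr_ge0. Qed.

Lemma sqr_enorm x : enorm x ^+ 2 = dot x x.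
Proof. by rewrite sqr_sqrtr// dot_ge0. Qed.

Lemma sqr_enormD x y :
  enorm (x + y) ^+ 2 = enorm x ^+ 2 + 2 * dot y x + enorm y ^+ 2.
Proof. by rewrite !sqr_enorm dotDl !dotDr (dotC x y); ring. Qed.

Lemma sqr_enormZ a x : enorm (a *: x) ^+ 2 = a ^+ 2 * enorm x ^+ 2.
Proof. by rewrite !sqr_enorm dotZl dotZr mulrA. Qed.

Lemma dot_delta x i : dot x (delta_mx ord0 i) = x ord0 i.
Proof.
rewrite /dot (bigD1 i)//= mxE !eqxx mulr1 big1 ?addr0// => j ji.
by rewrite mxE (negbTE ji) andbF mulr0.
Qed.

End euclidean.

(** Equivalently, log (1 + z) >= z - 2 z^2. It turns the product of the Jacobian factors into a sum
    of partial derivatives, that is, into the divergence. *)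
Lemma expR_le1D (R : realType) (z : R) : `|z| <= 2^-1 ->
  expR (z - 2 * z ^+ 2) <= 1 + z.
Proof.
rewrite ler_norml => /andP[z1 z2].
have p : 0 < 1 - (z - 2 * z ^+ 2) by have := sqr_ge0 z; nra.
rewrite -[leLHS]invrK -expRN -[leRHS]invrK; have p1 : 0 < 1 + z by lra.
rewrite lef_pV2 ?posrE ?expR_gt0 ?invr_gt0//.
apply: le_trans (expR_ge1Dx _); rewrite -[leLHS]mul1r ler_pdivrMr//.
have -> : (1 + - (z - 2 * z ^+ 2)) * (1 + z) = 1 + z ^+ 2 * (1 + 2 * z) by ring.
by rewrite lerDl mulr_ge0 ?sqr_ge0//; lra.
Qed.

Section lipschitz_partials.
Context {R : realType} {n : nat}.
Local Notation mu := (@lebesgue_measure_rV R n.+1).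

Lemma derive_lip_le (f : 'rV[R]_n.+1 -> R) (L : R) j x :
  (forall x y, `|f x - f y| <= L * `|x - y|) -> 0 <= L ->
  derivable f x (delta_mx ord0 j) -> `|'D_(delta_mx ord0 j) f x| <= L.
Proof.
move=> fL L0 df.
have q : \forall t \near (0 : R)^', `|t^-1 *: (f (t *: delta_mx ord0 j + x) - f x)| <= L.
  near=> t; have t0 : t != 0 by near: t; exact: nbhs_dnbhs_neq.
  rewrite normrZ normfV mulrC ler_pdivrMr ?normr_gt0//.
  rewrite (le_trans (fL _ _))// addrK ler_wpM2l// normrZ.
  by rewrite ler_piMr// norm_delta_mx.
rewrite ler_norml; apply/andP; split.
  apply: limr_ge => //; apply: filterS q => t.
  by rewrite ler_norml => /andP[].
by apply: limr_le => //; apply: filterS q => t; rewrite ler_norml => /andP[].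
Unshelve. all: by end_near. Qed.

Lemma coord_lip (Y : 'rV[R]_n.+1 -> 'rV[R]_n.+1) (L : R) :
  (forall x y, `|Y x - Y y| <= L * `|x - y|) ->
  forall j x y, `|Y x ord0 j - Y y ord0 j| <= L * `|x - y|.
Proof.
move=> YL j x y.
by apply: le_trans (YL x y); have := coord_le_norm (Y x - Y y) j; rewrite !mxE.
Qed.

Lemma lip_partials_derivable (Y : 'rV[R]_n.+1 -> 'rV[R]_n.+1) (L : R) :
  (forall x y, `|Y x - Y y| <= L * `|x - y|) ->
  {ae mu, forall x, forall j, derivable (fun y => Y y ord0 j) x (delta_mx ord0 j)}.
Proof.
move=> YL; have H (m : nat) : {ae mu, forall x, forall j : 'I_n.+1, j = m :> nat ->
    derivable (fun y => Y y ord0 j) x (delta_mx ord0 j)}.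
  have [mN|Nm] := ltnP m n.+1; last first.
    by apply: aeW => x j jm; move: Nm; rewrite -jm leqNgt ltn_ord.
  apply: ae_imp (lip_partial_derivable (Ordinal mN) (coord_lip YL (Ordinal mN))).
  by move=> x dx j jm; rewrite (_ : j = Ordinal mN)//; exact: val_inj.
by apply: ae_imp (ae_foralln H) => x Hx j; exact: (Hx j).
Qed.

Lemma measurable_euler_step (Y : 'rV[R]_n.+1 -> 'rV[R]_n.+1) (L h : R) :
  (forall x y, `|Y x - Y y| <= L * `|x - y|) ->
  measurable_fun setT (fun x : 'rV[R]_n.+1 => x + h *: Y x).
Proof.
move=> YL; apply: measurable_fun_rVP => i.
rewrite (_ : (fun x => _) = (fun x : 'rV[R]_n.+1 => x ord0 i + h * Y x ord0 i)); last first.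
  by apply/funext => x; rewrite !mxE.
apply: measurable_funD; first exact: measurable_coord.
apply: measurable_funM; first exact: measurable_cst.
apply: continuous_measurable_rV.
exact: (@lip_coord_continuous _ _ (fun y => Y y ord0 i) L (coord_lip YL i)).
Qed.

End lipschitz_partials.

Section euler_measure.
Context {R : realType} {n : nat}.
Local Notation N := n.+1.
Local Notation mu := (@lebesgue_measure_rV R N).
Variables (Y : 'rV[R]_N -> 'rV[R]_N) (L alpha0 gamma0 alpha gamma : R).
Hypotheses (YL : forall x y, `|Y x - Y y| <= L * `|x - y|).
Hypothesis Ydiv : {ae mu, forall x, alpha0 <= divergence Y x}.
Hypothesis Ydot : forall x y, dot (Y x - Y y) (x - y) <= gamma0 * enorm (x - y) ^+ 2.
Hypotheses (ha : alpha < alpha0) (hg : gamma0 < gamma).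
Local Notation D j x := ('D_(delta_mx ord0 j) (fun y => Y y ord0 j) x).

Let L0 : 0 <= L.
Proof.
have := YL 0 (const_mx 1); have : 0 < `|0 - const_mx 1 : 'rV[R]_N|.
  rewrite normr_gt0 sub0r oppr_eq0; apply/eqP => /rowP/(_ ord0).
  by rewrite !mxE => /eqP; rewrite oner_eq0.
by move=> p /(le_trans (normr_ge0 _)); rewrite pmulr_lge0.
Qed.

(** The second bound tests [Ydot] on points that differ only in coordinate [j], where the scalar
    product sees only that component of [Y]. *)
Let D_bounds j x : derivable (fun y => Y y ord0 j) x (delta_mx ord0 j) ->
  `|D j x| <= L /\ D j x <= gamma0.
Proof.
move=> dY.
have q2 : \forall t \near (0 : R)^', t^-1 *: (Y (t *: delta_mx ord0 j + x) ord0 j - Y x ord0 j) <= gamma0.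
  near=> t; have t0 : t != 0 by near: t; exact: nbhs_dnbhs_neq.
  have := Ydot (t *: delta_mx ord0 j + x) x; rewrite addrK sqr_enorm dotZr dot_delta.
  rewrite dotZl dotZr dot_delta !mxE !eqxx mulr1 => h.
  have t2 : 0 < t ^+ 2 by rewrite exprn_even_gt0.
  rewrite -(ler_pM2r t2); apply: le_trans h.
  by rewrite [leLHS](_ : _ = t * (Y (t *: delta_mx ord0 j + x) ord0 j - Y x ord0 j))// [_ *: _]mulrC; field.
split; last exact: limr_le.
exact: derive_lip_le (coord_lip YL j) L0 dY.
Unshelve. all: by end_near. Qed.

(** The Jacobian is [1 + h * divergence Y] up to order h^2. From below, the divergence is at least
    [alpha0]; from above, each diagonal derivative is at most [gamma0], which costs one factor
    [expR (h * gamma)] per coordinate. The strict gaps absorb the errors for small [h]. *)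
Lemma euler_measure : \forall h \near 0^'+, forall g : 'rV[R]_N -> \bar R,
  measurable_fun setT g -> (forall x, 0 <= g x)%E ->
  ((expR (h * alpha))%:E * \int[mu]_x g (x + h *: Y x)%R <= \int[mu]_x g x /\
   \int[mu]_x g x <= (expR (h * (N%:R * gamma)))%:E * \int[mu]_x g (x + h *: Y x)%R)%E.
Proof.
(* The 10 is 2 + 8: the error [2 * (h * L) ^+ 2] of each factor, and twice the square of
   [2 * (h * L)] from [expR_le1D]. The summand [L] secures [h * L <= 4^-1]. *)
pose K : R := 10 * L ^+ 2 * N%:R + L + 1.
have K0 : 0 < K by rewrite ltr_wpDl// addr_ge0// !mulr_ge0// exprn_ge0.
pose e := Num.min (4^-1) (Num.min (alpha0 - alpha) (gamma - gamma0)).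
have e0 : 0 < e by rewrite !lt_min !subr_gt0 ha hg; lra.
have eK : 0 < e / K by rewrite divr_gt0.
near=> h.
have h0 : 0 < h by near: h; exact: nbhs_right_gt.
have hK : h * K <= e by rewrite -ler_pdivlMr//; near: h; exact: nbhs_right_le.
have hL : h * L <= 4^-1.
  apply: (@le_trans _ _ (h * K)).
    rewrite ler_wpM2l ?ltW// /K; have : 0 <= 10 * L ^+ 2 * N%:R by rewrite !mulr_ge0// exprn_ge0.
    lra.
  by rewrite (le_trans hK)// ge_min lexx.
have N1 : 1 <= N%:R :> R by rewrite ler1n.
have L2 : 0 <= L ^+ 2 by rewrite exprn_ge0.
have hLN : h * (10 * L ^+ 2 * N%:R) <= e.
  by apply: le_trans hK; rewrite ler_wpM2l ?(ltW h0)// /K; have := L0; lra.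
have e1 : e <= alpha0 - alpha by rewrite !ge_min lexx !orbT.
have e2 : e <= gamma - gamma0 by rewrite !ge_min lexx !orbT.
have [b [mb b0 bD bI]] := euler_change_of_variables YL (ltW h0) hL.
have dYae := lip_partials_derivable YL.
have Bae : {ae mu, forall x, expR (h * alpha) <= \prod_j b j x <= expR (h * (N%:R * gamma))}.
  apply: ae_imp2 dYae Ydiv => x dY dv.
  have zb j : `|b j x - 1| <= 2 * (h * L) /\ h * D j x - 2 * (h * L) ^+ 2 <= b j x - 1 /\
      b j x <= expR (h * gamma).
    have [D1 D2] := D_bounds (dY j).
    have := bD j x (dY j); rewrite ler_norml => /andP[h1 h2].
    have hD : `|h * D j x| <= h * L by rewrite normrM (gtr0_norm h0) ler_wpM2l// ltW.
    have hL2 : (h * L) ^+ 2 <= 4^-1 * (h * L) by rewrite expr2 ler_wpM2r// mulr_ge0// ltW.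
    split; last split; last first.
    - apply: le_trans (expR_ge1Dx _).
      have : h * D j x <= h * gamma0 by rewrite ler_wpM2l// ltW.
      have : 2 * (h * L) ^+ 2 <= h * (gamma - gamma0); last by lra.
      rewrite (_ : 2 * _ = h * (h * (2 * L ^+ 2))); last by ring.
      rewrite ler_wpM2l ?(ltW h0)// (le_trans _ e2)// (le_trans _ hLN)//.
      rewrite ler_wpM2l ?(ltW h0)// (@le_trans _ _ (10 * L ^+ 2))//; first lra.
      by rewrite ler_peMr// mulr_ge0.
    - lra.
    - move: hD; rewrite !ler_norml => /andP[h3 h4]; apply/andP; split; lra.
  apply/andP; split; last first.
    rewrite mulrCA expRM_natl.
    rewrite -[X in _ <= _ ^+ X]card_ord -prodr_const.
    by apply: ler_prod => j _; rewrite b0/=; have [_ []] := zb j.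
  apply: (@le_trans _ _ (\prod_j expR ((b j x - 1) - 2 * (b j x - 1) ^+ 2))); last first.
    apply: ler_prod => j _; rewrite expR_ge0/=.
    rewrite -[leRHS](subrK 1) [leRHS]addrC; apply: expR_le1D.
    by have [z1 _] := zb j; lra.
  rewrite -expR_sum ler_expR.
  apply: (@le_trans _ _ (\sum_j (h * D j x - 10 * (h * L) ^+ 2))); last first.
    apply: ler_sum => j _; have [z1 [z2 _]] := zb j.
    have : (b j x - 1) ^+ 2 <= (2 * (h * L)) ^+ 2.
      by rewrite -real_normK ?num_real// ler_sqr ?nnegrE ?normr_ge0// mulr_ge0// mulr_ge0// ltW.
    rewrite exprMn; lra.
  rewrite sumrB -mulr_sumr sumr_const card_ord -[X in _ - X]mulr_natr.
  have : h * alpha0 <= h * divergence Y x by rewrite ler_wpM2l// ltW.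
  rewrite /divergence.
  have : 10 * (h * L) ^+ 2 * N%:R <= h * (alpha0 - alpha).
    rewrite (_ : _ * _ = h * (h * (10 * L ^+ 2 * N%:R))); last by ring.
    by rewrite ler_wpM2l ?(ltW h0)// (le_trans hLN).
  lra.
move=> g mg g0; rewrite (bI g mg g0).
have mT : measurable_fun setT (fun x : 'rV[R]_N => x + h *: Y x).
  exact: measurable_euler_step YL.
have mgT := measurableT_comp mg mT.
have mp : measurable_fun setT (fun x => (\prod_j b j x)%:E).
  by apply/measurable_EFinP; exact: measurable_prod.
split.
- rewrite -ge0_integralZl// ?lee_fin ?expR_ge0//.
  apply: ae_ge0_le_integral => //.
  + by move=> x _; rewrite mule_ge0// lee_fin expR_ge0.
  + exact: measurable_funeM.
  + by move=> x _; rewrite mule_ge0// lee_fin prodr_ge0.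
  + exact: emeasurable_funM.
  + apply: ae_imp Bae => x /andP[h1 _] _.
    by rewrite muleC lee_wpmul2l// lee_fin.
- rewrite -ge0_integralZl// ?lee_fin ?expR_ge0//.
  apply: ae_ge0_le_integral => //.
  + by move=> x _; rewrite mule_ge0// lee_fin prodr_ge0.
  + exact: emeasurable_funM.
  + by move=> x _; rewrite mule_ge0// lee_fin expR_ge0.
  + exact: measurable_funeM.
  + apply: ae_imp Bae => x /andP[_ h1] _.
    by rewrite [leRHS]muleC lee_wpmul2l// lee_fin.
Unshelve. all: by end_near. Qed.

End euler_measure.

(** * Local geometry of the domain *)

Section norms.
Context {R : realType} {n : nat}.
Implicit Types x y v : 'rV[R]_n.

Lemma dot_le x y : `|dot x y| <= n%:R * `|x| * `|y|.
Proof.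
rewrite (le_trans (ler_norm_sum _ _ _))//.
apply: (@le_trans _ _ (\sum_(i < n) `|x| * `|y|)).
  by apply: ler_sum => i _; rewrite normrM ler_pM// coord_le_norm.
by rewrite sumr_const card_ord -[leLHS]mulr_natl mulrA.
Qed.

Lemma norm_le_enorm x : `|x| <= enorm x.
Proof.
apply: norm_le_coord => [|i]; first exact: enorm_ge0.
rewrite -ler_sqr ?nnegrE ?enorm_ge0// sqr_enorm real_normK ?num_real//.
by rewrite /dot (bigD1 i)//= -expr2 lerDl sumr_ge0// => j _; rewrite -expr2 sqr_ge0.
Qed.

Lemma enorm_le x : enorm x <= n%:R * `|x|.
Proof.
rewrite -ler_sqr ?nnegrE ?enorm_ge0 ?mulr_ge0// sqr_enorm.
rewrite (le_trans (ler_norm _))// (le_trans (dot_le _ _))//.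
rewrite exprMn expr2 -!mulrA ler_wpM2l//.
case: n x => [|m] x.
  have : `|x| <= 0 by apply: norm_le_coord => // -[].
  by rewrite normr_le0 => /eqP ->; rewrite normr0 !mul0r.
by rewrite expr2 ler_peMl ?mulr_ge0// ler1n.
Qed.

Lemma lipschitz_bound (V W : normedModType R) (f : V -> W) : lipschitz f ->
  exists2 L : R, 0 <= L & forall x y : V, `|f x - f y| <= L * `|x - y|.
Proof.
move=> [M [_ HM]]; exists (Num.max M 0 + 1).
  by rewrite addr_ge0// le_max lexx orbT.
move=> x y; have : M < Num.max M 0 + 1 by rewrite ltr_pwDr// le_max lexx.
by move=> /HM/(_ (x, y)); apply.
Qed.

End norms.

Section local_geometry.
Context {R : realType} {n : nat}.
Implicit Types (Omega : set 'rV[R]_n) (x v w : 'rV[R]_n).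

(** Strict differentiability at the single point [x]. Two free points are needed because [psi] is
    compared at [y] and at [y + t *: w], neither of which has to be [x]. *)
Definition strict_gradient (psi : 'rV[R]_n -> R) x w := forall e : R, 0 < e ->
  exists2 d : R, 0 < d & forall y z, `|y - x| < d -> `|z - x| < d ->
    `|psi y - psi z - dot w (y - z)| <= e * `|y - z|.

Definition local_defining Omega x w := exists psi : 'rV[R]_n -> R,
  strict_gradient psi x w /\
  exists2 d : R, 0 < d & forall y, `|y - x| < d -> (Omega y <-> psi y < 0).

(** Uniformity in point, direction and step makes this stable under small changes of [x] and [v]. It
    refers to no chart, which allows normals coming from unrelated charts to be compared. *)
Definition leaving Omega x v := exists2 d : R, 0 < d &
  forall y w t, `|y - x| < d -> `|w - v| < d -> 0 < t < d ->
    ~ Omega y -> ~ Omega (y + t *: w).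

Lemma leaving_near Omega x v : leaving Omega x v ->
  exists2 d : R, 0 < d & forall y w, `|y - x| < d -> `|w - v| < d -> leaving Omega y w.
Proof.
move=> [d d0 H]; exists (d / 2); first by rewrite divr_gt0.
move=> y w yx wv; exists (d / 2); first by rewrite divr_gt0.
move=> z w' t zy w'w /andP[t0 td]; apply: H.
- by rewrite (le_lt_trans (ler_distD y _ _))// [ltRHS]splitr ltrD.
- by rewrite (le_lt_trans (ler_distD w _ _))// [ltRHS]splitr ltrD.
- by rewrite t0 (lt_trans td)// ltr_pdivrMr// ltr_pMr// ltr1n.
Qed.

Lemma leaving_of_dot Omega x v w : local_defining Omega x w ->
  0 < dot w v -> leaving Omega x v.
Proof.
move=> [psi [psiw [d d0 Od]]] wv.
pose V := `|v| + 1; have V0 : 0 < V by rewrite ltr_wpDl.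
pose W := n%:R * `|w| + 1; have W0 : 0 < W by rewrite ltr_wpDl// mulr_ge0.
have e0 : 0 < dot w v / 2 / V by rewrite !divr_gt0.
have [d' d'0 H] := psiw _ e0.
pose r := Num.min (Num.min d d') 1.
have r0 : 0 < r by rewrite !lt_min d0 d'0 ltr01.
(* In this order: [y] stays within [r / 2] of [x], the displacement [t *: w'] has norm at most
   [r / 2], and [dot w w'] keeps half of [dot w v], which pays for the linearization error of
   [psi]. *)
pose c := Num.min (r / 2) (Num.min (r / (2 * V)) (dot w v / 2 / W)).
have c0 : 0 < c by rewrite !lt_min !divr_gt0// mulr_gt0.
exists c => // y w' t yx; rewrite {1}/c !lt_min => /and3P[w1 w2 w3].
move=> /and4P[t0 t1 t2 t3] nOy.
have r1 : r <= 1 by rewrite ge_min lexx orbT.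
have yr : `|y - x| < r / 2 by apply: (lt_le_trans yx); rewrite ge_min lexx.
have w'V : `|w'| <= V.
  rewrite -[w'](subrK v) addrC (le_trans (ler_normD _ _))// lerD2l.
  by rewrite (le_trans (ltW w1))// ler_pdivrMr// mul1r (le_trans r1)// ler1n.
have ytr : `|y + t *: w' - x| < r.
  rewrite -addrAC [_ - x + _]addrC.
  rewrite (le_lt_trans (ler_normD _ _))// [ltRHS]splitr ler_ltD// normrZ gtr0_norm//.
  apply: (@le_trans _ _ (t * V)); first by rewrite ler_pM2l.
  by rewrite -ler_pdivlMr// (le_trans (ltW t2))// invfM mulrA.
have rd : r <= d by rewrite !ge_min lexx.
have rd' : r <= d' by rewrite !ge_min lexx orbT.
have yr' : `|y - x| < r by rewrite (lt_trans yr)// ltr_pdivrMr// ltr_pMr// ltr1n.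
have psiy : 0 <= psi y.
  rewrite leNgt; apply/negP => /(Od y (lt_le_trans yr' rd)); exact: nOy.
move=> /(Od _ (lt_le_trans ytr rd)); apply/negP; rewrite -leNgt.
have := H _ _ (lt_le_trans ytr rd') (lt_le_trans yr' rd').
have -> : y + t *: w' - y = t *: w' by rewrite addrAC subrr add0r.
rewrite normrZ (gtr0_norm t0) dotZr ler_norml => /andP[+ _].
have h1 : dot w v / 2 <= dot w w'.
  rewrite -[w'](subrK v) addrC dotDr.
  have := dot_le w (w' - v); rewrite ler_norml => /andP[+ _].
  have : n%:R * `|w| * `|w' - v| <= dot w v / 2.
    apply: (@le_trans _ _ (W * `|w' - v|)); first by rewrite ler_wpM2r// lerDl.
    by rewrite mulrC -ler_pdivlMr// ltW.
  lra.
have h2 : dot w v / 2 / V * (t * `|w'|) <= t * (dot w v / 2).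
  rewrite mulrCA ler_pM2l// mulrAC ler_pdivrMr// ler_wpM2l// ltW// divr_gt0//.
have h3 : t * (dot w v / 2) <= t * dot w w' by rewrite ler_pM2l.
lra.
Qed.

(** Since [psi x <= 0] at a limit of points of [Omega], a direction with negative product would
    enter [Omega]; this gives the weak inequality for all leaving directions. These form an open
    set, so [v] tilted slightly against [w] still leaves, and the inequality for [v] is strict. *)
Lemma dot_of_leaving Omega x v w : w != 0 -> local_defining Omega x w ->
  closure Omega x -> ~ Omega x -> leaving Omega x v -> 0 < dot w v.
Proof.
move=> w0 [psi [psiw [d d0 Od]]] clx nOx.
have ww : 0 < dot w w.
  rewrite lt_neqAle dot_ge0 andbT eq_sym -sqr_enorm sqrf_eq0 gt_eqF//.
  by rewrite (lt_le_trans _ (norm_le_enorm w))// normr_gt0.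
have psix : psi x <= 0.
  have [d1 d10 H1] := psiw 1 ltr01.
  pose C := n%:R * `|w| + 1; have C0 : 0 < C by rewrite ltr_wpDl// mulr_ge0.
  rewrite leNgt; apply/negP => px.
  pose r := Num.min (Num.min d d1) (psi x / C).
  have r0 : 0 < r by rewrite !lt_min d0 d10 divr_gt0.
  have [y [Oy]] := clx _ (nbhsx_ballx x r r0).
  rewrite -ball_normE/= distrC !lt_min => /andP[/andP[yd yd1] yC].
  have := H1 x y; rewrite subrr normr0 => /(_ d10 yd1).
  rewrite ler_norml => /andP[_]; have := (Od y yd).1 Oy.
  have := dot_le w (x - y); rewrite ler_norml (distrC x) => /andP[_].
  move: yC; rewrite ltr_pdivlMr// /C mulrDr mulr1 => h1 h2 h3 h4; lra.
suff dot_ge v' : leaving Omega x v' -> 0 <= dot w v'.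
  move=> /leaving_near[e e0 He].
  have a0 : 0 < e / 2 / `|w| by rewrite !divr_gt0// normr_gt0.
  have : leaving Omega x (v - (e / 2 / `|w|) *: w).
    apply: He; first by rewrite subrr normr0.
    rewrite addrAC subrr add0r normrN normrZ gtr0_norm// mulfVK ?normr_eq0//.
    by rewrite ltr_pdivrMr// ltr_pMr// ltr1n.
  move=> /dot_ge; rewrite dotDr dotNr dotZr subr_ge0; apply: lt_le_trans.
  by rewrite mulr_gt0.
move=> [e e0 He]; rewrite leNgt; apply/negP => wv.
pose V := `|v'| + 1; have V0 : 0 < V by rewrite ltr_wpDl.
have e1 : 0 < - dot w v' / 2 / V by rewrite !divr_gt0// oppr_gt0.
have [d1 d10 H1] := psiw _ e1.
pose r := Num.min (Num.min d d1) e; have r0 : 0 < r by rewrite !lt_min d0 d10 e0.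
pose t := Num.min (r / V) r / 2.
have t0 : 0 < t by rewrite divr_gt0// lt_min r0 divr_gt0.
have r2 : r / 2 < r by rewrite ltr_pdivrMr// ltr_pMr// ltr1n.
have tr : t < r.
  by rewrite (le_lt_trans _ r2)// /t ler_wpM2r// ge_min lexx orbT.
have tV : t * `|v'| < r.
  apply: (@lt_le_trans _ _ (t * V)); first by rewrite ltr_pM2l// ltrDl.
  rewrite -ler_pdivlMr//; apply: (@le_trans _ _ (r / V / 2)).
    by rewrite ler_wpM2r// ge_min lexx.
  by have : 0 < r / V by [rewrite divr_gt0]; lra.
have xr : `|x + t *: v' - x| < r by rewrite addrAC subrr add0r normrZ gtr0_norm.
have rd : r <= d by rewrite !ge_min lexx.
have rd1 : r <= d1 by rewrite !ge_min lexx orbT.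
have re : r <= e by rewrite ge_min lexx orbT.
apply: (He x v' t) => //; [by rewrite subrr normr0|by rewrite subrr normr0|by rewrite t0 (lt_le_trans tr)|].
apply/(Od _ (lt_le_trans xr rd)).
have := H1 _ x (lt_le_trans xr rd1); rewrite subrr normr0 => /(_ d10).
have -> : x + t *: v' - x = t *: v' by rewrite addrAC subrr add0r.
rewrite normrZ (gtr0_norm t0) dotZr ler_norml => /andP[_].
have : - dot w v' / 2 / V * (t * `|v'|) <= t * (- dot w v' / 2).
  rewrite mulrCA ler_pM2l// mulrAC ler_pdivrMr// ler_wpM2l ?lerDl//.
  by rewrite divr_ge0// oppr_ge0 ltW.
have : t * dot w v' < 0 by rewrite pmulr_rlt0.
lra.
Qed.

End local_geometry.

(** * Transversal fields and the exterior under an Euler step *)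

Section transversal_field.
Context {R : realType} {n : nat}.
Implicit Types (Omega : set 'rV[R]_n) (x v w y z : 'rV[R]_n).
Variables (Omega : set 'rV[R]_n).
Hypotheses (oO : open Omega) (bO : bounded_set Omega).
Local Notation bd := (topological_boundary Omega).

Lemma dot_sumr (I : eqType) (s : seq I) (F : I -> 'rV[R]_n) w :
  dot w (\sum_(i <- s) F i) = \sum_(i <- s) dot w (F i).
Proof.
apply: (big_morph (dot w)) => [x y|]; first exact: dotDr.
by rewrite /dot big1// => i _; rewrite mxE mulr0.
Qed.

Lemma bounded_norm_le : exists2 M : R, 0 <= M & forall x, Omega x -> `|x| <= M.
Proof.
have [M [_ HM]] := bO; exists (Num.max M 0 + 1).
  by rewrite addr_ge0// le_max lexx orbT.
by move=> x Ox; apply: HM => //; rewrite ltr_pwDr// le_max lexx.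
Qed.

Lemma closed_norm_le (M : R) : closed [set x : 'rV[R]_n | `|x| <= M].
Proof.
apply: (@closed_comp _ _ (fun x : 'rV[R]_n => `|x|) [set r | r <= M]); last exact: closed_le.
by move=> x _; exact: norm_continuous.
Qed.

Lemma boundaryP x : bd x -> closure Omega x /\ ~ Omega x.
Proof. by rewrite /topological_boundary ((interior_id _).1 oO) => -[]. Qed.

Lemma boundaryI x : closure Omega x -> ~ Omega x -> bd x.
Proof. by rewrite /topological_boundary ((interior_id _).1 oO). Qed.

Lemma compact_boundary : compact bd.
Proof.
apply: bounded_closed_compact.
  have [M M0 OM] := bounded_norm_le.
  exists M; split; first exact: num_real.
  move=> r Mr x /boundaryP[clx _]; apply: (le_trans _ (ltW Mr)).
  have : closure Omega `<=` [set x : 'rV[R]_n | `|x| <= M].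
    by rewrite [X in _ `<=` X](closure_id _).1; [apply: closureS|exact: closed_norm_le].
  by apply.
rewrite /topological_boundary setDE; apply: closedI; first exact: closed_closure.
by apply: open_closedC; exact: open_interior.
Qed.

Section field.
Variable nu : 'rV[R]_n -> 'rV[R]_n.
Hypothesis nu0 : forall x, bd x -> nu x != 0.
Hypothesis nu_def : forall x, bd x -> local_defining Omega x (nu x).

Lemma leaving_iff_dot x v : bd x -> leaving Omega x v <-> 0 < dot (nu x) v.
Proof.
move=> bx; have [clx nOx] := boundaryP bx; split.
  exact: dot_of_leaving (nu0 bx) (nu_def bx) clx nOx.
exact: leaving_of_dot (nu_def bx).
Qed.

Lemma max0_dist (a b : R) : `|Num.max 0 a - Num.max 0 b| <= `|a - b|.
Proof.
rewrite ler_norml; have := ler_norm (a - b); have := ler_norm (b - a); rewrite distrC.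
by case: (leP 0 a); case: (leP 0 b) => ? ? ? ?; apply/andP; split; lra.
Qed.

(* Cones of directions leaving Omega are locally constant, so a normal at a
   boundary point stays transversal at the nearby ones; conversely a leaving
   direction has positive scalar product with the normal. This makes a sum of
   cut-off normals transversal without any continuity of the normal. *)
Lemma transversal_field : exists (Z : 'rV[R]_n -> 'rV[R]_n) (L : R),
  [/\ 0 <= L, forall x y, `|Z x - Z y| <= L * `|x - y| &
      forall x, bd x -> 0 < dot (nu x) (Z x)].
Proof.
have /choice[d Hd] : forall x, exists d : R, 0 < d /\ (bd x ->
    forall y, `|y - x| < d -> leaving Omega y (nu x)).
  move=> x; have [bx|nbx] := pselect (bd x); last by exists 1; split.
  have xx : 0 < dot (nu x) (nu x).
    rewrite lt_neqAle dot_ge0 andbT eq_sym -sqr_enorm sqrf_eq0 gt_eqF//.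
    by rewrite (lt_le_trans _ (norm_le_enorm _))// normr_gt0 nu0.
  have /leaving_near[e e0 He] := (leaving_iff_dot _ bx).2 xx.
  by exists e; split => // _ y yx; apply: He => //; rewrite subrr normr0.
have := compact_boundary; rewrite compact_cover => /(_ _ bd (fun x => ball x (d x))).
case=> [x _|x bx|D Dbd cD]; first exact: ball_open.
  by exists x => //; apply: ballxx; have [] := Hd x.
pose s : seq 'rV[R]_n := finmap.enum_fset D.
have sbd x : x \in s -> bd x by move=> xD; have := Dbd x xD; rewrite inE.
pose tent x y := Num.max 0 (d x - `|y - x|).
exists (fun y => \sum_(x <- s) tent x y *: nu x), (\sum_(x <- s) `|nu x|); split.
- by apply: sumr_ge0.
- move=> y z; rewrite -sumrB mulr_suml (le_trans (ler_norm_sum _ _ _))//.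
  apply: ler_sum => x _; rewrite -scalerBl normrZ mulrC ler_wpM2l//.
  rewrite (le_trans (max0_dist _ _))// opprB addrC addrA subrK.
  by rewrite distrC (le_trans (ler_dist_dist _ _))// opprB addrA subrK.
- move=> y by_.
  have dot0 x : x \in s -> 0 <= dot (nu y) (tent x y *: nu x).
    move=> xD; rewrite dotZr; rewrite /tent; case: (leP 0 (d x - `|y - x|)) => [|_]; last by rewrite mul0r.
    rewrite le_eqVlt => /orP[/eqP <-|h]; first by rewrite mul0r.
    rewrite mulr_ge0 ?ltW//; apply/(leaving_iff_dot _ by_).
    have [_] := Hd x; apply; last by rewrite -subr_gt0.
    exact: sbd.
  rewrite dot_sumr; have [x xD yx] := cD y by_.
  have xD' : x \in s by [].
  rewrite (big_rem x xD')/= ltr_pwDl//; last first.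
    by rewrite big_seq; apply: sumr_ge0 => z /mem_rem; exact: dot0.
  have yx' : `|y - x| < d x by rewrite distrC; move: yx; rewrite -ball_normE.
  rewrite dotZr mulr_gt0//; first by rewrite lt_max subr_gt0 yx' orbT.
  apply/(leaving_iff_dot _ by_); have [_] := Hd x; apply => //.
  exact: sbd.
Qed.

End field.

(** At boundary points the field leaves [Omega], and off the closure there is room for a short step;
    compactness makes the threshold on [h] uniform in a large ball. Beyond this ball the linear
    growth of [Y] prevents a short step from reaching [Omega]. *)
Lemma euler_step_exterior (Y : 'rV[R]_n -> 'rV[R]_n) (L : R) :
  0 <= L -> (forall x y, `|Y x - Y y| <= L * `|x - y|) ->
  (forall x, bd x -> leaving Omega x (Y x)) ->
  \forall h \near 0^'+, forall x, ~ Omega x -> ~ Omega (x + h *: Y x).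
Proof.
move=> L0 YL Yl; have [M M0 OM] := bounded_norm_le.
(* For small [h] the norm of [x + h *: Y x] is at least [|x| / 2 - 1], which exceeds [M] as soon as
   [|x|] exceeds [2 * (M + 1)]. *)
pose K := ~` Omega `&` [set x : 'rV[R]_n | `|x| <= 2 * (M + 1)].
have cK : compact K.
  apply: bounded_closed_compact.
    exists (2 * (M + 1)); split; first exact: num_real.
    by move=> r Mr x [_ /= xM]; exact: le_trans (ltW Mr).
  by apply: closedI; [exact: open_closedC|exact: closed_norm_le].
have L1 : 0 < L + 1 by rewrite ltr_wpDl.
have cov : forall x, K x -> \forall x' \near x & h \near (0 : R)^'+,
    ~ Omega x' -> ~ Omega (x' + h *: Y x').
  move=> x [nOx _]; have [clx|nclx] := pselect (closure Omega x).
    have [d d0 Hd] := Yl _ (boundaryI clx nOx).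
    exists (ball x (Num.min d (d / (L + 1))), [set h | 0 < h < d]) => /=.
      split; first by apply: nbhsx_ballx; rewrite lt_min d0 divr_gt0.
      near=> h; apply/andP; split; first by near: h; exact: nbhs_right_gt.
      by near: h; exact: nbhs_right_lt.
    move=> [y h] /= []; rewrite -ball_normE/= distrC lt_min => /andP[yd ydL] hd.
    apply: Hd => //; apply: (le_lt_trans (YL y x)).
    apply: (@le_lt_trans _ _ ((L + 1) * `|y - x|)); first by rewrite ler_wpM2r// lerDl.
    by rewrite mulrC -ltr_pdivlMr.
  have nO : nbhs x (~` Omega).
    have : nbhs x (~` closure Omega).
      by apply: open_nbhs_nbhs; split => //; exact/closed_openC/closed_closure.
    by apply: filterS; apply: subsetC; exact: subset_closure.
  have [e /= e0 He] := (nbhs_ballP _ _).1 nO.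
  have V0 : 0 < 2 * (`|Y x| + L + 1) by rewrite mulr_gt0// ltr_wpDl// addr_ge0.
  exists (ball x (Num.min (e / 2) 1), [set h | 0 < h < e / (2 * (`|Y x| + L + 1))]) => /=.
    split; first by apply: nbhsx_ballx; rewrite lt_min ltr01 divr_gt0.
    near=> h; apply/andP; split; first by near: h; exact: nbhs_right_gt.
    by near: h; apply: nbhs_right_lt; rewrite divr_gt0.
  move=> [y h] /= []; rewrite -ball_normE/= distrC lt_min => /andP[yd y1] /andP[h0 hd] _.
  apply: He; rewrite -ball_normE/= distrC -addrAC.
  rewrite (le_lt_trans (ler_normD _ _))// [ltRHS]splitr ltr_leD//.
  rewrite normrZ gtr0_norm//.
  have : `|Y y| <= `|Y x| + L + 1.
    rewrite -[Y y](subrK (Y x)) addrC (le_trans (ler_normD _ _))// -addrA lerD2l.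
    by rewrite (le_trans (YL y x))// (@le_trans _ _ L)// ?ler_piMr ?lerDl// ltW.
  move=> /(ler_wpM2l (ltW h0)) /le_trans; apply.
  by move: hd; rewrite ltr_pdivlMr// => hd; rewrite ler_pdivlMr//; nra.
have covK := (compact_near_coveringP K).1 cK _ _ _ _ cov.
have B0 : 0 < (2 * (L + 1))^-1 by rewrite invr_gt0 mulr_gt0.
have C0 : 0 < (`|Y 0| + 1)^-1 by rewrite invr_gt0 ltr_wpDl.
near=> h => x nOx.
have h0 : 0 < h by near: h; exact: nbhs_right_gt.
have [xM|xM] := leP `|x| (2 * (M + 1)).
  suff KP : K `<=` (fun x' => ~ Omega x' -> ~ Omega (x' + h *: Y x')) by exact: KP.
  by near: h; exact: covK.
move=> /OM; apply/negP; rewrite -ltNge.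
have h1 : h * (2 * (L + 1)) <= 1.
  by rewrite -ler_pdivlMr ?mulr_gt0// mul1r; near: h; exact: nbhs_right_le.
have h2 : h * (`|Y 0| + 1) <= 1.
  by rewrite -ler_pdivlMr ?ltr_wpDl// mul1r; near: h; exact: nbhs_right_le.
have h3 : `|Y x| <= `|Y 0| + L * `|x|.
  rewrite -[Y x](subrK (Y 0)) addrC (le_trans (ler_normD _ _))// lerD2l.
  by rewrite (le_trans (YL _ _))// subr0.
have h4 : `|x| - h * `|Y x| <= `|x + h *: Y x|.
  rewrite lerBlDr -{1}[x](addrK (h *: Y x)) (le_trans (ler_normB _ _))//.
  by rewrite normrZ gtr0_norm.
have h5 : h * `|Y x| <= h * (`|Y 0| + L * `|x|) by rewrite ler_wpM2l// ltW.
have h6 : h * (2 * (L + 1)) * `|x| <= `|x| by rewrite ler_piMl.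
have x0 := normr_ge0 x; have hx : 0 <= h * `|x| by rewrite mulr_ge0// ltW.
apply: lt_le_trans h4; nra.
Unshelve. all: by end_near. Qed.

End transversal_field.

(** * Defining functions and normals from charts *)

Section C11_charts.
Context {R : realType}.

Lemma derive_dot_grad n (g : 'rV[R]_n -> R) p v : differentiable g p ->
  'D_v g p = dot (grad g p) v.
Proof.
move=> dg; rewrite deriveE// {1}(row_sum_delta v) linear_sum /dot.
apply: eq_bigr => i _; rewrite linearZ /= mxE deriveE//.
by rewrite [LHS]mulrC.
Qed.

(** The mean value theorem on the segment from [b] to [a] gives the gradient at an intermediate
    point, which the Lipschitz bound compares with the one at [z]. *)
Lemma C11_strict_gradient n (g : 'rV[R]_n -> R) z : C11 g ->
  strict_gradient g z (grad g z).
Proof.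
move=> [dg /lipschitz_bound[L L0 gL]] e e0.
have C0 : 0 < n%:R * L + 1 by rewrite ltr_wpDl// mulr_ge0.
exists (e / (n%:R * L + 1)); first by rewrite divr_gt0.
move=> a b az bz; pose v := a - b; pose phi (t : R) := g (t *: v + b).
have phid (t : R) : is_derive t (1 : R) phi (dot (grad g (t *: v + b)) v).
  have gd : derivable g (t *: v + b) v by exact: diff_derivable.
  have E : (fun h : R => h^-1 *: (phi (h *: 1 + t) - phi t)) =
           (fun h : R => h^-1 *: (g (h *: v + (t *: v + b)) - g (t *: v + b))).
    by apply/funext => h; rewrite /phi [h *: 1]mulr1 scalerDl -addrA.
  apply: DeriveDef; first by rewrite /derivable E.
  by rewrite -derive_dot_grad// /derive E.
have phic : {within `[0, 1], continuous phi}.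
  apply: continuous_subspaceT => t.
  by apply: differentiable_continuous; apply/derivable1_diffP; case: (phid t).
have [c] := MVT ltr01 (fun t _ => phid t) phic.
rewrite in_itv/= subr0 mulr1 => /andP[c0 c1].
rewrite /phi scale1r scale0r add0r /v subrK => ->.
rewrite -/v -dotNl -dotDl (le_trans (dot_le _ _))// ler_wpM2r//.
have cz : `|c *: v + b - z| <= e / (n%:R * L + 1).
  have -> : c *: v + b - z = c *: (a - z) + (1 - c) *: (b - z).
    rewrite /v !scalerBr scalerBl scale1r scalerBl scale1r.
    by apply/rowP => i; rewrite !mxE; ring.
  rewrite (le_trans (ler_normD _ _))// !normrZ gtr0_norm// gtr0_norm ?subr_gt0//.
  have := ltW az; have := ltW bz; set D := e / _ => h1 h2.
  have := ler_wpM2l (ltW c0) h2; have c1' : 0 <= 1 - c by rewrite subr_ge0 ltW.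
  have := ler_wpM2l c1' h1; lra.
apply: (@le_trans _ _ (n%:R * (L * (e / (n%:R * L + 1))))).
  by rewrite ler_wpM2l// (le_trans (gL _ _))// ler_wpM2l.
rewrite [leLHS](_ : _ = n%:R * L * e / (n%:R * L + 1)); last by rewrite !mulrA.
by rewrite ler_pdivrMr// mulrC ler_wpM2l ?lerDl// ltW.
Qed.

Context {N : nat}.
Implicit Types (Omega : set 'rV[R]_N) (x y w : 'rV[R]_N).

Lemma strict_gradientZ (psi : 'rV[R]_N -> R) x w a :
  strict_gradient psi x w -> strict_gradient (fun y => a * psi y) x (a *: w).
Proof.
move=> pw e e0; have a1 : 0 < `|a| + 1 by rewrite ltr_wpDl.
have [d d0 H] := pw _ (divr_gt0 e0 a1); exists d => // y z yx zx.
rewrite dotZl -!mulrBr normrM.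
apply: (@le_trans _ _ (`|a| * (e / (`|a| + 1) * `|y - z|))).
  by rewrite ler_wpM2l// H.
rewrite !mulrA ler_wpM2r// ler_pdivrMr// mulrC ler_wpM2l ?lerDl// ltW//.
Qed.

Lemma mulmx_norm_le n (x : 'rV[R]_N) (Q : 'M[R]_(N, n)) :
  `|x *m Q| <= (\sum_i \sum_j `|Q i j|) * `|x|.
Proof.
apply: norm_le_coord => [|j].
  by rewrite mulr_ge0// sumr_ge0// => i _; exact: sumr_ge0.
rewrite mxE (le_trans (ler_norm_sum _ _ _))// mulr_suml.
apply: ler_sum => i _; rewrite normrM mulrC ler_pM// ?coord_le_norm//.
by rewrite (bigD1 j)//= lerDl sumr_ge0.
Qed.

(** The defining function is graph minus height in the rotated coordinates, divided by [enorm w];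
    its gradient is [w] carried back by the orthogonal matrix. It cannot vanish, as coordinate [i]
    of [w] is -1. *)
Lemma C11_chart_local_defining Omega x r Q i g : C11_chart Omega x r Q i g ->
  let w := graph_conormal i g (x *m Q) in
  (enorm w)^-1 *: (w *m Q^T) != 0 /\
  local_defining Omega x ((enorm w)^-1 *: (w *m Q^T)).
Proof.
move=> [r0 QQ Cg Og] w.
have wi : w ord0 i = -1 by rewrite mxE unlift_none.
have w0 : 0 < enorm w.
  apply: lt_le_trans (norm_le_enorm w); rewrite normr_gt0.
  by apply/eqP => w0; move: wi; rewrite w0 mxE => /eqP; rewrite eq_sym oppr_eq0 oner_eq0.
split.
  rewrite scaler_eq0 invr_eq0 gt_eqF//=; apply/eqP => wQ.
  have : w *m Q^T *m Q = w by rewrite -mulmxA (mulmx1C QQ) mulmx1.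
  rewrite wQ mul0mx => w00; move: wi; rewrite -w00 mxE => /eqP.
  by rewrite eq_sym oppr_eq0 oner_eq0.
pose psi y := g (col' i (y *m Q)) - (y *m Q) ord0 i.
exists (fun y => (enorm w)^-1 * psi y); split; last first.
  (* Charts use the Euclidean ball and [local_defining] the sup norm, whence the radius
     [r / N%:R]. *)
  have N0 : 0 < N%:R :> R by rewrite ltr0n (leq_ltn_trans _ (ltn_ord i)).
  exists (r / N%:R); first by rewrite divr_gt0.
  move=> y yx; rewrite pmulr_rlt0 ?invr_gt0// subr_lt0; apply: Og.
  by rewrite (le_lt_trans (enorm_le _))// mulrC -ltr_pdivlMr.
apply: strict_gradientZ => e e0.
pose C := \sum_i \sum_j `|Q i j| + 1.
have C0 : 0 < C by rewrite ltr_wpDl// sumr_ge0// => k _; exact: sumr_ge0.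
have [d d0 Hd] := C11_strict_gradient (col' i (x *m Q)) Cg (divr_gt0 e0 C0).
have AC y z : `|col' i (y *m Q) - col' i (z *m Q)| <= C * `|y - z|.
  apply: (@le_trans _ _ (`|(y - z) *m Q|)).
    apply: norm_le_coord => // k; rewrite !mxE.
    by have := coord_le_norm ((y - z) *m Q) (lift i k); rewrite mulmxBl !mxE.
  by rewrite (le_trans (mulmx_norm_le _ _))// ler_wpM2r// lerDl.
exists (d / C); first by rewrite divr_gt0.
move=> y z yx zx.
have yx' : `|col' i (y *m Q) - col' i (x *m Q)| < d.
  by rewrite (le_lt_trans (AC _ _))// mulrC -ltr_pdivlMr.
have zx' : `|col' i (z *m Q) - col' i (x *m Q)| < d.
  by rewrite (le_lt_trans (AC _ _))// mulrC -ltr_pdivlMr.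
have dotE : dot (w *m Q^T) (y - z) =
    dot (grad g (col' i (x *m Q))) (col' i (y *m Q) - col' i (z *m Q)) -
    ((y *m Q) ord0 i - (z *m Q) ord0 i).
  have dmx n (a b : 'rV[R]_n) : dot a b = (a *m b^T) ord0 ord0.
    by rewrite mxE; apply: eq_bigr => k _; rewrite mxE.
  rewrite dmx -mulmxA -trmx_mul -dmx /dot (bigD1_ord i)//= wi mulN1r addrC.
  congr (_ + _).
    apply: eq_bigr => k _; rewrite mulmxBl [w _ _]mxE liftK; congr (_ * _).
    by rewrite !mxE.
  by rewrite mulmxBl !mxE.
have := Hd _ _ yx' zx'; rewrite dotE /psi.
rewrite (_ : _ - _ - (_ - _) - (_ - _) = g (col' i (y *m Q)) - g (col' i (z *m Q)) -
  dot (grad g (col' i (x *m Q))) (col' i (y *m Q) - col' i (z *m Q))); last by ring.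
move=> /le_trans; apply.
apply: (@le_trans _ _ (e / C * (C * `|y - z|))).
  by rewrite ler_wpM2l// ltW// divr_gt0.
by rewrite mulrA mulfVK// gt_eqF.
Qed.

Lemma outer_unit_normal_local_defining Omega x nu : outer_unit_normal Omega x nu ->
  nu != 0 /\ local_defining Omega x nu.
Proof. by move=> [r [Q [i [g [/C11_chart_local_defining H ->]]]]]. Qed.

End C11_charts.

(** * Perturbed vector field *)

Section good_field.
Context {R : realType} {n : nat}.
Local Notation N := n.+1.
Local Notation mu := (@lebesgue_measure_rV R N).

(** In the expanded square the cross term is bounded by [gamma0], and the term of order h^2 fits
    into the gap [2 * h * (gamma - gamma0)] for small [h]. *)
Lemma euler_enorm (Y : 'rV[R]_N -> 'rV[R]_N) (L gamma0 gamma : R) :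
  0 <= L -> (forall x y, `|Y x - Y y| <= L * `|x - y|) -> gamma0 < gamma ->
  (forall x y, dot (Y x - Y y) (x - y) <= gamma0 * enorm (x - y) ^+ 2) ->
  \forall h \near 0^'+, forall x y,
    enorm (x + h *: Y x - (y + h *: Y y)) <= expR (h * gamma) * enorm (x - y).
Proof.
move=> L0 YL gg Yg; pose C := (N%:R * L) ^+ 2 + 1.
have C0 : 0 < C by rewrite ltr_wpDl// sqr_ge0.
have e0 : 0 < (2 * (gamma - gamma0)) / C by rewrite divr_gt0// mulr_gt0// subr_gt0.
near=> h => x y.
have h0 : 0 < h by near: h; exact: nbhs_right_gt.
have hC : h * C <= 2 * (gamma - gamma0).
  by rewrite -ler_pdivlMr//; near: h; exact: nbhs_right_le.
rewrite -ler_sqr ?nnegrE ?enorm_ge0 ?mulr_ge0 ?expR_ge0 ?enorm_ge0//.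
rewrite exprMn -expRM_natl.
have -> : x + h *: Y x - (y + h *: Y y) = (x - y) + h *: (Y x - Y y).
  by rewrite scalerBr opprD addrACA.
set d := x - y; set D := Y x - Y y.
have h1 : enorm (d + h *: D) ^+ 2 = enorm d ^+ 2 + 2 * h * dot D d + h ^+ 2 * enorm D ^+ 2.
  by rewrite sqr_enormD sqr_enormZ dotZl mulrA.
have hD : enorm D ^+ 2 <= C * enorm d ^+ 2.
  apply: (@le_trans _ _ ((N%:R * L) ^+ 2 * enorm d ^+ 2)); last first.
    by rewrite ler_wpM2r ?sqr_ge0// lerDl.
  rewrite -exprMn -mulrA ler_sqr ?nnegrE ?enorm_ge0 ?mulr_ge0 ?enorm_ge0//.
  rewrite (le_trans (enorm_le _))// ler_wpM2l// (le_trans (YL x y))//.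
  by rewrite ler_wpM2l// norm_le_enorm.
have g1 := Yg x y; rewrite -/d -/D in g1.
have E0 : 0 <= enorm d ^+ 2 by rewrite sqr_ge0.
apply: (@le_trans _ _ ((1 + 2 * (h * gamma)) * enorm d ^+ 2)); last first.
  by rewrite ler_wpM2r// expR_ge1Dx.
rewrite h1.
have h2 : 2 * h * dot D d <= 2 * h * (gamma0 * enorm d ^+ 2).
  by rewrite ler_wpM2l// mulr_ge0// ltW.
have h3 : h ^+ 2 * enorm D ^+ 2 <= h * (2 * (gamma - gamma0)) * enorm d ^+ 2.
  apply: (@le_trans _ _ (h ^+ 2 * (C * enorm d ^+ 2))).
    by rewrite ler_wpM2l ?sqr_ge0.
  rewrite mulrA ler_wpM2r// expr2 -mulrA ler_wpM2l// ltW//.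
lra.
Unshelve. all: by end_near. Qed.

(** A discrete Gronwall estimate: [A] bounds [Y] on [Omega], and up to time [k%:R * h <= 1] the
    growth [(1 + h * L) ^+ k] stays below [expR L]. Thus [C] depends neither on [h] nor on [k]. *)
Lemma euler_drift (Y : 'rV[R]_N -> 'rV[R]_N) (L : R) (Omega : set 'rV[R]_N) :
  0 <= L -> (forall x y, `|Y x - Y y| <= L * `|x - y|) -> bounded_set Omega ->
  exists2 C : R, 0 <= C & forall (h : R) k x, 0 <= h -> k%:R * h <= 1 -> Omega x ->
    `|iter k (fun x => x + h *: Y x) x - x| <= C * (k%:R * h).
Proof.
move=> L0 YL /bounded_norm_le[M M0 OM].
pose A := `|Y 0| + L * M; have A0 : 0 <= A by rewrite addr_ge0// mulr_ge0.
exists (A * expR L); first by rewrite mulr_ge0// expR_ge0.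
move=> h k x h0 kh Ox.
have hL : 0 <= h * L by rewrite mulr_ge0.
have YA : `|Y x| <= A.
  rewrite -[Y x](subrK (Y 0)) addrC (le_trans (ler_normD _ _))// lerD2l.
  by rewrite (le_trans (YL _ _))// subr0 ler_wpM2l// OM.
suff H : `|iter k (fun x => x + h *: Y x) x - x| <= A * (k%:R * h) * (1 + h * L) ^+ k.
  apply: (le_trans H); rewrite [leRHS]mulrAC ler_wpM2l ?mulr_ge0//.
  apply: (@le_trans _ _ (expR (h * L) ^+ k)).
    by rewrite lerXn2r ?nnegrE ?addr_ge0 ?expR_ge0// expR_ge1Dx.
  by rewrite -expRM_natl ler_expR mulrA ler_piMl.
elim: k {kh} => [|k IH]; first by rewrite subrr normr0 mul0r mulr0 mul0r.
rewrite iterS; set z := iter k _ x in IH *.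
have p0 : 0 <= (1 + h * L) ^+ k by rewrite exprn_ge0// addr_ge0.
have p1 : 1 <= (1 + h * L) ^+ k by rewrite exprn_ege1// lerDl.
have h1 : `|z + h *: Y z - x| <= `|z - x| + h * `|Y z|.
  by rewrite addrAC (le_trans (ler_normD _ _))// normrZ ger0_norm.
have h2 : `|Y z| <= A + L * `|z - x|.
  rewrite -[Y z](subrK (Y x)) addrC (le_trans (ler_normD _ _))// lerD//.
have h3 : h * `|Y z| <= h * (A + L * `|z - x|) by rewrite ler_wpM2l.
apply: (le_trans h1); apply: (@le_trans _ _ (`|z - x| * (1 + h * L) + A * h)); first by lra.
have h4 : `|z - x| * (1 + h * L) <= A * (k%:R * h) * (1 + h * L) ^+ k * (1 + h * L).
  by rewrite ler_wpM2r// addr_ge0.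
have h5 : A * h <= A * h * ((1 + h * L) ^+ k * (1 + h * L)).
  by rewrite ler_peMr ?mulr_ge0// -exprSr exprn_ege1// lerDl.
rewrite exprSr -natr1; lra.
Qed.

Variables (Omega : set 'rV[R]_N) (nu X : 'rV[R]_N -> 'rV[R]_N) (c1 c2 : R).
Hypotheses (oO : open Omega) (bO : bounded_set Omega).
Hypothesis Onu : forall x, topological_boundary Omega x -> outer_unit_normal Omega x (nu x).
Hypothesis Xlip : lipschitz X.
Hypothesis Xdiv : {ae mu, forall x, c1 <= divergence X x}.
Hypothesis Xdot : forall x y, dot (X x - X y) (x - y) <= c2 * enorm (x - y) ^+ 2.
Hypothesis Xnu : forall x, topological_boundary Omega x -> 0 <= dot (X x) (nu x).

(** The field [X] may be tangential somewhere, so a small multiple of a transversal field [Z] is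
    added. The number [N%:R * LZ] bounds both the divergence of [Z] and its one-sided constant, and
    [eta] keeps the perturbation below the gaps [c1 - alpha] and [gamma - c2]. *)
Lemma good_field (alpha gamma : R) : alpha < c1 -> c2 < gamma ->
  exists (Y : 'rV[R]_N -> 'rV[R]_N) (C : R), 0 <= C /\ \forall h \near 0^'+,
  let T := fun x => x + h *: Y x in
  [/\ measurable_fun setT T,
      forall x, ~ Omega x -> ~ Omega (T x),
      forall x y, enorm (T x - T y) <= expR (h * gamma) * enorm (x - y),
      forall g : 'rV[R]_N -> \bar R, measurable_fun setT g -> (forall x, 0 <= g x)%E ->
        ((expR (h * alpha))%:E * \int[mu]_x g (T x) <= \int[mu]_x g x /\
        \int[mu]_x g x <= (expR (h * (N%:R * gamma)))%:E * \int[mu]_x g (T x))%E &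
      forall k x, k%:R * h <= 1 -> Omega x -> `|iter k T x - x| <= C * (k%:R * h)].
Proof.
move=> ac gc.
have nu0 x : topological_boundary Omega x -> nu x != 0.
  by move=> /Onu/outer_unit_normal_local_defining[].
have nud x : topological_boundary Omega x -> local_defining Omega x (nu x).
  by move=> /Onu/outer_unit_normal_local_defining[].
have [Z [LZ [LZ0 ZL Znu]]] := transversal_field oO bO nu0 nud.
have [LX LX0 XL] := lipschitz_bound Xlip.
pose e := Num.min (c1 - alpha) (gamma - c2).
have e0 : 0 < e by rewrite lt_min !subr_gt0 ac gc.
have NL0 : 0 <= N%:R * LZ by rewrite mulr_ge0.
have NL1 : 0 < N%:R * LZ + 1 by rewrite ltr_wpDl.
pose eta := e / (N%:R * LZ + 1).
have eta0 : 0 < eta by rewrite divr_gt0.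
have etae : eta * (N%:R * LZ) < e.
  by rewrite /eta mulrAC ltr_pdivrMr// ltr_pM2l// ltrDl.
pose Y x := X x + eta *: Z x.
pose L := LX + eta * LZ; have L0 : 0 <= L by rewrite addr_ge0// mulr_ge0// ltW.
have YL x y : `|Y x - Y y| <= L * `|x - y|.
  rewrite /Y opprD addrACA -scalerBr (le_trans (ler_normD _ _))// mulrDl lerD//.
  by rewrite normrZ gtr0_norm// -[leRHS]mulrA ler_wpM2l// ltW.
pose gamma0 := c2 + eta * (N%:R * LZ).
pose alpha0 := c1 - eta * (N%:R * LZ).
have g0 : gamma0 < gamma.
  by rewrite /gamma0 -ltrBrDl (lt_le_trans etae)// ge_min lexx orbT.
have a0 : alpha < alpha0.
  by rewrite /alpha0 ltrBrDr addrC -ltrBrDr (lt_le_trans etae)// ge_min lexx.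
have Ydot x y : dot (Y x - Y y) (x - y) <= gamma0 * enorm (x - y) ^+ 2.
  rewrite /Y opprD addrACA -scalerBr dotDl dotZl mulrDl lerD//.
  rewrite -[leRHS]mulrA ler_wpM2l ?(ltW eta0)// (le_trans (ler_norm _))//.
  rewrite (le_trans (dot_le _ _))//.
  apply: (@le_trans _ _ (N%:R * (LZ * `|x - y|) * `|x - y|)).
    by rewrite ler_wpM2r// ler_wpM2l.
  rewrite mulrA -[leLHS]mulrA -expr2 ler_wpM2l// ler_sqr ?nnegrE ?enorm_ge0//.
  exact: norm_le_enorm.
have Ydiv : {ae mu, forall x, alpha0 <= divergence Y x}.
  have dXZ := ae_imp2 (fun x => @conj _ _) (lip_partials_derivable XL) (lip_partials_derivable ZL).
  apply: ae_imp2 dXZ Xdiv => x [dX dZ] /= cX.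
  have -> : divergence Y x = divergence X x +
      eta * \sum_(i < N) 'D_(delta_mx ord0 i) (fun y => Z y ord0 i) x.
    rewrite /divergence mulr_sumr -big_split/=; apply: eq_bigr => i _.
    rewrite (_ : (fun y => Y y ord0 i) =
      (fun y => X y ord0 i) + eta *: (fun y => Z y ord0 i)); last first.
      by apply/funext => y; rewrite !mxE.
    by rewrite deriveD//; [rewrite deriveZ|exact: derivableZ].
  rewrite lerD// -mulrN ler_wpM2l ?(ltW eta0)//.
  have : `|\sum_(i < N) 'D_(delta_mx ord0 i) (fun y => Z y ord0 i) x| <= N%:R * LZ.
    rewrite (le_trans (ler_norm_sum _ _ _))//.
    rewrite -[N in leRHS]card_ord mulr_natl -sumr_const.
    by apply: ler_sum => i _; exact: derive_lip_le (coord_lip ZL i) LZ0 (dZ i).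
  by rewrite ler_norml => /andP[].
have Yleave x : topological_boundary Omega x -> leaving Omega x (Y x).
  move=> bx; apply: (leaving_of_dot (nud x bx)); rewrite dotDr dotZr dotC.
  by rewrite ltr_wpDl ?Xnu// mulr_gt0// Znu.
have [C C0 HC] := euler_drift L0 YL bO.
have H1 := euler_step_exterior oO bO L0 YL Yleave.
have H2 := euler_enorm L0 YL g0 Ydot.
have H3 := euler_measure YL Ydiv Ydot a0 g0.
exists Y, C; split => //.
near=> h; have h0 : 0 < h by near: h; exact: nbhs_right_gt.
split.
- exact: measurable_euler_step YL.
- by near: h; apply: H1.
- by near: h; apply: H2.
- by near: h; apply: H3.
- by move=> k x; apply: HC; rewrite ltW.
Unshelve. all: by end_near. Qed.

End good_field.

(** * Gagliardo forms *)

Section double_integral.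
Context {R : realType} {n : nat}.
Local Notation V := 'rV[R]_n.
Local Notation mu := (@lebesgue_measure_rV R n).
Local Open Scope ereal_scope.

Lemma ge0_measurable_integral_fst (F : V * V -> \bar R) :
  measurable_fun setT F -> (forall z, 0 <= F z) ->
  measurable_fun setT (fun y => \int[mu]_x F (x, y)).
Proof. by move=> mF F0; have := @measurable_fun_fubini_tonelli_G _ _ V V R mu F mF F0. Qed.

Lemma measurable_integral_fst (F : V * V -> \bar R) : measurable_fun setT F ->
  measurable_fun setT (fun y => \int[mu]_x F (x, y)).
Proof.
move=> mF; have h1 := ge0_measurable_integral_fst (measurable_funepos mF) (funepos_ge0 _).
have h2 := ge0_measurable_integral_fst (measurable_funeneg mF) (funeneg_ge0 _).
rewrite (_ : (fun y => _) = (fun y => \int[mu]_x F^\+ (x, y)) \-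
    (fun y => \int[mu]_x F^\- (x, y))); first exact: emeasurable_funB.
apply/funext => y; rewrite integralE; congr (_ - _); apply: eq_integral => x _.
  by rewrite !funeposE.
by rewrite !funenegE.
Qed.

Section ge0.
Variable F : V * V -> \bar R.
Hypotheses (mF : measurable_fun setT F) (F0 : forall z, 0 <= F z).

Let mFl y : measurable_fun setT (fun x => F (x, y)).
Proof. exact: (measurableT_comp mF (measurable_pair2 y)). Qed.

Let mFi : measurable_fun setT (fun y => \int[mu]_x F (x, y)).
Proof. exact: measurable_integral_fst. Qed.

Let Fi0 y : 0 <= \int[mu]_x F (x, y).
Proof. exact: integral_ge0. Qed.

Lemma double_integral_le (G : V * V -> \bar R) : measurable_fun setT G ->
  (forall z, F z <= G z) ->
  \int[mu]_y \int[mu]_x F (x, y) <= \int[mu]_y \int[mu]_x G (x, y).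
Proof.
move=> mG FG; apply: ge0_le_integral => //; first exact: measurable_integral_fst.
move=> y _; apply: ge0_le_integral => //.
exact: (measurableT_comp mG (measurable_pair2 y)).
Qed.

Lemma double_integralZl (c : R) : (0 <= c)%R ->
  \int[mu]_y \int[mu]_x (c%:E * F (x, y)) = c%:E * \int[mu]_y \int[mu]_x F (x, y).
Proof.
move=> c0; rewrite -ge0_integralZl//; apply: eq_integral => y _.
by rewrite ge0_integralZl.
Qed.

(** The one-variable bound is applied once in each variable, hence the square. *)
Lemma double_integral_comp_le (T : V -> V) (a : R) : measurable_fun setT T ->
  (0 <= a)%R ->
  (forall g : V -> \bar R, measurable_fun setT g -> (forall x, 0 <= g x) ->
    \int[mu]_x g (T x) <= a%:E * \int[mu]_x g x) ->
  \int[mu]_y \int[mu]_x F (T x, T y) <=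
  (a ^+ 2)%:E * \int[mu]_y \int[mu]_x F (x, y).
Proof.
move=> mT a0 Ta.
have mTT : measurable_fun setT (fun z : V * V => (T z.1, T z.2)).
  apply: measurable_fun_pair => /=; apply: (measurableT_comp mT).
    exact: measurable_fst.
  exact: measurable_snd.
have mFT : measurable_fun setT (fun z : V * V => F (T z.1, T z.2)).
  exact: (measurableT_comp mF mTT).
apply: (@le_trans _ _ (\int[mu]_y (a%:E * \int[mu]_x F (x, T y)))).
  apply: ge0_le_integral => //.
  - by move=> y _; exact: integral_ge0.
  - exact: measurable_integral_fst mFT.
  - by apply: measurable_funeM; exact: (measurableT_comp mFi mT).
  - by move=> y _; exact: (Ta _ (mFl (T y)) (fun x => F0 _)).
rewrite ge0_integralZl//; last exact: (measurableT_comp mFi mT).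
rewrite expr2 EFinM -muleA lee_wpmul2l ?lee_fin//.
exact: (Ta _ mFi Fi0).
Qed.

End ge0.

Lemma measurable_box (x : V) (r : R) :
  measurable [set z : V | forall i, (x ord0 i - r <= z ord0 i <= x ord0 i + r)%R].
Proof.
rewrite (_ : [set _ | _] = \bigcap_(i : 'I_n) ((fun z : V => z ord0 i) @^-1` `[(x ord0 i - r)%R, (x ord0 i + r)%R])).
  apply: fin_bigcap_measurable => // i _.
  by rewrite -[X in measurable X]setTI; apply: measurable_coord.
by apply/seteqP; split => [z h i _|z h i]; [have := h i|have := h i I]; rewrite /= in_itv.
Qed.

Lemma box_measure (x : V) (r : R) : (0 <= r)%R ->
  mu [set z | forall i, (x ord0 i - r <= z ord0 i <= x ord0 i + r)%R] =
  ((2 * r) ^+ n)%:E.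
Proof.
move=> r0; have := @lebesgue_measure_rV_box R n (fun i => `[(x ord0 i - r)%R, (x ord0 i + r)%R]%classic).
move=> /(_ (fun i => measurable_itv _)).
rewrite (_ : [set _ | _] = [set z | forall i, (x ord0 i - r <= z ord0 i <= x ord0 i + r)%R]); last first.
  by apply/seteqP; split => z /= h i; have := h i; rewrite in_itv.
move=> ->; rewrite (eq_bigr (fun=> (2 * r)%:E)); last first.
  move=> i _; rewrite lebesgue_measure_itv/= lte_fin.
  case: ifPn => [_|]; first by rewrite -EFinD; congr EFin; ring.
  rewrite -leNgt => h.
  have -> : r = 0%R by lra.
  by rewrite mulr0.
by rewrite prodEFin prodr_const card_ord.
Qed.

(* Average over the cube of half-side r around x: both w x and w (S x) are
   compared with the values of w there. *)
Lemma shift_le_double_integral (F : V * V -> R) (S : V -> V) (w : V -> R) (r rho : R) :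
  measurable_fun setT F -> (forall z, 0 <= F z)%R -> (0 < r)%R -> (0 <= rho)%R ->
  (forall z y, `|z - y| <= 2 * r -> (w z - w y) ^+ 2 <= rho * F (z, y))%R ->
  measurable_fun setT w -> measurable_fun setT S ->
  (forall g : V -> \bar R, measurable_fun setT g -> (forall x, 0 <= g x) ->
    \int[mu]_x g (S x) <= \int[mu]_x g x) ->
  (forall x, w (S x) != w x -> `|S x - x| <= r)%R ->
  ((2 * r) ^+ n)%:E * \int[mu]_x ((w (S x) - w x) ^+ 2)%:E <=
  (4 * rho)%:E * \int[mu]_y \int[mu]_x (F (x, y))%:E.
Proof.
move=> mF F0 r0 rho0 wle mw mS Sle Sr.
pose D y := \int[mu]_z (F (z, y))%:E.
have mFE : measurable_fun setT (EFin \o F) by exact/measurable_EFinP.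
have mq1 y : measurable_fun setT (fun z => (F (z, y))%:E).
  exact: (measurableT_comp mFE (measurable_pair2 y)).
have mD : measurable_fun setT D by exact: measurable_integral_fst mFE.
have D0 y : 0 <= D y by apply: integral_ge0 => z _; rewrite lee_fin.
have key x : ((2 * r) ^+ n)%:E * ((w (S x) - w x) ^+ 2)%:E <=
    (2 * rho)%:E * (D (S x) + D x).
  have [->|nw] := eqVneq (w (S x)) (w x).
    by rewrite subrr expr0n mule0 mule_ge0 ?lee_fin ?mulr_ge0// adde_ge0.
  have Sx := Sr x nw.
  pose Q := [set z : V | forall i, (x ord0 i - r <= z ord0 i <= x ord0 i + r)%R].
  have mQ : measurable Q by exact: measurable_box.
  have Qx z : Q z -> (`|z - x| <= r)%R.
    move=> Qz; apply: norm_le_coord => [|i]; first exact: ltW.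
    by rewrite !mxE ler_distl; exact: Qz.
  rewrite -(box_measure x (ltW r0)) muleC -[X in _ * mu X]/Q -integral_cst//.
  apply: (@le_trans _ _ (\int[mu]_(z in Q) ((2 * rho)%:E *
      ((F (z, S x))%:E + (F (z, x))%:E)))).
    apply: ge0_le_integral => //.
    - by move=> z _; rewrite lee_fin sqr_ge0.
    - apply: measurable_funTS; apply: measurable_funeM; exact: emeasurable_funD.
    - move=> z Qz; rewrite /cst -EFinD -EFinM lee_fin.
      have h1 : ((w z - w x) ^+ 2 <= rho * F (z, x))%R.
        by apply: wle; have := Qx z Qz; lra.
      have h2 : ((w z - w (S x)) ^+ 2 <= rho * F (z, S x))%R.
        apply: wle; have := ler_distD x z (S x); rewrite (distrC x (S x)).
        by have := Qx z Qz; lra.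
      have := sqr_ge0 ((w z - w x) + (w z - w (S x)))%R.
      rewrite (_ : w (S x) - w x = (w z - w x) - (w z - w (S x)))%R; last by ring.
      rewrite !expr2 in h1 h2 *; nra.
  apply: (@le_trans _ _ (\int[mu]_z ((2 * rho)%:E *
      ((F (z, S x))%:E + (F (z, x))%:E)))).
    apply: ge0_subset_integral => //.
    - by apply: measurable_funeM; exact: emeasurable_funD.
    - by move=> z _; rewrite mule_ge0 ?adde_ge0 ?lee_fin  ?mulr_ge0.
  rewrite ge0_integralZl//; last 3 first.
  - exact: emeasurable_funD.
  - by move=> z _; rewrite adde_ge0 ?lee_fin .
  - by rewrite lee_fin mulr_ge0.
  by rewrite ge0_integralD// => z _; rewrite lee_fin.
have mwS : measurable_fun setT (fun x => ((w (S x) - w x) ^+ 2)%:E : \bar R).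
  apply/measurable_EFinP; apply: measurable_funX; apply: measurable_funB => //.
  exact: measurableT_comp.
rewrite -ge0_integralZl//; last 2 first.
- by move=> x _; rewrite lee_fin sqr_ge0.
- by rewrite lee_fin exprn_ge0// mulr_ge0// ltW.
apply: (@le_trans _ _ (\int[mu]_x ((2 * rho)%:E * (D (S x) + D x)))).
  apply: ge0_le_integral => //.
  - by move=> x _; rewrite mule_ge0// lee_fin ?sqr_ge0// exprn_ge0// mulr_ge0// ltW.
  - exact: measurable_funeM.
  - apply: measurable_funeM; apply: emeasurable_funD => //.
    exact: (measurableT_comp mD mS).
rewrite ge0_integralZl//; last 3 first.
- by apply: emeasurable_funD => //; exact: (measurableT_comp mD mS).
- by move=> x _; rewrite adde_ge0.
- by rewrite lee_fin mulr_ge0.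
rewrite ge0_integralD//; last exact: (measurableT_comp mD mS).
rewrite (_ : (4 * _)%:E = (2 * rho)%:E * 2%:E); last by rewrite -EFinM; congr EFin; rewrite -/rho; ring.
rewrite -muleA lee_wpmul2l// ?lee_fin ?mulr_ge0//.
rewrite mule_natl mule2n leeD//; exact: Sle.
Qed.

End double_integral.

Section gagliardo.
Context {R : realType} {n : nat}.
Local Notation V := 'rV[R]_n.
Local Notation mu := (@lebesgue_measure_rV R n).
Variable q : R.
Implicit Types u v w : V -> R.

(** The integrand of [energy] for [q = N + 2 s]. On the diagonal the numerator vanishes, so the
    value there is 0 whatever the quotient convention. *)
Definition quad u v (z : V * V) : R :=
  (u z.1 - u z.2) * (v z.1 - v z.2) / enorm (z.1 - z.2) `^ q.

Definition gag u v : \bar R := (\int[mu]_y \int[mu]_x (quad u v (x, y))%:E)%E.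

Lemma quad_ge0 u z : 0 <= quad u u z.
Proof. by rewrite mulr_ge0 ?invr_ge0 ?powR_ge0// -expr2 sqr_ge0. Qed.

Lemma measurable_quad u v : measurable_fun setT u -> measurable_fun setT v ->
  measurable_fun setT (quad u v).
Proof.
move=> mu1 mv1.
have m1 f : measurable_fun setT f -> measurable_fun setT (fun z : V * V => f z.1 : R).
  by move=> mf; exact: (measurableT_comp mf measurable_fst).
have m2 f : measurable_fun setT f -> measurable_fun setT (fun z : V * V => f z.2 : R).
  by move=> mf; exact: (measurableT_comp mf measurable_snd).
apply: measurable_funM.
  by apply: measurable_funM; apply: measurable_funB; [exact: m1|exact: m2|exact: m1|exact: m2].
rewrite (_ : (fun z : V * V => _) = (fun z : V * V =>
  ((\sum_i (z.1 ord0 i - z.2 ord0 i) ^+ 2) `^ 2^-1) `^ (- q))); last first.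
  apply/funext => z; rewrite powRN /enorm powR12_sqrt; last by apply: sumr_ge0 => i _; exact: sqr_ge0.
  by congr ((Num.sqrt _ `^ _)^-1); apply: eq_bigr => i _; rewrite !mxE expr2.
apply: (measurableT_comp (measurable_powR _)).
apply: (measurableT_comp (measurable_powR _)).
apply: measurable_sum => i; apply: measurable_funX; apply: measurable_funB.
  exact: (m1 (fun x : V => x ord0 i) (measurable_coord i)).
exact: (m2 (fun x : V => x ord0 i) (measurable_coord i)).
Qed.

Local Open Scope ereal_scope.

Lemma gag_ge0 u : 0 <= gag u u.
Proof. by apply: integral_ge0 => y _; apply: integral_ge0 => x _; rewrite lee_fin quad_ge0. Qed.

Lemma gag_ae u u' v : measurable_fun setT u -> measurable_fun setT u' ->
  measurable_fun setT v -> {ae mu, forall x, u x = u' x} -> gag u v = gag u' v.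
Proof.
move=> mu1 mu1' mv uu'.
have mq w : measurable_fun setT w -> measurable_fun setT (EFin \o quad w v).
  by move=> mw; apply/measurable_EFinP; exact: measurable_quad.
apply: ae_eq_integral => //; [exact: measurable_integral_fst (mq _ mu1)|
  exact: measurable_integral_fst (mq _ mu1')|].
apply: (ae_imp _ uu') => y uy _.
apply: ae_eq_integral => //.
- exact: (measurableT_comp (mq _ mu1) (measurable_pair2 y)).
- exact: (measurableT_comp (mq _ mu1') (measurable_pair2 y)).
- by apply: (ae_imp _ uu') => x ux _; rewrite /quad/= ux uy.
Qed.

Lemma gag_integral u v : measurable_fun setT u -> measurable_fun setT v ->
  (mu \x mu).-integrable setT (EFin \o quad u v) ->
  gag u v = \int[mu \x mu]_z (quad u v z)%:E.
Proof. by move=> mu1 mv1 int; rewrite -(integral21_prod_meas1 int). Qed.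

Lemma gag_integrable u : measurable_fun setT u -> gag u u < +oo ->
  (mu \x mu).-integrable setT (EFin \o quad u u).
Proof.
move=> mu1 goo; apply/integrable21ltyP.
  by apply/measurable_EFinP; exact: measurable_quad.
apply: le_lt_trans goo; rewrite le_eqVlt; apply/orP; left; apply/eqP.
by apply: eq_integral => y _; apply: eq_integral => x _; rewrite /= ger0_norm// quad_ge0.
Qed.

(** Iterated integrals of signed functions are not additive in general. The bound of [quad u v] by
    [quad u u + quad v v] gives integrability on the product, where the square is expanded under one
    integral. *)
Lemma gag_polar u v : measurable_fun setT u -> measurable_fun setT v ->
  gag u u < +oo -> gag v v < +oo ->
  gag u v \is a fin_num /\
  gag (u \- v)%R (u \- v)%R = gag u u + gag v v - 2%:E * gag u v.
Proof.
move=> mu1 mv1 uoo voo.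
have iu := gag_integrable mu1 uoo; have iv := gag_integrable mv1 voo.
have muv : measurable_fun setT (EFin \o quad u v).
  by apply/measurable_EFinP; exact: measurable_quad.
have iuv : (mu \x mu).-integrable setT (EFin \o quad u v).
  apply: (le_integrable _ muv _ (integrableD measurableT iu iv)) => // z _.
  change (`|quad u v z|%:E <= `|quad u u z + quad v v z|%:E).
  rewrite lee_fin [leRHS]ger0_norm ?addr_ge0 ?quad_ge0//.
  rewrite /quad normrM (ger0_norm (x := (_ `^ _)^-1)) ?invr_ge0 ?powR_ge0//.
  rewrite -mulrDl ler_wpM2r ?invr_ge0 ?powR_ge0// ler_norml.
  set a := (u _ - u _)%R; set b := (v _ - v _)%R.
  have := sqr_ge0 (a + b)%R; have := sqr_ge0 (a - b)%R; have := sqr_ge0 a; have := sqr_ge0 b.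
  by rewrite !expr2 => *; apply/andP; split; lra.
have md : measurable_fun setT (u \- v)%R by exact: measurable_funB.
have E : EFin \o quad (u \- v)%R (u \- v)%R =
    ((EFin \o quad u u) \+ (EFin \o quad v v)) \- (fun z => 2%:E * (quad u v z)%:E).
  apply/funext => z.
  transitivity ((quad u u z + quad v v z - 2 * quad u v z)%:E)%R; last by [].
  by rewrite /comp; congr EFin; rewrite /quad /=; ring.
have i2 : (mu \x mu).-integrable setT (fun z => 2%:E * (quad u v z)%:E).
  exact: integrableZl.
have iD := integrableD measurableT iu iv.
have id : (mu \x mu).-integrable setT (EFin \o quad (u \- v)%R (u \- v)%R).
  by rewrite E; exact: integrableB.
rewrite (gag_integral md md id) (gag_integral mu1 mu1 iu) (gag_integral mv1 mv1 iv)
  (gag_integral mu1 mv1 iuv).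
split; first exact: integrable_fin_num.
rewrite -integralZl// -integralD// -integralB//.
by apply: eq_integral => z _; have := congr1 (fun f => f z) E.
Qed.

(** Since [T] expands distances at most by [b], the kernel at [(x, y)] is at most [b] to the power
    [q] times the kernel at [(T x, T y)]; the two changes of variables cost [a] each. *)
Lemma gag_comp_le (T : V -> V) (a b : R) u : measurable_fun setT u ->
  measurable_fun setT T -> (0 <= a)%R -> (0 <= b)%R -> (0 <= q)%R ->
  (forall x y, enorm (T x - T y) <= b * enorm (x - y))%R ->
  (forall g : V -> \bar R, measurable_fun setT g -> (forall x, 0 <= g x) ->
    \int[mu]_x g (T x) <= a%:E * \int[mu]_x g x) ->
  gag (u \o T) (u \o T) <= (b `^ q * a ^+ 2)%:E * gag u u.
Proof.
move=> mu1 mT a0 b0 q0 Tb Ta.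
have bq0 : (0 <= b `^ q)%R by rewrite powR_ge0.
have mq : measurable_fun setT (EFin \o quad u u).
  by apply/measurable_EFinP; exact: measurable_quad.
have muT : measurable_fun setT (u \o T) by exact: measurableT_comp.
have mqT : measurable_fun setT (EFin \o quad (u \o T) (u \o T)).
  by apply/measurable_EFinP; exact: measurable_quad.
have qT x y : (quad (u \o T) (u \o T) (x, y) <= b `^ q * quad u u (T x, T y))%R.
  rewrite /quad/= [leRHS]mulrCA.
  have [->|Txy] := eqVneq (T x) (T y); first by rewrite !subrr !mul0r.
  rewrite ler_wpM2l//; first by rewrite -expr2 sqr_ge0.
  have TT0 : (0 < enorm (T x - T y))%R.
    by rewrite (lt_le_trans _ (norm_le_enorm _))// normr_gt0 subr_eq0.
  have bE0 : (0 < b * enorm (x - y))%R by exact: lt_le_trans (Tb x y).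
  have E0 : (0 < enorm (x - y))%R.
    rewrite lt_neqAle enorm_ge0 andbT; apply/eqP => e0.
    by move: bE0; rewrite -e0 mulr0 ltxx.
  have := ge0_ler_powR q0 _ _ (Tb x y).
  rewrite !nnegrE enorm_ge0 (ltW bE0) => /(_ isT isT).
  rewrite powRM ?enorm_ge0// => h.
  by rewrite ler_pdivlMr ?powR_gt0// mulrC ler_pdivrMr ?powR_gt0.
have mTT : measurable_fun setT (fun z : V * V => (T z.1, T z.2)).
  apply: measurable_fun_pair => /=; apply: (measurableT_comp mT).
    exact: measurable_fst.
  exact: measurable_snd.
have mqTT := measurableT_comp mq mTT.
have q0E z : 0 <= (quad u u z)%:E by rewrite lee_fin quad_ge0.
apply: (@le_trans _ _ ((b `^ q)%:E * \int[mu]_y \int[mu]_x (quad u u (T x, T y))%:E)).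
  have mZ : measurable_fun setT (fun z : V * V => (b `^ q)%:E * (quad u u (T z.1, T z.2))%:E).
    exact: (measurable_funeM _ mqTT).
  rewrite -(@double_integralZl _ _ (fun z => (quad u u (T z.1, T z.2))%:E) mqTT (fun z => q0E _) _ bq0).
  apply: (double_integral_le mqT _ mZ) => -[x y].
    by rewrite lee_fin quad_ge0.
  by rewrite -EFinM lee_fin; exact: qT.
rewrite EFinM -muleA lee_wpmul2l ?lee_fin//.
exact: (double_integral_comp_le mq q0E mT a0 Ta).
Qed.

(** A fractional translation estimate at scale [r]: within distance [2 * r] the kernel is bounded
    below. For [q = n + 2 s] the two powers of [r] leave a factor of order r^(2s), which is small
    with [r]. *)
Lemma gag_shift_le (S : V -> V) w (r : R) : (0 < r)%R -> (0 <= q)%R ->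
  measurable_fun setT w -> measurable_fun setT S ->
  (forall g : V -> \bar R, measurable_fun setT g -> (forall x, 0 <= g x) ->
    \int[mu]_x g (S x) <= \int[mu]_x g x) ->
  (forall x, w (S x) != w x -> `|S x - x| <= r)%R ->
  ((2 * r) ^+ n)%:E * \int[mu]_x ((w (S x) - w x) ^+ 2)%:E <=
  (4 * (n%:R * (2 * r)) `^ q)%:E * gag w w.
Proof.
move=> r0 q0 mw mS Sle Sr.
apply: (shift_le_double_integral (measurable_quad mw mw) (quad_ge0 w) r0 (powR_ge0 _ _)) => //.
move=> z y zy; have [->|nzy] := eqVneq z y.
  by rewrite subrr expr0n mulr_ge0 ?powR_ge0// quad_ge0.
have E0 : (0 < enorm (z - y))%R.
  by rewrite (lt_le_trans _ (norm_le_enorm _))// normr_gt0 subr_eq0.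
rewrite /quad/= mulrCA -expr2 ler_peMr ?sqr_ge0// ler_pdivlMr ?powR_gt0// mul1r.
apply: ge0_ler_powR => //; rewrite ?nnegrE ?enorm_ge0 ?mulr_ge0// ?(ltW r0)//.
by rewrite (le_trans (enorm_le _))// ler_wpM2l.
Qed.

End gagliardo.

(** * Elementary inequalities *)

Section power_inequalities.
Context {R : realType}.

(* Young's inequality in the form of the tangent line to the r-th power at b. *)
Lemma powR_tangent (a b r : R) : 1 < r -> 0 <= a -> 0 <= b ->
  r * (a * b `^ (r - 1)) <= a `^ r + (r - 1) * b `^ r.
Proof.
move=> r1 a0 b0; have r0 : 0 < r by lra.
have r10 : 0 < r - 1 by lra.
have := @conjugate_powR R a (b `^ (r - 1)) r (r / (r - 1)) a0 (powR_ge0 _ _) r0.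
move=> /(_ (divr_gt0 r0 r10)); rewrite -powRrM.
have -> : (r - 1) * (r / (r - 1)) = r by field; rewrite gt_eqF.
have e2 : r^-1 + (r / (r - 1))^-1 = 1 by field; rewrite !gt_eqF.
move=> /(_ e2); rewrite -(ler_pM2l r0) => /le_trans; apply.
rewrite le_eqVlt; apply/orP; left; apply/eqP.
by field; rewrite !gt_eqF.
Qed.

(** Convexity of |t|^p / p alone gives the reverse inequality with the tangent at [a]. Here the
    tangent at [b] is used, and moving its slope to [a] costs a quadratic term because for [p > 2]
    the derivative is Lipschitz on bounded sets. *)
Lemma powR_descent (M p : R) : 2 < p -> 0 <= M ->
  exists2 C : R, 0 <= C & forall a b, `|a| <= M -> `|b| <= M ->
    `|a| `^ (p - 2) * a * (a - b) <= `|a| `^ p / p - `|b| `^ p / p + C * (a - b) ^+ 2.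
Proof.
move=> p2 M0; have p0 : 0 < p by lra.
pose K := M `^ (p - 2); have K0 : 0 <= K by rewrite powR_ge0.
have split1 a : 0 <= a -> a `^ (p - 2) * a = a `^ (p - 1).
  move=> a0; rewrite (_ : p - 2 = (p - 1) - 1); last by ring.
  by rewrite mulrC mulr_powRB1// subr_gt0; lra.
have splitp a : 0 <= a -> a `^ (p - 1) * a = a `^ p.
  by move=> a0; rewrite mulrC mulr_powRB1.
have leK a : 0 <= a -> a <= M -> a `^ (p - 2) <= K.
  by move=> a0 aM; apply: ge0_ler_powR; rewrite ?nnegrE//; lra.
have same a b : 0 <= a -> 0 <= b -> a <= M -> b <= M ->
    a `^ (p - 1) * (a - b) <= a `^ p / p - b `^ p / p + (p - 1) * K * (a - b) ^+ 2.
  move=> a0 b0 aM bM.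
  have t1 : b `^ p / p - a `^ p / p <= b `^ (p - 1) * (b - a).
    have := @powR_tangent a b p _ a0 b0; have p1 : 1 < p by lra.
    move=> /(_ p1) h; rewrite -mulrBl ler_pdivrMr// mulrBr (splitp _ b0).
    by lra.
  have t2 x y : 0 <= x -> 0 <= y -> y <= M -> x <= y -> y `^ (p - 1) - x `^ (p - 1) <= (p - 1) * K * (y - x).
    move=> x0 y0 yM xy; have p1 : 1 < p - 1 by lra.
    have := powR_tangent p1 x0 y0; rewrite (_ : p - 1 - 1 = p - 2); last by ring.
    move=> h; have := leK _ y0 yM; have := split1 _ y0 => <- h1.
    have : (p - 1) * (y `^ (p - 2) * (y - x)) <= (p - 1) * (K * (y - x)).
      by rewrite ler_wpM2l ?ler_wpM2r ?subr_ge0//; lra.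
    have := split1 _ y0; move: h; set A := y `^ (p - 2); set B := y `^ (p - 1); nra.
  have : (b `^ (p - 1) - a `^ (p - 1)) * (b - a) <= (p - 1) * K * (a - b) ^+ 2.
    have [ab|ba] := leP a b.
      have h := t2 _ _ a0 b0 bM ab; have ba0 : 0 <= b - a by rewrite subr_ge0.
      by have := ler_wpM2r ba0 h; rewrite -[leRHS]mulrA -expr2 -[(b - a) ^+ 2]sqrrN opprB.
    have h := t2 _ _ b0 a0 aM (ltW ba); have ab0 : 0 <= a - b by rewrite subr_ge0 ltW.
    by have := ler_wpM2r ab0 h; rewrite -[leRHS]mulrA -expr2 -[leLHS]mulrNN !opprB.
  lra.
exists (2 * K + (p - 1) * K); first by rewrite addr_ge0// mulr_ge0//; lra.
(* Opposite signs, with [b] standing for minus the second value: both moduli are then at most the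
   distance [a + b], and each term is quadratic by itself. *)
have opp a b : 0 <= a -> 0 <= b -> a <= M -> b <= M ->
    a `^ (p - 1) * (a + b) <= a `^ p / p - b `^ p / p + 2 * K * (a + b) ^+ 2.
  move=> a0 b0 aM bM.
  have h1 : a `^ (p - 1) * (a + b) <= K * (a + b) ^+ 2.
    rewrite -split1// -mulrA expr2 ler_pM ?powR_ge0 ?mulr_ge0 ?addr_ge0// ?leK//.
    by rewrite ler_wpM2r ?addr_ge0// lerDl.
  have h2 : b `^ p / p <= K * (a + b) ^+ 2.
    have h3 : b `^ p <= K * (a + b) ^+ 2.
      rewrite -splitp// -split1// -mulrA ler_pM ?powR_ge0 ?mulr_ge0// ?leK//.
      by rewrite expr2 ler_pM// lerDr.
    rewrite (le_trans _ h3)// ler_pdivrMr// ler_peMr ?powR_ge0//; lra.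
  have h4 : 0 <= a `^ p / p by rewrite divr_ge0 ?powR_ge0// ltW.
  lra.
move=> a b aM bM.
have pK : 0 <= (p - 1) * K * (a - b) ^+ 2 by rewrite mulr_ge0 ?sqr_ge0// mulr_ge0//; lra.
have qK : 0 <= 2 * K * (a - b) ^+ 2 by rewrite mulr_ge0 ?sqr_ge0// mulr_ge0.
rewrite mulrDl; move: aM bM.
have [a0|a0] := leP 0 a; have [b0|b0] := leP 0 b => aM bM.
- rewrite (ger0_norm a0) (ger0_norm b0) in aM bM *; rewrite split1//.
  by have := same _ _ a0 b0 aM bM; lra.
- have b0' : 0 <= - b by lra.
  rewrite (ger0_norm a0) (ltr0_norm b0) in aM bM *; rewrite split1//.
  by have := opp _ _ a0 b0' aM bM; lra.
- have a0' : 0 <= - a by lra.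
  rewrite (ltr0_norm a0) (ger0_norm b0) in aM bM *.
  have := opp _ _ a0' b0 aM bM; rewrite -(split1 _ a0') (_ : (- a + b) ^+ 2 = (a - b) ^+ 2); last by ring.
  by lra.
- have a0' : 0 <= - a by lra.
  have b0' : 0 <= - b by lra.
  rewrite (ltr0_norm a0) (ltr0_norm b0) in aM bM *.
  have := same _ _ a0' b0' aM bM; rewrite -(split1 _ a0') (_ : (- a - - b) ^+ 2 = (a - b) ^+ 2); last by ring.
  by lra.
Qed.

Lemma expR_gap (mu nu : R) : 0 < mu -> nu < mu ->
  exists2 d : R, 0 < d & \forall h \near 0^'+,
    d * h <= 1 - expR (- (h * mu)) - h * nu.
Proof.
move=> mu0 numu.
exists ((mu - nu) / 2); first lra.
have e0 : 0 < (mu - nu) / 2 / mu ^+ 2 by rewrite !divr_gt0 ?exprn_gt0//; lra.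
near=> h; have h0 : 0 < h by near: h; exact: nbhs_right_gt.
have hm : h * mu ^+ 2 <= (mu - nu) / 2.
  by rewrite -ler_pdivlMr ?exprn_gt0//; near: h; exact: nbhs_right_le.
have hmu : 0 < h * mu by rewrite mulr_gt0.
(* With x = h mu, the product of 1 - x + x^2 and 1 + x is 1 + x^3, at least 1, while 1 + x is at
   most exp x. *)
have e2 : expR (- (h * mu)) <= 1 - h * mu + (h * mu) ^+ 2.
  rewrite expRN -[leLHS]mul1r ler_pdivrMr ?expR_gt0//.
  have q0 : 0 <= 1 - h * mu + (h * mu) ^+ 2 by nra.
  apply: (@le_trans _ _ ((1 - h * mu + (h * mu) ^+ 2) * (1 + h * mu))).
    by have : 0 <= (h * mu) ^+ 3 by [rewrite exprn_ge0// ltW]; nra.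
  by rewrite ler_wpM2l// expR_ge1Dx.
have := ler_wpM2l (ltW h0) hm.
by move: e2; rewrite !exprMn !expr2; lra.
Unshelve. all: by end_near. Qed.

End power_inequalities.

(** * Bounded functions supported in the domain *)

Section bounded_support.
Context {R : realType} {n : nat}.
Local Notation V := 'rV[R]_n.
Local Notation mu := (@lebesgue_measure_rV R n).
Variable Omega : set V.
Hypotheses (mO : measurable Omega) (Ofin : (mu Omega < +oo)%E).
Implicit Types (f g u w : V -> R) (T : V -> V).

(** Vanishing is required everywhere outside [Omega], not just almost everywhere, so that
    composition with a map preserving the exterior stays in the class pointwise. On a set of finite
    measure all integrals are then real numbers. *)
Definition bsupp g := [/\ measurable_fun setT g,
  exists M, forall x, `|g x| <= M & forall x, ~ Omega x -> g x = 0].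

Lemma bsupp_integrable g : bsupp g -> mu.-integrable setT (EFin \o g).
Proof.
move=> [mg [M gM] g0].
have mgO : mu.-integrable Omega (EFin \o g).
  apply: measurable_bounded_integrable => //; first exact: measurable_funTS.
  exists M; split; first exact: num_real.
  by move=> y My x _ /=; rewrite (le_trans (gM x))// ltW.
move: mgO; rewrite (integrable_mkcond _ mO); apply: eq_integrable => // x _.
rewrite patchE; case: ifPn => // /negP xO; rewrite /= g0// => Ox.
by apply: xO; rewrite inE.
Qed.

Lemma bsuppD f g : bsupp f -> bsupp g -> bsupp (fun x => f x + g x).
Proof.
move=> [mf [A fA] f0] [mg [B gB] g0]; split; first exact: measurable_funD.
  by exists (A + B) => x; rewrite (le_trans (ler_normD _ _))// lerD.
by move=> x Ox; rewrite f0// g0// addr0.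
Qed.

Lemma bsuppM f g : bsupp f -> bsupp g -> bsupp (fun x => f x * g x).
Proof.
move=> [mf [A fA] f0] [mg [B gB] g0]; split; first exact: measurable_funM.
  by exists (A * B) => x; rewrite normrM ler_pM.
by move=> x Ox; rewrite f0// mul0r.
Qed.

Lemma bsuppZ c g : bsupp g -> bsupp (fun x => c * g x).
Proof.
move=> [mg [B gB] g0]; split; first exact: measurable_funM.
  by exists (`|c| * B) => x; rewrite normrM ler_wpM2l.
by move=> x Ox; rewrite g0// mulr0.
Qed.

Lemma bsuppB f g : bsupp f -> bsupp g -> bsupp (fun x => f x - g x).
Proof.
move=> bf /(bsuppZ (-1)) /(bsuppD bf); congr bsupp.
by apply/funext => x; rewrite mulN1r.
Qed.

Lemma bsupp0 : bsupp (fun=> 0).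
Proof. by split => //; exists 0 => x; rewrite normr0. Qed.

Lemma bsupp_sum m (g : nat -> V -> R) : (forall k, bsupp (g k)) ->
  bsupp (fun x => \sum_(k < m) g k x).
Proof.
move=> bg; elim: m => [|m IH].
  by have := bsupp0; congr bsupp; apply/funext => x; rewrite big_ord0.
have := bsuppD IH (bg m); congr bsupp.
by apply/funext => x; rewrite big_ord_recr.
Qed.

Lemma bsuppX2 g : bsupp g -> bsupp (fun x => g x ^+ 2).
Proof. by move=> bg; have := bsuppM bg bg. Qed.

Lemma bsupp_comp g T : bsupp g -> measurable_fun setT T ->
  (forall x, ~ Omega x -> ~ Omega (T x)) -> bsupp (g \o T).
Proof.
move=> [mg [B gB] g0] mT TO; split; first exact: measurableT_comp.
  by exists B => x; exact: gB.
by move=> x Ox; apply: g0; exact: TO.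
Qed.

Lemma bsupp_powR p u : 0 < p -> bsupp u -> bsupp (fun x => `|u x| `^ p).
Proof.
move=> p0 [mu1 [A uA] u0]; split.
- apply: (measurableT_comp (measurable_powR _)); exact: measurableT_comp.
- exists (A `^ p) => x; rewrite ger0_norm ?powR_ge0// ge0_ler_powR ?nnegrE ?(ltW p0)//.
  exact: le_trans (uA x).
- by move=> x Ox; rewrite u0// normr0 powR0// gt_eqF.
Qed.

Local Notation I g := (\int[mu]_x g x).

Lemma bsupp_EFin g : bsupp g -> (\int[mu]_x (g x)%:E)%E = (I g)%:E.
Proof. by move=> bg; rewrite fineK//; exact: integrable_fin_num (bsupp_integrable bg). Qed.

Lemma bI_D f g : bsupp f -> bsupp g -> I (fun x => f x + g x) = I f + I g.
Proof. by move=> bf bg; apply: RintegralD => //; exact: bsupp_integrable. Qed.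

Lemma bI_B f g : bsupp f -> bsupp g -> I (fun x => f x - g x) = I f - I g.
Proof. by move=> bf bg; apply: RintegralB => //; exact: bsupp_integrable. Qed.

Lemma bI_Z c g : bsupp g -> I (fun x => c * g x) = c * I g.
Proof. by move=> bg; apply: RintegralZl => //; exact: bsupp_integrable. Qed.

Lemma bI_le f g : bsupp f -> bsupp g -> (forall x, f x <= g x) -> I f <= I g.
Proof. by move=> bf bg fg; apply: le_Rintegral => //; exact: bsupp_integrable. Qed.

Lemma bI_sum m (g : nat -> V -> R) : (forall k, bsupp (g k)) ->
  I (fun x => \sum_(k < m) g k x) = \sum_(k < m) I (g k).
Proof.
move=> bg; elim: m => [|m IH].
  rewrite big_ord0; under eq_Rintegral do rewrite big_ord0.
  by rewrite Rintegral_cst// mul0r.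
rewrite big_ord_recr/= -IH -bI_D//; last exact: bsupp_sum.
by apply: eq_Rintegral => x _; rewrite big_ord_recr.
Qed.

End bounded_support.

(** * Energy descent along an Euler step *)

Lemma sqr_sum_le {R : realType} (a : nat -> R) m :
  (\sum_(k < m) a k) ^+ 2 <= m%:R * \sum_(k < m) a k ^+ 2.
Proof.
elim: m => [|m IH]; first by rewrite !big_ord0 expr0n mul0r.
rewrite !big_ord_recr/= -natr1; move: IH.
set S := \sum_(k < m) a k; set Q := \sum_(k < m) a k ^+ 2; set b := a m => IH.
have [m0|m0] := eqVneq m 0.
  by rewrite /S /Q m0 !big_ord0; lra.
have mp : 0 < m%:R :> R by rewrite ltr0n lt0n.
suff : 2 * S * b <= Q + m%:R * b ^+ 2 by move: IH; rewrite !expr2; nra.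
rewrite -(ler_pM2l mp); have := sqr_ge0 (S - m%:R * b).
by move: IH; rewrite !expr2; nra.
Qed.

Lemma powR_normr_mulr {R : realType} (p x : R) : 0 < p -> `|x| `^ (p - 2) * x * x = `|x| `^ p.
Proof.
move=> p0; rewrite -mulrA -expr2 -real_normK ?num_real// -powR_mulrn// -powRD ?subrK//.
by rewrite gt_eqF.
Qed.

Section descent.
Context {R : realType} {n : nat}.
Local Notation V := 'rV[R]_n.
Local Notation mu := (@lebesgue_measure_rV R n).
Variable Omega : set V.
Hypotheses (mO : measurable Omega) (Ofin : (mu Omega < +oo)%E).
Local Notation I g := (\int[mu]_x g x).
Variables (T : V -> V) (u : V -> R).
Hypotheses (mT : measurable_fun setT T) (TO : forall x, ~ Omega x -> ~ Omega (T x)).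
Hypothesis bu : bsupp Omega u.
Let w x := u x - u (T x).

Let bv : bsupp Omega (u \o T). Proof. exact: bsupp_comp. Qed.
Let bw : bsupp Omega w. Proof. exact: bsuppB. Qed.

Lemma measurable_iter k : measurable_fun setT (iter k T).
Proof. by elim: k => [|k IH]; [exact: measurable_id|exact: measurableT_comp]. Qed.

Lemma iter_exterior k x : ~ Omega x -> ~ Omega (iter k T x).
Proof. by move=> Ox; elim: k => // k; exact: TO. Qed.

Section nonexpansive.
Hypothesis Tle : forall g : V -> \bar R, measurable_fun setT g -> (forall x, 0 <= g x)%E ->
  (\int[mu]_x g (T x) <= \int[mu]_x g x)%E.

Lemma iter_integral_le k (g : V -> \bar R) : measurable_fun setT g ->
  (forall x, 0 <= g x)%E -> (\int[mu]_x g (iter k T x) <= \int[mu]_x g x)%E.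
Proof.
elim: k g => [//|k IH] g mg g0; apply: le_trans (Tle mg g0).
exact: (IH _ (measurableT_comp mg mT) (fun x => g0 _)).
Qed.

(** Telescoping [w] along the orbit gives [u - u o T^m = m w + sum (w o T^k - w)]. Squaring and
    integrating bounds [m^2 |w|_2^2] by [8 |u|_2^2] plus half of itself, the half coming from the
    hypothesis. *)
Lemma displacement_le m :
  (forall k, (k < m)%N -> 4 * I (fun x => (w (iter k T x) - w x) ^+ 2) <= I (fun x => w x ^+ 2)) ->
  m%:R ^+ 2 * I (fun x => w x ^+ 2) <= 16 * I (fun x => u x ^+ 2).
Proof.
move=> H.
have bd k : bsupp Omega (fun x => (w (iter k T x) - w x) ^+ 2).
  apply: bsuppX2; apply: bsuppB => //.
  exact: (bsupp_comp bw (measurable_iter k) (@iter_exterior k)).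
have bum : bsupp Omega (u \o iter m T).
  exact: (bsupp_comp bu (measurable_iter m) (@iter_exterior m)).
have telescope x : u x - u (iter m T x) =
    m%:R * w x + \sum_(k < m) (w (iter k T x) - w x).
  elim: m {H bum} => [|m IH]; first by rewrite big_ord0 mul0r addr0 subrr.
  rewrite big_ord_recr/= -natr1; move: IH; set S := \sum_(k < m) _.
  by rewrite /w; lra.
have pw x : m%:R ^+ 2 * w x ^+ 2 <= (4 * u x ^+ 2 + 4 * u (iter m T x) ^+ 2) +
    (2 * m%:R) * \sum_(k < m) (w (iter k T x) - w x) ^+ 2.
  have := sqr_sum_le (fun k => w (iter k T x) - w x) m.
  have := telescope x; set S := \sum_(k < m) _; set Q := \sum_(k < m) _.
  set a := u x; set b := u _ => e SQ.
  have -> : m%:R ^+ 2 * w x ^+ 2 = (a - b - S) ^+ 2 by rewrite e; ring.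
  have := sqr_ge0 (a + b); have := sqr_ge0 (a - b + S); move: SQ.
  rewrite !expr2; nra.
have b4u : bsupp Omega (fun x => 4 * u x ^+ 2) by apply: bsuppZ; exact: bsuppX2.
have bum2 : bsupp Omega (fun x => u (iter m T x) ^+ 2) by exact: bsuppX2.
have b4um : bsupp Omega (fun x => 4 * u (iter m T x) ^+ 2) by exact: bsuppZ.
have bS := bsupp_sum m bd.
have bmS := bsuppZ (2 * m%:R) bS.
have bw2 := bsuppX2 bw; have bu2 := bsuppX2 bu.
have := bI_le mO Ofin (bsuppZ (m%:R ^+ 2) bw2) (bsuppD (bsuppD b4u b4um) bmS) pw.
rewrite (bI_D mO Ofin (bsuppD b4u b4um) bmS) (bI_D mO Ofin b4u b4um).
rewrite (bI_Z mO Ofin _ bw2) (bI_Z mO Ofin _ bu2) (bI_Z mO Ofin _ bum2) (bI_Z mO Ofin _ bS).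
rewrite (bI_sum mO Ofin m bd).
have : I (fun x => u (iter m T x) ^+ 2) <= I (fun x => u x ^+ 2).
  rewrite -lee_fin -!(bsupp_EFin mO Ofin)//.
  have [m2 _ _] := bu2.
  apply: (@iter_integral_le m (fun x => (u x ^+ 2)%:E)).
    exact/measurable_EFinP.
  by move=> x; rewrite lee_fin sqr_ge0.
have : m%:R * \sum_(k < m) I (fun x => (w (iter k T x) - w x) ^+ 2) <=
    m%:R * (m%:R * (4^-1 * I (fun x => w x ^+ 2))).
  rewrite ler_wpM2l//; apply: le_trans (_ : _ <= \sum_(k < m) (4^-1 * I (fun x => w x ^+ 2))) _.
    by apply: ler_sum => k _; have := H k (ltn_ord k); lra.
  by rewrite sumr_const card_ord -[leLHS]mulr_natl.
by rewrite !expr2; nra.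
Qed.

(** The reverse Poincare bound by [K] turns the translation estimate into smallness of [w o T^k - w]
    relative to [w]. The 16 is the 4 of [gag_shift_le] times the 4 required by [displacement_le]. *)
Lemma displacement_gag_le (q r K : R) m : 0 < r -> 0 <= q ->
  (gag q w w < +oo)%E -> fine (gag q w w) <= K * I (fun x => w x ^+ 2) ->
  (forall k x, (k < m)%N -> Omega x -> `|iter k T x - x| <= r) ->
  16 * (n%:R * (2 * r)) `^ q * K <= (2 * r) ^+ n ->
  m%:R ^+ 2 * I (fun x => w x ^+ 2) <= 16 * I (fun x => u x ^+ 2).
Proof.
move=> r0 q0 goo gK Tr rK; apply: displacement_le => k km.
have r2 : 0 < (2 * r) ^+ n by rewrite exprn_gt0// mulr_gt0.
have [mw _ w0] := bw.
have nw x : w (iter k T x) != w x -> `|iter k T x - x| <= r.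
  move=> nx; apply: Tr => //; apply: contrapT => Ox; move/eqP: nx; apply.
  by rewrite !w0//; exact: iter_exterior.
have bd : bsupp Omega (fun x => (w (iter k T x) - w x) ^+ 2).
  apply: bsuppX2; apply: bsuppB => //.
  exact: (bsupp_comp bw (measurable_iter k) (@iter_exterior k)).
have := gag_shift_le r0 q0 mw (measurable_iter k) (@iter_integral_le k) nw.
have gE : gag q w w = (fine (gag q w w))%:E by rewrite fineK// ge0_fin_numE ?gag_ge0.
rewrite (bsupp_EFin mO Ofin bd) gE -!EFinM lee_fin => h.
have h0 : 0 <= I (fun x => w x ^+ 2) by apply: Rintegral_ge0 => x _; rewrite sqr_ge0.
have c0 : 0 <= (n%:R * (2 * r)) `^ q by rewrite powR_ge0.
rewrite -(ler_pM2l r2) mulrCA; apply: le_trans (ler_wpM2r h0 rK).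
by have := ler_wpM2l c0 gK; lra.
Qed.

End nonexpansive.

(** The energy of [u - u o T] is polarized and that of [u o T] is bounded by scaling: the kernel
    gives [expR (h * gamma * q)], each variable [expR (- (h * alpha))]. *)
Lemma gag_displacement_le (q alpha gamma h : R) : 0 <= q -> (gag q u u < +oo)%E ->
  (forall x y, enorm (T x - T y) <= expR (h * gamma) * enorm (x - y)) ->
  (forall g : V -> \bar R, measurable_fun setT g -> (forall x, 0 <= g x)%E ->
    (expR (h * alpha))%:E * \int[mu]_x g (T x) <= \int[mu]_x g x)%E ->
  exists a b c : R, [/\ gag q u u = a%:E, gag q u (u \o T) = b%:E, gag q w w = c%:E,
    (gag q (u \o T) (u \o T) < +oo)%E &
    c <= (1 + expR (- (h * (2 * alpha - gamma * q)))) * a - 2 * b].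
Proof.
move=> q0 uoo Tb Ta.
have [mu1 _ _] := bu; have [mv _ _] := bv.
have Ta' (g : V -> \bar R) : measurable_fun setT g -> (forall x, 0 <= g x)%E ->
    (\int[mu]_x g (T x) <= (expR (- (h * alpha)))%:E * \int[mu]_x g x)%E.
  move=> mg g0; have /(lee_wpmul2l (x := (expR (- (h * alpha)))%:E)) := Ta g mg g0.
  by rewrite lee_fin expR_ge0 muleA -EFinM -expRD addNr expR0 mul1e; exact.
have vle := gag_comp_le mu1 mT (expR_ge0 _) (expR_ge0 _) q0 Tb Ta'.
have voo : (gag q (u \o T) (u \o T) < +oo)%E.
  by apply: le_lt_trans vle _; rewrite lte_mul_pinfty// lee_fin mulr_ge0 ?powR_ge0 ?sqr_ge0.
have fin (f : V -> R) : (gag q f f < +oo)%E -> exists a, gag q f f = a%:E.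
  by move=> foo; exists (fine (gag q f f)); rewrite fineK// ge0_fin_numE ?gag_ge0.
have [uvfin gw] := gag_polar mu1 mv uoo voo.
have [a ea] := fin u uoo; have [d ed] := fin _ voo.
have [b eb] : exists b, gag q u (u \o T) = b%:E by exists (fine (gag q u (u \o T))); rewrite fineK.
exists a, b, (a + d - 2 * b); split => //; first by have := gw; rewrite ea ed eb.
move: vle; rewrite ea ed -EFinM lee_fin -expRM -expRM_natl -expRD.
rewrite (_ : h * gamma * q + _ = - (h * (2 * alpha - gamma * q))); last by ring.
lra.
Qed.

(** With [v = u o T], testing with [u] and [v] turns the polarized bound into
    [kap * c <= 2 * (P - Q) - (1 - E) * P]. Then [FC] bounds [P - Q] by [(P - Pv) / p + C * W], and
    the volume bound gives [P - Pv <= h * n * gamma * P]. *)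
Lemma energy_descent (q kap p M C alpha gamma h : R) :
  0 < kap -> 0 <= q -> 2 < p ->
  (forall x, `|u x| <= M) ->
  (forall a b, `|a| <= M -> `|b| <= M ->
    `|a| `^ (p - 2) * a * (a - b) <= `|a| `^ p / p - `|b| `^ p / p + C * (a - b) ^+ 2) ->
  (gag q u u < +oo)%E ->
  (forall v, bsupp Omega v -> (gag q v v < +oo)%E ->
    (kap%:E * gag q u v = (I (fun x => `|u x| `^ (p - 2) * u x * v x))%:E)%E) ->
  (forall x y, enorm (T x - T y) <= expR (h * gamma) * enorm (x - y)) ->
  (forall g : V -> \bar R, measurable_fun setT g -> (forall x, 0 <= g x)%E ->
    ((expR (h * alpha))%:E * \int[mu]_x g (T x) <= \int[mu]_x g x /\
    \int[mu]_x g x <= (expR (h * (n%:R * gamma)))%:E * \int[mu]_x g (T x))%E) ->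
  exists2 c : R, gag q w w = c%:E &
  kap * c + (1 - expR (- (h * (2 * alpha - gamma * q)))
    - h * (2 * (n%:R * gamma) / p)) * I (fun x => `|u x| `^ p) <=
  2 * C * I (fun x => w x ^+ 2).
Proof.
move=> k0 q0 p2 uM FC uoo weak Tb Ta; have p0 : 0 < p by lra.
have [a [b [c [ea eb ec voo cle]]]] := gag_displacement_le q0 uoo Tb
  (fun g mg g0 => proj1 (Ta g mg g0)).
exists c => //.
set P := I (fun x => `|u x| `^ p).
have bPu : bsupp Omega (fun x => `|u x| `^ p) by exact: bsupp_powR.
have bPv : bsupp Omega (fun x => `|u (T x)| `^ p) by exact: (bsupp_powR _ bv).
have bfu : bsupp Omega (fun x => `|u x| `^ (p - 2) * u x).
  by apply: bsuppM => //; apply: bsupp_powR => //; rewrite subr_gt0.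
have bfuv := bsuppM bfu bv; have bw2 := bsuppX2 bw.
have e2 : kap * a = P.
  have := weak _ bu uoo; rewrite ea -EFinM => -[->].
  by apply: eq_Rintegral => x _; rewrite powR_normr_mulr.
set Q := I (fun x => `|u x| `^ (p - 2) * u x * (u \o T) x).
have e1 : kap * b = Q by have := weak _ bv voo; rewrite eb -EFinM => -[->].
set W := I (fun x => w x ^+ 2).
set Pv := I (fun x => `|u (T x)| `^ p).
have ineq : P - Q <= p^-1 * P - p^-1 * Pv + C * W.
  rewrite /P /Q /Pv /W -(bI_B mO Ofin bPu bfuv) -(bI_Z mO Ofin _ bPu) -(bI_Z mO Ofin _ bPv)
    -(bI_Z mO Ofin _ bw2) -(bI_B mO Ofin (bsuppZ _ bPu) (bsuppZ _ bPv)).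
  have bB := bsuppB (bsuppZ p^-1 bPu) (bsuppZ p^-1 bPv).
  rewrite -(bI_D mO Ofin bB (bsuppZ _ bw2)).
  apply: (bI_le mO Ofin (bsuppB bPu bfuv) (bsuppD bB (bsuppZ _ bw2))) => x.
  have := FC (u x) (u (T x)) (uM _) (uM _).
  by rewrite /w /= -(powR_normr_mulr (u x) p0); lra.
have PPv : P <= expR (h * (n%:R * gamma)) * Pv.
  rewrite -lee_fin EFinM -(bsupp_EFin mO Ofin bPu) -(bsupp_EFin mO Ofin bPv).
  have [mP _ _] := bPu.
  apply: (proj2 (Ta (fun x => (`|u x| `^ p)%:E) _ _)).
    exact/measurable_EFinP.
  by move=> x; rewrite lee_fin powR_ge0.
have P0 : 0 <= P by apply: Rintegral_ge0 => x _; exact: powR_ge0.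
have Pv0 : (1 - h * (n%:R * gamma)) * P <= Pv.
  have : expR (- (h * (n%:R * gamma))) * P <= Pv.
    by rewrite expRN mulrC ler_pdivrMr ?expR_gt0// mulrC.
  by apply: le_trans; rewrite ler_wpM2r// expR_ge1Dx.
have pi0 : 0 <= p^-1 by rewrite invr_ge0 ltW.
move: P Q W Pv e2 e1 ineq Pv0 {PPv} P0 => P Q W Pv e2 e1 ineq Pv0 P0.
have pv := ler_wpM2l pi0 Pv0.
have := ler_wpM2l (ltW k0) cle; move: (expR _) => E.
rewrite mulrBr [kap * (2 * b)]mulrCA e1 [kap * (_ * a)]mulrCA e2; lra.
Qed.

End descent.

(** * Vanishing of weak solutions *)

(** With [t = 2 * r] the condition reads [A * t^(2s) <= 1]: the surplus [2 * s] of the kernel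
    exponent over the dimension makes it hold for small [t]. *)
Lemma small_radius {R : realType} (n : nat) (B s : R) : 0 <= B -> 0 < s ->
  exists2 r : R, 0 < r & B * (n%:R * (2 * r)) `^ (n%:R + 2 * s) <= (2 * r) ^+ n.
Proof.
move=> B0 s0; pose A := B * n%:R `^ (n%:R + 2 * s).
have A0 : 0 <= A by rewrite mulr_ge0 ?powR_ge0.
have A1 : 0 < A + 1 by rewrite ltr_wpDl.
pose t := (A + 1)^-1 `^ (2 * s)^-1.
have t0 : 0 < t by rewrite powR_gt0// invr_gt0.
exists (t / 2); first by rewrite divr_gt0.
have -> : 2 * (t / 2) = t by field.
rewrite powRM ?(ltW t0)// mulrA -/A powRD; last by rewrite (gt_eqF t0) implybT.
rewrite powR_mulrn ?(ltW t0)// mulrCA ler_piMr ?exprn_ge0 ?(ltW t0)//.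
rewrite -powRrM mulVf ?gt_eqF ?mulr_gt0// powRr1 ?invr_ge0 ?(ltW A1)//.
by rewrite ler_pdivrMr// mul1r lerDl.
Qed.

Section vanishing.
Context {R : realType} {n : nat}.
Local Notation V := 'rV[R]_n.
Local Notation mu := (@lebesgue_measure_rV R n).
Variable Omega : set V.
Hypotheses (mO : measurable Omega) (Ofin : (mu Omega < +oo)%E).
Local Notation I g := (\int[mu]_x g x).

(** Without its term in [P], the descent inequality is a reverse Poincare inequality for the
    displacement, whence [m^2 W(h) <= 16 U] while [m h <= tau]. For [h = tau / m] the full
    inequality yields [m d tau P <= 32 C U] for all large [m], which forces [P = 0]. *)
Lemma weak_solution_vanishes (s kap p alpha gamma C0 : R) (Y : V -> V) (u : V -> R) :
  0 < s -> 0 < kap -> 2 < p -> 0 <= alpha ->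
  0 < 2 * alpha - gamma * (n%:R + 2 * s) ->
  2 * (n%:R * gamma) / p < 2 * alpha - gamma * (n%:R + 2 * s) ->
  bsupp Omega u -> (gag (n%:R + 2 * s) u u < +oo)%E ->
  (forall v, bsupp Omega v -> (gag (n%:R + 2 * s) v v < +oo)%E ->
    (kap%:E * gag (n%:R + 2 * s) u v = (I (fun x => `|u x| `^ (p - 2) * u x * v x))%:E)%E) ->
  0 <= C0 ->
  (\forall h \near 0^'+, let T := fun x => x + h *: Y x in
    [/\ measurable_fun setT T,
      forall x, ~ Omega x -> ~ Omega (T x),
      forall x y, enorm (T x - T y) <= expR (h * gamma) * enorm (x - y),
      forall g : V -> \bar R, measurable_fun setT g -> (forall x, 0 <= g x)%E ->
        ((expR (h * alpha))%:E * \int[mu]_x g (T x) <= \int[mu]_x g x /\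
        \int[mu]_x g x <= (expR (h * (n%:R * gamma)))%:E * \int[mu]_x g (T x))%E &
      forall k x, k%:R * h <= 1 -> Omega x -> `|iter k T x - x| <= C0 * (k%:R * h)]) ->
  I (fun x => `|u x| `^ p) = 0.
Proof.
move=> s0 k0 p2 alpha0 mu0 numu bu uoo weak C00 Tnear.
set q := n%:R + 2 * s in mu0 numu uoo weak *.
have q0 : 0 <= q by rewrite addr_ge0// mulr_ge0// ltW.
have [M M0 uM] : exists2 M, 0 <= M & forall x, `|u x| <= M.
  by case: bu => _ [M uM] _; exists M => //; exact: le_trans (uM 0).
have [C C1 FC] := powR_descent p2 M0.
have [d d0 dgap] := expR_gap mu0 numu.
set P := I (fun x => `|u x| `^ p).
have P0 : 0 <= P by apply: Rintegral_ge0 => x _; exact: powR_ge0.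
set U := I (fun x => u x ^+ 2).
have U0 : 0 <= U by apply: Rintegral_ge0 => x _; exact: sqr_ge0.
pose K := 2 * C / kap.
have K0 : 0 <= K by rewrite divr_ge0 ?mulr_ge0// ltW.
have [r r0 rK] := small_radius n (mulr_ge0 (ler0n R 16) K0) s0.
(* Up to time [tau] the drift bound applies and keeps the orbits of points of [Omega] within
   distance [r] of their start. *)
pose tau := Num.min 1 (r / (C0 + 1)).
have C01 : 0 < C0 + 1 by rewrite ltr_wpDl.
have tau0 : 0 < tau by rewrite lt_min ltr01 divr_gt0.
have tau1 : tau <= 1 by rewrite ge_min lexx.
have taur : C0 * tau <= r.
  apply: (@le_trans _ _ ((C0 + 1) * tau)); first by rewrite ler_wpM2r ?(ltW tau0)// lerDl.
  by rewrite mulrC -ler_pdivlMr// ge_min lexx orbT.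
pose W h := I (fun x => (u x - u (x + h *: Y x)) ^+ 2).
have [e e0 He] : exists2 e : R, 0 < e & forall h, 0 < h -> h < e ->
    d * h * P <= 2 * C * W h /\
    forall m, m%:R * h <= tau ->
      m%:R ^+ 2 * W h <= 16 * U.
  have : \forall h \near 0^'+,
      d * h * P <= 2 * C * W h /\
      forall m, m%:R * h <= tau ->
        m%:R ^+ 2 * W h <= 16 * U.
    near=> h; have h0 : 0 < h by near: h; exact: nbhs_right_gt.
    have [mT TO Tb Ta Tk] : let T := fun x => x + h *: Y x in
        [/\ measurable_fun setT T,
      forall x, ~ Omega x -> ~ Omega (T x),
      forall x y, enorm (T x - T y) <= expR (h * gamma) * enorm (x - y),
      forall g : V -> \bar R, measurable_fun setT g -> (forall x, 0 <= g x)%E ->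
        ((expR (h * alpha))%:E * \int[mu]_x g (T x) <= \int[mu]_x g x /\
        \int[mu]_x g x <= (expR (h * (n%:R * gamma)))%:E * \int[mu]_x g (T x))%E &
      forall k x, k%:R * h <= 1 -> Omega x -> `|iter k T x - x| <= C0 * (k%:R * h)].
      by near: h; exact: Tnear.
    have gap : d * h <= 1 - expR (- (h * (2 * alpha - gamma * q))) -
        h * (2 * (n%:R * gamma) / p) by near: h; exact: dgap.
    have [c ec cle] := energy_descent mO Ofin mT TO bu k0 q0 p2 uM FC uoo weak Tb Ta.
    have {}cle : kap * c + (1 - expR (- (h * (2 * alpha - gamma * q))) -
      h * (2 * (n%:R * gamma) / p)) * P <= 2 * C * W h := cle.
    have c0 : 0 <= c by rewrite -lee_fin -ec gag_ge0.
    have gapP := ler_wpM2r P0 gap.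
    have kc : 0 <= kap * c by rewrite mulr_ge0// ltW.
    have hP : 0 <= d * h * P by rewrite !mulr_ge0// ltW.
    split; first by lra.
    move=> m mh.
    have Tle (g : V -> \bar R) : measurable_fun setT g -> (forall x, 0 <= g x)%E ->
        (\int[mu]_x g (x + h *: Y x)%R <= \int[mu]_x g x)%E.
      move=> mg g0; apply: le_trans (proj1 (Ta g mg g0)).
      rewrite -[leLHS]mul1e lee_wpmul2r ?integral_ge0// lee_fin -expR0 ler_expR.
      by rewrite mulr_ge0// ltW.
    apply: (displacement_gag_le mO Ofin mT TO bu Tle r0 q0 (K := K) (m := m)) => //.
    - by rewrite ec ltry.
    - rewrite ec /= /K mulrAC ler_pdivlMr// mulrC.
      by change (is_true (kap * c <= 2 * C * W h)); lra.
    - move=> k x km Ox.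
      have kmh : k%:R * h <= m%:R * h by rewrite ler_wpM2r ?(ltW h0)// ler_nat ltnW.
      have kt : k%:R * h <= tau by exact: le_trans mh.
      apply: (le_trans (Tk k x (le_trans kt tau1) Ox)).
      by apply: le_trans taur; rewrite ler_wpM2l.
    - by rewrite mulrAC.
  move=> [e /= e0 He]; exists e => // h h0 he.
  by apply: He => //=; rewrite sub0r normrN gtr0_norm.
apply/eqP; rewrite eq_le P0 andbT leNgt; apply/negP => P1.
(* For [m] above the first summand the final inequality fails; above the second, [tau / m] lies in
   the admissible range of steps. *)
pose A := 32 * C * U / (d * tau * P) + tau / e.
have dP : 0 < d * tau * P by rewrite !mulr_gt0.
have A1 : 0 <= 32 * C * U / (d * tau * P) by rewrite divr_ge0 ?mulr_ge0// ltW.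
have A2 : 0 < tau / e by rewrite divr_gt0.
have A0 : 0 <= A by rewrite addr_ge0// ltW.
have mA := archi_boundP A0; set m := Num.bound A in mA.
have m0 : 0 < m%:R :> R by exact: le_lt_trans mA.
have [] := He (tau / m%:R).
- by rewrite divr_gt0.
- rewrite ltr_pdivrMr// mulrC -ltr_pdivrMr//; apply: le_lt_trans mA.
  by rewrite lerDr.
move=> h1 /(_ m); rewrite mulrCA divff ?gt_eqF// mulr1 lexx => /(_ isT) h2.
have h3 : 32 * C * U < m%:R * (d * tau * P).
  by rewrite -ltr_pdivrMr//; apply: le_lt_trans mA; rewrite lerDl ltW.
have h4 : m%:R * (d * tau * P) = m%:R ^+ 2 * (d * (tau / m%:R) * P).
  by field; rewrite gt_eqF.
have h5 : m%:R ^+ 2 * (d * (tau / m%:R) * P) <= m%:R ^+ 2 * (2 * C * W (tau / m%:R)).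
  by rewrite ler_wpM2l// sqr_ge0.
have h6 : 2 * C * (m%:R ^+ 2 * W (tau / m%:R)) <= 2 * C * (16 * U) by rewrite ler_wpM2l// mulr_ge0.
move: h3 h4 h5 h6; set x1 := m%:R * _; set x2 := m%:R ^+ 2 * (d * _ * P); set m2 := m%:R ^+ 2; lra.
Unshelve. all: by end_near. Qed.

End vanishing.

(** * Bounded representatives and the weak equation *)

Section weak_formulation.
Context {R : realType} {n : nat}.
Local Notation V := 'rV[R]_n.
Local Notation mu := (@lebesgue_measure_rV R n).
Variable Omega : set V.
Hypothesis mO : measurable Omega.

Lemma bounded_set_measure_lty : bounded_set Omega -> (mu Omega < +oo)%E.
Proof.
move=> /bounded_norm_le[M M0 OM].
apply: (@le_lt_trans _ _ (((2 * M) ^+ n)%:E)); last exact: ltry.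
rewrite -(box_measure 0 M0); apply: le_measure; rewrite ?inE//.
  exact: (measurable_box (0 : V) M).
move=> x Ox i; rewrite mxE sub0r add0r -ler_norml.
by rewrite (le_trans (coord_le_norm x i))// OM.
Qed.

Lemma bounded_representative (u : V -> R) : measurable_fun setT u ->
  {ae mu, forall x, (~` Omega) x -> u x = 0} -> finite_norm mu +oo (u \_ Omega) ->
  exists2 u', bsupp Omega u' & {ae mu, forall x, u x = u' x}.
Proof.
move=> mu1 u0 uoo.
have [M M0 uM] : exists2 M : R, 0 <= M & {ae mu, forall x, `|(u \_ Omega) x| <= M}.
  move: uoo; rewrite /finite_norm unlock; case: ifPn => [muT|].
    move=> uoo; exists (Num.max 0 (fine (ess_sup_inf.ess_sup mu (abse \o (EFin \o u \_ Omega))))).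
      by rewrite le_max lexx.
    apply: (ae_imp _ (ess_sup_inf.ess_sup_ge mu (abse \o (EFin \o u \_ Omega)))) => x /= ux.
    rewrite -lee_fin EFin_max le_max; apply/orP; right.
    rewrite fineK// fin_numElt uoo andbT (lt_le_trans _ ux)// ltNyr.
    by [].
  (* The essential supremum norm is 0 by convention when the whole space is null; every property
     then holds almost everywhere. *)
  rewrite -leNgt => muT _; exists 0 => //; exists setT; split => //.
  by apply/eqP; rewrite eq_le muT measure_ge0.
exists (u \_ (Omega `&` [set x | `|u x| <= M])).
  have mA : measurable (Omega `&` [set x | `|u x| <= M]).
    apply: measurableI => //; rewrite -[X in measurable X]setTI.
    have := @measurable_fun_le _ _ R setT (fun x => `|u x|) (cst M).
    rewrite setTI; apply => //; exact: measurableT_comp.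
  split; first by apply/(measurable_restrictT _ mA); exact: measurable_funTS.
    exists M => x; rewrite patchE; case: ifPn => [|_]; last by rewrite normr0.
    by rewrite inE => -[].
  by move=> x Ox; rewrite patchE; case: ifPn => //; rewrite inE => -[].
apply: (ae_imp2 _ u0 uM) => x ux; rewrite !patchE.
case: ifPn => [|/negP]; rewrite inE => Ox h.
  by rewrite mem_set.
by rewrite ux//; case: ifPn => //; rewrite inE => -[].
Qed.

Hypothesis Ofin : (mu Omega < +oo)%E.

Lemma bsupp_Lfun2 (v : V -> R) : bsupp Omega v -> v \in Lfun mu 2%:E.
Proof.
move=> bv; have [mv _ _] := bv.
rewrite inE; apply/andP; split; first by rewrite inE.
rewrite inE /= /finite_norm unlock; apply: poweR_lty.
rewrite (_ : (\int[mu]_x _)%E = (\int[mu]_x (`|v x| `^ 2)%:E)%E).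
  by rewrite (bsupp_EFin mO Ofin) ?ltry//; apply: bsupp_powR.
by apply: eq_integral => x _; exact: (poweR_EFin `|v x| 2).
Qed.

Lemma Rintegral_powR_eq0 (p : R) (u : V -> R) : 0 < p -> bsupp Omega u ->
  \int[mu]_x (`|u x| `^ p) = 0 -> {ae mu, forall x, u x = 0}.
Proof.
move=> p0 bu I0; have bp := bsupp_powR p0 bu; have [mp _ _] := bp.
have mpE : measurable_fun setT (fun x => (`|u x| `^ p)%:E) by exact/measurable_EFinP.
have /(ae_eq_integral_abs mu measurableT mpE) :
    (\int[mu]_x `|(`|u x| `^ p)%:E|)%E = 0%E.
  transitivity (\int[mu]_x (`|u x| `^ p)%:E)%E.
    by apply: eq_integral => x _; rewrite gee0_abs// lee_fin powR_ge0.
  by rewrite (bsupp_EFin mO Ofin bp) I0.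
apply: ae_imp => x /(_ I) [] /eqP; rewrite powR_eq0 normr_eq0 => /andP[/eqP].
by [].
Qed.

Lemma gagC (q : R) (u v : V -> R) : gag q u v = gag q v u.
Proof.
apply: eq_integral => y _; apply: eq_integral => x _.
by rewrite /quad [(u _ - _) * _]mulrC.
Qed.

Lemma integral_weak_ae (p : R) (u u' v : V -> R) : 2 < p ->
  measurable_fun setT u -> bsupp Omega u' -> bsupp Omega v ->
  {ae mu, forall x, u x = u' x} ->
  (\int[mu]_(x in Omega) (`|u x| `^ (p - 2) * u x * v x)%:E =
   (\int[mu]_x (`|u' x| `^ (p - 2) * u' x * v x)%R)%:E)%E.
Proof.
move=> p2 mu1 bu' bv uu'; have [mu' _ _] := bu'; have [mv _ v0] := bv.
have mf (f : V -> R) : measurable_fun setT f ->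
    measurable_fun setT (fun x : V => (`|f x| `^ (p - 2) * f x * v x)%:E : \bar R).
  move=> mf; apply/measurable_EFinP; apply: measurable_funM => //.
  apply: measurable_funM => //.
  by apply: (measurableT_comp (measurable_powR _)); exact: measurableT_comp.
have bf : bsupp Omega (fun x => `|u' x| `^ (p - 2) * u' x * v x).
  by apply: bsuppM => //; apply: bsuppM => //; apply: bsupp_powR => //; rewrite subr_gt0.
rewrite -(bsupp_EFin mO Ofin bf) integral_mkcond.
apply: ae_eq_integral => //; last 2 first.
- exact: mf.
- apply: (ae_imp _ uu') => x ux _; rewrite patchE -ux; case: ifPn => // /negP.
  by rewrite inE => Ox; rewrite v0// mulr0.
- by apply/(measurable_restrictT _ mO); apply: measurable_funTS; exact: mf.
Qed.

End weak_formulation.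

Lemma c_Ns_ge0 {R : realType} (N : nat) (s : R) : 0 <= s -> 0 <= c_Ns N s.
Proof.
move=> s0; have G0 a : 0 <= Gamma a :> R.
  by apply: Rintegral_ge0 => t _; rewrite mulr_ge0 ?powR_ge0 ?expR_ge0.
by rewrite /c_Ns divr_ge0// !mulr_ge0// powR_ge0.
Qed.

Theorem corollary1p7 (R : realType) (N : nat) (s : R)
    (Omega : set 'rV[R]_N) (nu X : 'rV[R]_N -> 'rV[R]_N)
    (c1 c2 p : R) (u : 'rV[R]_N -> R) :
  (1 <= N)%N ->
  0 < s < 1 ->
  open Omega -> bounded_set Omega -> C11_domain Omega ->
  (forall x, topological_boundary Omega x -> outer_unit_normal Omega x (nu x)) ->
  lipschitz X ->
  {ae lebesgue_measure_rV N, forall x, c1 <= divergence X x} ->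
  (forall x y, dot (X x - X y) (x - y) <= c2 * enorm (x - y) ^+ 2) ->
  0 < c2 ->
  c2 * N%:R / 2 < c1 <= c2 * N%:R ->
  0 < s < c1 / c2 - N%:R / 2 ->
  p > 2 * N%:R / (2 * c1 / c2 - (N%:R + 2 * s)) ->
  weak_solution s Omega (fun t => `|t| `^ (p - 2) * t) u ->
  (forall x, topological_boundary Omega x -> 0 <= dot (X x) (nu x)) ->
  {ae lebesgue_measure_rV N, forall x, u x = 0}.
Proof.
case: N => [//|n] in Omega nu X u *; set N := n.+1.
move=> _ /andP[s0 s1] oO bO _ Onu Xlip Xdiv Xdot c20 /andP[c1l c1u] /andP[_ sl] pl
  [[[uL2 uE] u0] ubd weak] Xnu.
pose mu := @lebesgue_measure_rV R N.
have mO := open_measurable_rV oO.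
have Ofin := bounded_set_measure_lty mO bO.
have mu1 : measurable_fun setT u.
  by move: uL2; rewrite inE => /andP[+ _]; rewrite inE.
have [u' bu' uu'] := bounded_representative mO mu1 u0 ubd.
suff H : {ae mu, forall x, u' x = 0} by apply: (ae_imp2 _ uu' H) => x -> .
pose q := N%:R + 2 * s; pose a := c1 / c2.
have ac : c1 = a * c2 by rewrite /a mulfVK// gt_eqF.
have N1 : 1 <= N%:R :> R by rewrite ler1n.
have a1 : a <= N%:R by rewrite /a ler_pdivrMr// mulrC.
pose D := 2 * a - q.
have D0 : 0 < D by rewrite /D /q; rewrite -/a in sl; lra.
have DN : D < N%:R by rewrite /D /q; lra.
have {}pl : 2 * N%:R / D < p by rewrite /D /a mulrA.
have pD : 2 * N%:R < p * D by rewrite -ltr_pdivrMr.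
(* Since [D < N], the lower bound [2 * N / D] for [p] exceeds 2. *)
have p2 : 2 < p.
  apply: lt_trans pl; rewrite ltr_pdivlMr//; lra.
have p0 : 0 < p by lra.
apply: (Rintegral_powR_eq0 mO Ofin p0 bu').
have [mu1' _ _] := bu'.
pose kap := c_Ns N s / 2.
have kap0 : 0 <= kap by rewrite divr_ge0// c_Ns_ge0// ltW.
have weak' v : bsupp Omega v -> (kap%:E * gag q v v < +oo)%E ->
    (kap%:E * gag q u' v)%E = (\int[mu]_x (`|u' x| `^ (p - 2) * u' x * v x))%:E.
  move=> bv vE; have [mv _ v0] := bv.
  rewrite -(integral_weak_ae mO Ofin p2 mu1 bu' bv uu') -weak.
    by rewrite -(gag_ae q mu1 mu1' mv uu').
  split; last by apply: nearW => x; exact: v0.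
  by split => //; exact: (bsupp_Lfun2 mO Ofin).
(* Only [0 <= kap] has been established. If [kap = 0], the weak equation tested with [u'] itself
   already gives a vanishing integral. *)
have [kap1|kap1] := eqVneq kap 0.
  have := weak' _ bu'; rewrite kap1 mul0e => /(_ (ltry _)) [] /esym.
  by move=> <-; apply: eq_Rintegral => x _; rewrite powR_normr_mulr.
have {kap1}kap0 : 0 < kap by rewrite lt_neqAle eq_sym kap1.
(* [gag_ae] changes the first argument only, so the two arguments are replaced in turn around
   [gagC]. *)
have guu : (gag q u' u' < +oo)%E.
  rewrite -(gag_ae q mu1 mu1' mu1' uu') gagC -(gag_ae q mu1 mu1' mu1 uu') ltey.
  apply/eqP => goo; move: uE; rewrite /energy -/kap.
  change (~ (kap%:E * gag q u u < +oo)%E) => //.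
  by rewrite goo mulry gtr0_sg// mul1e.
(* [g] is the strict margin left by the condition on [p] at the constants [c1] and [c2]. Passing to
   [c1 - e] and [c2 + e] lowers it by exactly [e * k], and [e] spends half of it. *)
pose g := 2 * c1 - c2 * q - 2 * (N%:R * c2 / p).
have pN : c2 * (2 * N%:R / p) < c2 * D by rewrite ltr_pM2l// ltr_pdivrMr// [ltRHS]mulrC.
have g0 : 0 < g.
  by move: pN; rewrite /g /D ac; lra.
pose k := 2 + q + 2 * N%:R / p.
have q0 : 0 <= q by rewrite addr_ge0// mulr_ge0// ltW.
have k0 : 0 < k.
  by rewrite /k; have : 0 <= 2 * N%:R / p by [rewrite divr_ge0// ltW]; lra.
pose e := g / k / 2.
have e0 : 0 < e by rewrite !divr_gt0.
have gek : e * k < g by rewrite /e mulrAC mulfVK ?gt_eqF// ltr_pdivrMr//; lra.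
pose alpha := c1 - e; pose gamma := c2 + e.
have alphac : alpha < c1 by rewrite /alpha; lra.
have cgamma : c2 < gamma by rewrite /gamma; lra.
have [Y [C0 [C00 HY]]] := good_field oO bO Onu Xlip Xdiv Xdot Xnu alphac cgamma.
have gamma0 : 0 < gamma by rewrite /gamma; lra.
have mu2 : 2 * (N%:R * gamma) / p < 2 * alpha - gamma * q.
  by move: gek; rewrite /g /k /alpha /gamma; lra.
have mu0 : 0 < 2 * alpha - gamma * q.
  by apply: le_lt_trans mu2; rewrite divr_ge0 ?(ltW p0)// mulr_ge0// mulr_ge0// ltW.
have alpha0 : 0 <= alpha.
  by have : 0 <= gamma * q by [rewrite mulr_ge0// ltW]; lra.
apply: (weak_solution_vanishes mO Ofin s0 kap0 p2 alpha0 mu0 mu2 bu' guu _ C00 HY) => v bv gv.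
by apply: weak' => //; rewrite lte_mul_pinfty// lee_fin ltW.
Qed.
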